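(* Let $q$ be a power of a prime $p$, let $Q\in\mathbb F_q[x]$ be monic of degree $t\ge 0$, let $D:=\{x\in\mathbb F_q: Q(x)\neq 0\}$, $n:=|D|$, and let $\ell\ge 1$ be an integer. Let $k$ be a positive integer, and put $c:=k/q$ and $\gamma:=(t+\ell-1)\sqrt q/n$. Let $\delta_0>0$ be a constant (independent of $k$). Suppose that one of the following two conditions holds: Condition A: $$\frac{p-1}{p}\,c\ln\frac1c+(1-c)\ln\frac1{1-c}-\frac{1+c}{p}\ln(1+c)\ \ge\ \gamma\ln(2p)+\delta_0;$$ Condition B: $p\to\infty$, $\gamma\ge \dfrac{c}{p}$, and $$c\ln\frac1c+(1-c)\ln\frac{1}{1-c}\ \ge\ \gamma+\gamma\ln\frac{c+\gamma}{\gamma}+\delta_0 .$$ Then, as $k\to\infty$, uniformly for all integers $0\le r\le k+t+\ell$ and all $\varepsilon\in\mathcal E^{\ell,Q}$, $$\mathbb P(Y_k(\varepsilon)=r)\sim \mu_{k+t+\ell-r}(r)\binom{n}{r}q^{-r},$$ where $Y_k(\varepsilon)$ is the number of distinct zeros lying in $D$ of a uniformly random polynomial $f\in\mathcal M_{k+t+\ell}(\varepsilon)$, and $$\mu_m(r)=\sum_{j=0}^{m}(-1)^j\binom{n-r}{j}q^{-j}.$$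
   Context: $\mathcal M$ is the set of monic polynomials over the finite field $\mathbb F_q$, and $\mathcal M_d$ the set of those of degree $d$. For $f\in\mathcal M$ put $\hat f(x)=x^{\deg f}f(1/x)$. Fix an integer $\ell\ge 0$ and $Q\in\mathcal M$. Two polynomials $f,g\in\mathcal M$ are Hayes equivalent with respect to $\ell$ and $Q$ if $\gcd(f,Q)=\gcd(g,Q)=1$, $\hat f\equiv\hat g \pmod{x^{\ell+1}}$ and $f\equiv g\pmod Q$. $\mathcal E^{\ell,Q}$ denotes the set of equivalence classes (of monic polynomials coprime to $Q$); it is a finite abelian group under $\langle f\rangle\langle g\rangle=\langle fg\rangle$. For $\varepsilon\in\mathcal E^{\ell,Q}$, $\mathcal M_{d}(\varepsilon)$ is the set of polynomials in $\mathcal M_d$ belonging to the class $\varepsilon$ (for $k\ge0$ and $t=\deg Q$ one has $|\mathcal M_{k+t+\ell}(\varepsilon)|=q^k$). The statement concerns sequences of parameters $(q,Q,\ell,k)$ with $k\to\infty$, where $\delta_0$ is fixed along the sequence, and where either every member satisfies the inequality in Condition A, or $p\to\infty$ along the sequence and every member satisfies the two inequalities of Condition B. The conditions presuppose that their expressions are defined, i.e. $n\ge1$ and $0<c<1$. ''Uniformly'' means that $\mathbb P(Y_k(\varepsilon)=r)=(1+o(1))\,\mu_{k+t+\ell-r}(r)\binom nr q^{-r}$ with the $o(1)$ tending to $0$ uniformly over $r$ and $\varepsilon$. *)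

(* Defs.v *)
From HB Require Import structures.
From mathcomp Require Import all_boot all_order all_algebra.
From mathcomp Require Import qpoly.
From mathcomp Require Import all_classical all_reals all_analysis.

Set Implicit Arguments.
Unset Strict Implicit.
Unset Printing Implicit Defensive.

Import Order.TTheory GRing.Theory Num.Theory.
Import numFieldNormedType.Exports.

Local Open Scope ring_scope.

Section Hayes.
Variable F : finFieldType.
Implicit Types f g Q : {poly F}.

Definition deg f : nat := (size f).-1.

(* x^(deg f) * f(1/x): the coefficients of f in reverse order *)
Definition revp f : {poly F} := \poly_(i < size f) f`_(deg f - i).

Definition hayes_equiv (l : nat) Q f g : Prop :=
  [/\ coprimep f Q, coprimep g Q,
      revp f %% 'X^(l.+1) = revp g %% 'X^(l.+1) & f %% Q = g %% Q].

Definition hayes_class (l : nat) Q f : set {poly F} :=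
  [set g | g \is monic /\ hayes_equiv l Q f g]%classic.

Definition hayes_classes (l : nat) Q : set (set {poly F}) :=
  [set e | exists f, [/\ f \is monic, coprimep f Q
                       & e = hayes_class l Q f]]%classic.

(* the polynomials of size at most d.+1 form a finite type,
   so this is a finite set *)
Definition monics_in (d : nat) (e : set {poly F}) : {set {poly_(d.+1) F}} :=
  finset (fun f : {poly_(d.+1) F} =>
    [&& (f : {poly F}) \is monic, deg f == d & (f : {poly F}) \in e]).

Definition nonzeros Q : {set F} := finset (fun x : F => ~~ root Q x).

Definition num_zeros Q f : nat :=
  #|finset (fun x : F => (x \in nonzeros Q) && root f x)|.

End Hayes.

Definition unif_on (R : realType) (T : finType) (A : {set T})
    (P : pred T) : R :=
  #|finset (fun x : T => (x \in A) && P x)|%:R / #|A|%:R.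

Section Asymptotics.
Variables (R : realType) (F : finFieldType) (Q : {poly F}) (l k : nat).

Definition prob_num_zeros (e : set {poly F}) (r : nat) : R :=
  unif_on R (monics_in (k + deg Q + l) e)
    (fun f => num_zeros Q f == r).

(* For r > n the subtraction n - r truncates; there the factor 'C(n, r)
   in [main_term] is 0, so the value of [mu] is immaterial. *)
Definition mu (m r : nat) : R :=
  \sum_(0 <= j < m.+1)
    (-1) ^+ j * 'C(#|nonzeros Q| - r, j)%:R * #|F|%:R ^- j.

Definition main_term (r : nat) : R :=
  mu (k + deg Q + l - r) r * 'C(#|nonzeros Q|, r)%:R * #|F|%:R ^- r.

Definition cpar : R := k%:R / #|F|%:R.

Definition gammapar : R :=
  ((deg Q)%:R + l%:R - 1) * Num.sqrt #|F|%:R / #|nonzeros Q|%:R.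

(* Positivity of #|nonzeros Q| and 0 < c < 1 ensure that the fractions and
   logarithms are meaningful, [ln] and [/] being total functions. *)
Definition params_defined : Prop :=
  (0 < #|nonzeros Q|)%N /\ 0 < cpar < 1.

Definition conditionA (p : nat) (delta0 : R) : Prop :=
  params_defined /\
  let c := cpar in let gamma := gammapar in let P := p%:R : R in
  (P - 1) / P * c * ln (1 / c) + (1 - c) * ln (1 / (1 - c))
    - (1 + c) / P * ln (1 + c)
  >= gamma * ln (2 * P) + delta0.

Definition conditionB (p : nat) (delta0 : R) : Prop :=
  params_defined /\
  let c := cpar in let gamma := gammapar in
  gamma >= c / p%:R /\
  c * ln (1 / c) + (1 - c) * ln (1 / (1 - c))
  >= gamma + gamma * ln ((c + gamma) / gamma) + delta0.

End Asymptotics.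

(* Main.v *)
Require Import Defs.
From HB Require Import structures.
From mathcomp Require Import all_classical all_reals all_analysis.
From mathcomp Require Import all_boot all_order all_algebra all_fingroup.
From mathcomp Require Import all_field all_character.
From mathcomp Require Import qpoly.
From mathcomp Require Import zify ring lra.
Set Implicit Arguments.
Unset Strict Implicit.
Unset Printing Implicit Defensive.
Import Order.TTheory GRing.Theory Num.Theory.
Import numFieldNormedType.Exports.
Local Open Scope ring_scope.

(** Shift the variable so that [Q] does not vanish at 0. Among the monic polynomials of
    a fixed degree the Hayes class of [f] is then the residue of the reversal of [f]
    modulo [h = x^(l+1) rev(Q)], and a random member of a class is a random polynomial
    with a prescribed residue. The number of [j]-subsets [S] of [D] with [\prod_(x in S)
    ('X - x)] in a given class determines the [j]-th binomial moment of the number of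
    zeros in [D], and inclusion-exclusion recovers the distribution: for [j <= k] the
    moments are exactly those of the main term, so only [k < j <= k+t+l] matters.

    For such [j] one expands in characters of the residue group. Weil's bound [|\sum_(x
    in D) chi(x)| <= (t+l-1) sqrt q] makes the average of [chi] over [D] at most [gamma]
    in modulus. Either condition gives [H(c) >= gamma + delta0] with [H(c) = c ln(1/c) +
    (1-c) ln(1/(1-c)) <= 1]; hence [gamma <= 1 - delta0] and [c] stays away from 0 and
    1. With [a = n-j] and [b = j], the AM-GM inequality bounds [\prod_(x in D) |a + b
    chi(x) z|] on the unit circle by [e^(-const n)] times its value for the trivial
    character, so the subset counts are equidistributed up to an exponentially small
    relative error, which absorbs the [q^(t+l)] classes because [t+l-1 <= sqrt q].

    Weil's bound is obtained by the Bombieri-Stepanov method. The series [Z = \sum_n Z_n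
    t^n] over the residue ring with [Z(t^q) = (1 - t w) Z(t)] generates the ray class
    field of modulus [h], and the Galois group acts on it by [Z |-> sigma Z]. An
    auxiliary function built from [r]-th powers, [r = q^e], bounds from above the number
    of points of degree dividing [2e] with a given Frobenius element; as these numbers
    sum to [q^(2e)] up to [O(1)], the upper bounds are also lower bounds. Newton's
    identities then turn [|\sum p_i| = O(q^(i/2))] for even [i] into a bound on the
    inverse roots of the L-polynomial. *)

(** * Power series *)

(** Iterating the functional equation gives [Z = \prod_i 1 / (1 - w t^(q^i))], with [w] the class of
    the variable modulo [h]: a Lang torsor under the units of the residue ring. Where [t] takes a
    value of degree [d] with minimal polynomial [P], the [d]-th iterate of the [q]-Frobenius
    multiplies [Z] by the norm [\prod_(i < d) (1 - t^(q^i) w)], which is the reversal of [P]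
    evaluated at [w]. This is why residues of reversals are Frobenius elements.

    The cover is studied inside [F[[t]]]: a linear form turns [Z] into coordinates, functions are
    filtered by weight in [t] and the coordinates, and a basis over [F[t]] with a bounded loss [C]
    of degree plays the part of Riemann-Roch. Which shifts of [Z] respect the relations between the
    coordinates is not known beforehand; the group [H] of these shifts may be proper, and its order
    is only compared with the rank [N]. The constants of this stage depend on [F] and [h]. They
    disappear as [e] grows, because a bound on all large power sums up to a constant factor is an
    exact bound on each root. *)

Record fps (F : Type) := Fps { cf : nat -> F }.
HB.instance Definition _ (F : Type) := gen_eqMixin (fps F).
HB.instance Definition _ (F : Type) := gen_choiceMixin (fps F).

Lemma fpsP (F : Type) (f g : fps F) : (forall n, cf f n = cf g n) -> f = g.
Proof. by case: f g => [f] [g] /= E; congr Fps; apply: functional_extensionality_dep. Qed.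

Section FpsRing.
Variable F : comNzRingType.
Implicit Types f g h : fps F.

Definition fps_trunc n f : {poly F} := \poly_(i < n) cf f i.
Definition fps0 : fps F := Fps (fun _ => 0).
Definition fps1 : fps F := Fps (fun n => (n == 0%N)%:R).
Definition fps_opp f := Fps (fun n => - cf f n).
Definition fps_add f g := Fps (fun n => cf f n + cf g n).
Definition fps_mul f g :=
  Fps (fun n => \sum_(j < n.+1) cf f j * cf g (n - j)%N).

(** A coefficient of a product involves finitely many terms, so the ring laws of series are
    inherited from polynomial truncations. *)
Lemma cf_mul_poly f g n (p r : {poly F}) :
  (forall i, (i <= n)%N -> p`_i = cf f i) ->
  (forall i, (i <= n)%N -> r`_i = cf g i) -> cf (fps_mul f g) n = (p * r)`_n.
Proof.
move=> pf rg; rewrite coefM /=; apply: eq_bigr => i _.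
by rewrite pf ?rg ?leq_subr // -ltnS.
Qed.

Lemma coef_fps_trunc n f i : (i < n)%N -> (fps_trunc n f)`_i = cf f i.
Proof. by move=> lt_in; rewrite coef_poly lt_in. Qed.

Lemma fps_addA : associative fps_add.
Proof. by move=> f g h; apply: fpsP => n /=; rewrite addrA. Qed.
Lemma fps_addC : commutative fps_add.
Proof. by move=> f g; apply: fpsP => n /=; rewrite addrC. Qed.
Lemma fps_add0 : left_id fps0 fps_add.
Proof. by move=> f; apply: fpsP => n /=; rewrite add0r. Qed.
Lemma fps_addN : left_inverse fps0 fps_opp fps_add.
Proof. by move=> f; apply: fpsP => n /=; rewrite addNr. Qed.
HB.instance Definition _ :=
  GRing.isZmodule.Build (fps F) fps_addA fps_addC fps_add0 fps_addN.

Lemma fps_mulC : commutative fps_mul.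
Proof.
move=> f g; apply: fpsP => n.
have tr := coef_fps_trunc.
rewrite (@cf_mul_poly f g n (fps_trunc n.+1 f) (fps_trunc n.+1 g)); try by move=> *; apply: tr.
by rewrite mulrC; symmetry; apply: cf_mul_poly => *; apply: tr.
Qed.

Lemma fps_mulA : associative fps_mul.
Proof.
move=> f g h; apply: fpsP => n.
pose tr := fps_trunc n.+1.
have trE u i : (i <= n)%N -> (tr u)`_i = cf u i by move=> le_in; apply: coef_fps_trunc.
have trM u v i : (i <= n)%N -> (tr u * tr v)`_i = cf (fps_mul u v) i.
  by move=> le_in; symmetry; apply: cf_mul_poly => j le_ji; rewrite trE ?(leq_trans le_ji).
rewrite (@cf_mul_poly _ _ n (tr f) (tr g * tr h)) ?mulrA; try by move=> *; auto.
by symmetry; apply: cf_mul_poly; auto.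
Qed.

Lemma fps_mul1 : left_id fps1 fps_mul.
Proof.
move=> f; apply: fpsP => n /=; rewrite big_ord_recl /= mul1r subn0 big1 ?addr0 // => i _.
by rewrite mul0r.
Qed.
Lemma fps_mulDl : left_distributive fps_mul fps_add.
Proof.
move=> f g h; apply: fpsP => n /=; rewrite -big_split /=.
by apply: eq_bigr => i _; rewrite mulrDl.
Qed.
Lemma fps_1neq0 : fps1 != 0 :> fps F.
Proof. by apply/eqP => /(congr1 (fun f => cf f 0)) /= /eqP; rewrite oner_eq0. Qed.
HB.instance Definition _ := GRing.Zmodule_isComNzRing.Build (fps F)
  fps_mulA fps_mulC fps_mul1 fps_mulDl fps_1neq0.

Lemma cfD f g n : cf (f + g) n = cf f n + cf g n. Proof. by []. Qed.
Lemma cfB f g n : cf (f - g) n = cf f n - cf g n. Proof. by []. Qed.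
Lemma cf0 n : cf (0 : fps F) n = 0. Proof. by []. Qed.
Lemma cf1 n : cf (1 : fps F) n = (n == 0%N)%:R. Proof. by []. Qed.
Lemma cfM f g n : cf (f * g) n = \sum_(j < n.+1) cf f j * cf g (n - j)%N.
Proof. by []. Qed.

Lemma cf_sum (I : Type) (s : seq I) (P : pred I) (f : I -> fps F) n :
  cf (\sum_(i <- s | P i) f i) n = \sum_(i <- s | P i) cf (f i) n.
Proof. by elim/big_rec2: _ => // i x y _ <-. Qed.

Definition pofp (p : {poly F}) : fps F := Fps (fun n => p`_n).

Lemma pofp_is_zmod : zmod_morphism pofp.
Proof. by move=> p r; apply: fpsP => n; rewrite cfB /= coefB. Qed.
HB.instance Definition _ := GRing.isZmodMorphism.Build {poly F} (fps F) pofp pofp_is_zmod.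
Lemma pofp_is_monoid : monoid_morphism pofp.
Proof.
split=> [|p r]; apply: fpsP => n; first by rewrite cf1 /= coef1.
by rewrite cfM /= coefM.
Qed.
HB.instance Definition _ := GRing.isMonoidMorphism.Build {poly F} (fps F) pofp pofp_is_monoid.

Lemma pofp_inj : injective pofp.
Proof. by move=> p r E; apply/polyP => i; have := congr1 (fun f => cf f i) E. Qed.

Lemma cfZ c f n : cf (pofp c%:P * f) n = c * cf f n.
Proof.
rewrite cfM big_ord_recl /= coefC eqxx subn0 big1 ?addr0 // => i _.
by rewrite coefC mul0r.
Qed.

Definition fpsX : fps F := pofp 'X.

Lemma cfXnM m f n : cf (fpsX ^+ m * f) n = if (n < m)%N then 0 else cf f (n - m).
Proof.
rewrite /fpsX -rmorphXn cfM /=; case: ltnP => [lt_nm|le_mn].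
  rewrite big1 // => j _; rewrite coefXn ltn_eqF ?mul0r //.
  exact: leq_trans (ltn_ord j) lt_nm.
have lt_mn : (m < n.+1)%N by [].
rewrite (bigD1 (Ordinal lt_mn)) //= coefXn eqxx mul1r big1 ?addr0 // => j.
by rewrite -val_eqE /= coefXn => /negPf->; rewrite mul0r.
Qed.

Lemma cfXM f n : cf (fpsX * f) n = if n is m.+1 then cf f m else 0.
Proof. by rewrite -[fpsX]expr1 cfXnM; case: n => [|n] //=; rewrite subSS subn0. Qed.

Definition vanish m f := forall i, (i < m)%N -> cf f i = 0.

Lemma vanish_dvd m f : vanish m f -> exists g, f = fpsX ^+ m * g.
Proof.
move=> f0; exists (Fps (fun n => cf f (n + m))); apply: fpsP => n.
by rewrite cfXnM; case: ltnP => [/f0//|le_mn]; rewrite /= subnK.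
Qed.

Lemma dvd_vanish m g : vanish m (fpsX ^+ m * g).
Proof. by move=> i lt_im; rewrite cfXnM lt_im. Qed.

Lemma fps_order f : f != 0 -> exists m, vanish m f /\ cf f m != 0.
Proof.
move=> nz_f; have exm : exists n, cf f n != 0.
  case: (pselect (exists n, cf f n != 0)) => // nex; case/eqP: nz_f.
  by apply: fpsP => n; apply: contrapT => /eqP nz; apply: nex; exists n.
case: (ex_minnP exm) => m nzm min_m; exists m; split => // i lt_im.
by apply: contraTeq lt_im => /min_m; rewrite leqNgt.
Qed.

End FpsRing.

Section FpsField.
Variable F : fieldType.
Implicit Types f g : fps F.

(** Leading terms multiply, which makes [fps F] a domain; its fraction field serves in the
    independence of the shifts of [Z]. *)
Lemma cf_mul_order m n f g : vanish m f -> vanish n g ->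
  cf (f * g) (m + n) = cf f m * cf g n.
Proof.
move=> /vanish_dvd[f' ->] /vanish_dvd[g' ->].
rewrite mulrACA -exprD !cfXnM !ltnn !subnn cfM.
by rewrite big_ord_recl big_ord0 addr0 subn0.
Qed.

Lemma fps_mul_eq0 f g : f * g = 0 -> (f == 0) || (g == 0).
Proof.
move=> fg0; apply/norP => -[/fps_order[m [vf fm]] /fps_order[n [vg gn]]].
have := cf_mul_order vf vg; rewrite fg0 cf0 => /esym/eqP.
by rewrite mulf_eq0 (negPf fm) (negPf gn).
Qed.

Definition fps_unit : pred (fps F) := fun f => `[< exists g, g * f = 1 >].
Definition fps_inv f : fps F :=
  if pselect (exists g, g * f = 1) is left ex then projT1 (cid ex) else f.

Lemma fps_mulVr : {in fps_unit, left_inverse 1 fps_inv *%R}.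
Proof.
move=> f /asboolP uf; rewrite /fps_inv; case: pselect => // ex.
exact: (projT2 (cid ex)).
Qed.
Lemma fps_unitPl f g : g * f = 1 -> fps_unit f.
Proof. by move=> gf; apply/asboolP; exists g. Qed.
Lemma fps_inv_out : {in [predC fps_unit], fps_inv =1 id}.
Proof. by move=> f /asboolP uf; rewrite /fps_inv; case: pselect. Qed.
HB.instance Definition _ := GRing.ComNzRing_hasMulInverse.Build (fps F)
  fps_mulVr fps_unitPl fps_inv_out.
HB.instance Definition _ := GRing.ComUnitRing_isIntegral.Build (fps F) fps_mul_eq0.
End FpsField.

(** * The Frobenius on power series and polynomials *)

Section Frobenius.
Variable F : finFieldType.
Local Notation q := #|F|.

Lemma card_gt1 : (1 < q)%N. Proof. exact: finNzRing_gt1. Qed.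

Lemma expf_card_exp e (c : F) : c ^+ (q ^ e) = c.
Proof. by elim: e => [|e IH]; rewrite ?expr1 // expnSr exprM IH expf_card. Qed.

Lemma pchar_nat_card e : [pchar F].-nat (q ^ e)%N.
Proof.
have [p p_pr pF] := finPcharP F.
have := card_pprimeChar pF; rewrite (eq_card (B := F)) // => ->.
by rewrite -expnM (eq_pnat _ (pcharf_eq pF)) pnatX pnat_id.
Qed.

(** The morphism [h] only transports the characteristic of [F] to [S]. *)
Lemma frobD (S : comNzRingType) (h : {rmorphism F -> S}) e (x y : S) :
  (x + y) ^+ (q ^ e) = x ^+ (q ^ e) + y ^+ (q ^ e).
Proof.
apply: exprDn_pchar; apply: sub_in_pnat (pchar_nat_card e) => p _.
exact: rmorph_pchar.
Qed.

Definition fps_const : F -> fps F := @pofp F \o polyC.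
HB.instance Definition _ := GRing.RMorphism.on fps_const.

Lemma fps_frobD e (f g : fps F) : (f + g) ^+ (q ^ e) = f ^+ (q ^ e) + g ^+ (q ^ e).
Proof. exact: (frobD fps_const). Qed.

Lemma poly_frobD e (f g : {poly F}) : (f + g) ^+ (q ^ e) = f ^+ (q ^ e) + g ^+ (q ^ e).
Proof. exact: (frobD polyC). Qed.

Lemma fps_frobN e (f : fps F) : (- f) ^+ (q ^ e) = - f ^+ (q ^ e).
Proof.
apply/eqP; rewrite -addr_eq0 -fps_frobD addNr expr0n.
by rewrite expn_eq0 eqn0Ngt (ltnW card_gt1).
Qed.

Lemma fps_frobB e (f g : fps F) : (f - g) ^+ (q ^ e) = f ^+ (q ^ e) - g ^+ (q ^ e).
Proof. by rewrite fps_frobD fps_frobN. Qed.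

Lemma frob_gt0 e : (0 < q ^ e)%N. Proof. by rewrite expn_gt0 (ltnW card_gt1). Qed.

Lemma fps_frob_sum e (I : Type) (s : seq I) (P : pred I) (f : I -> fps F) :
  (\sum_(i <- s | P i) f i) ^+ (q ^ e) = \sum_(i <- s | P i) f i ^+ (q ^ e).
Proof.
apply: (big_morph (fun f : fps F => f ^+ (q ^ e))); first exact: fps_frobD.
by rewrite expr0n eqn0Ngt frob_gt0.
Qed.

Lemma poly_frob e (p : {poly F}) : p ^+ (q ^ e) = p \Po 'X^(q ^ e).
Proof.
elim/poly_ind: p => [|p c IH]; first by rewrite comp_poly0 expr0n eqn0Ngt frob_gt0.
by rewrite poly_frobD exprMn IH -polyC_exp expf_card_exp comp_polyD comp_polyM comp_polyX comp_polyC.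
Qed.

(** The Frobenius fixes coefficients, so [f ^+ (q ^ e)] is [f] with [t] replaced by [t^(q^e)]; the
    tail beyond degree [n] contributes nothing up to degree [n], and the truncation falls under
    [poly_frob]. *)
Lemma cf_frob e (f : fps F) n :
  cf (f ^+ (q ^ e)) n = if (q ^ e %| n)%N then cf f (n %/ q ^ e) else 0.
Proof.
set r := (q ^ e)%N; have r_gt0 : (0 < r)%N := frob_gt0 e.
pose p := fps_trunc n.+1 f.
have vp : vanish n.+1 (f - pofp p).
  by move=> i lt_in; rewrite cfB /= coef_fps_trunc // subrr.
have [g Eg] := vanish_dvd vp.
rewrite (_ : f ^+ r = (pofp p + fpsX F ^+ n.+1 * g) ^+ r); last by rewrite -Eg addrC subrK.
rewrite fps_frobD cfD exprMn -exprM cfXnM ifT; last exact: leq_pmulr.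
rewrite addr0 -rmorphXn poly_frob /= -/r.
have -> : (p \Po 'X^r)`_n = if (r %| n)%N then p`_(n %/ r) else 0.
  rewrite comp_polyE coef_sum.
  under eq_bigr => i _ do rewrite coefZ -exprM coefXn mulrC.
  case: ifP => [r_n|nr_n]; last first.
    apply: big1 => i _; case: eqP => [En|_]; last by rewrite mul0r.
    by rewrite En dvdn_mulr in nr_n.
  have [lt_n|le_n] := ltnP (n %/ r) (size p).
    rewrite (bigD1 (Ordinal lt_n)) //= mulnC divnK // eqxx mul1r big1 ?addr0 // => i.
    rewrite -val_eqE /= => ne_i; case: eqP => [En|_]; last by rewrite mul0r.
    by rewrite En mulKn ?eqxx in ne_i.
  rewrite nth_default // big1 // => i _; case: eqP => [En|_]; last by rewrite mul0r.
  by rewrite En mulKn // leqNgt ltn_ord in le_n.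
by case: ifP => // _; rewrite coef_fps_trunc // ltnS leq_div.
Qed.
End Frobenius.

(** * The algebra generated by the torsor coordinates *)

Section Torsor.
Variables (F : finFieldType) (A : finComUnitRingType) (iota : {rmorphism F -> A}).
Variables (w : A) (lam : {additive A -> F}).
Hypothesis lamZ : forall c a, lam (iota c * a) = c * lam a.
Local Notation q := #|F|.

(** Coefficients of [Z], read off from [Z(t) = t w Z(t) + Z(t^q)]. The call at [n %/ q] is not
    structural, hence the fuel. *)
Fixpoint tors_rec fuel n : A :=
  if fuel is k.+1 then
    if n is n'.+1 then w * tors_rec k n' + (if (q %| n)%N then tors_rec k (n %/ q)%N else 0)
    else 1
  else 0.
Definition tors n := tors_rec n.+1 n.

Lemma tors_rec_fuel k n : (n < k)%N -> tors_rec k n = tors n.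
Proof.
rewrite /tors; have: (n < n.+1)%N by [].
move: {2 4}n.+1 => m; elim: k m n => [|k IH] [|m] [|n] //= lt_nm lt_nk.
have lt_div : (n.+1 %/ q < n.+1)%N by rewrite ltn_Pdiv ?card_gt1.
rewrite (IH m) //; case: ifP => // _; congr (_ + _); apply: IH; exact: leq_trans lt_div _.
Qed.

Lemma torsS n : tors n.+1 = w * tors n + (if (q %| n.+1)%N then tors (n.+1 %/ q)%N else 0).
Proof.
rewrite {1}/tors [tors_rec n.+2 _]/(w * tors_rec n.+1 n
  + (if (q %| n.+1)%N then tors_rec n.+1 (n.+1 %/ q)%N else 0)).
congr (_ * _ + _); case: ifP => // _; apply: tors_rec_fuel; exact: ltn_Pdiv (card_gt1 F) _.
Qed.

(** The coordinate [lam(a Z)]. Letting [a] vary keeps all information on [Z] while working in the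
    domain [F[[t]]] instead of the ring of series over [A]. *)
Definition yser (a : A) : fps F := Fps (fun n => lam (a * tors n)).

Lemma yserB a b : yser (a - b) = yser a - yser b.
Proof. by apply: fpsP => n; rewrite cfB /= mulrBl raddfB. Qed.
HB.instance Definition _ := GRing.isZmodMorphism.Build A (fps F) yser yserB.

(* With Z = \sum_n tors n t^n this is Z(t^q) = (1 - t w) Z(t) read through lam. *)
Lemma yser_frob a : yser a ^+ q = yser a - fpsX F * yser (w * a).
Proof.
apply: fpsP => n; rewrite -[q]expn1 cf_frob expn1 cfB cfXM /=.
case: n => [|n]; first by rewrite dvdn0 div0n subr0.
rewrite torsS [w * a]mulrC mulrDr !mulrA raddfD /= addrAC subrr add0r.
by case: ifP => // _; rewrite mulr0 raddf0.
Qed.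

(** The series [lam(p Z)] for a polynomial [p] in [t] over [A]; iterates of the Frobenius multiply
    [Z] by such polynomials. *)
Definition yserP (p : {poly A}) : fps F :=
  Fps (fun n => lam (\sum_(i < n.+1) p`_i * tors (n - i))).

Lemma yserPB p r : yserP (p - r) = yserP p - yserP r.
Proof.
apply: fpsP => n; rewrite cfB /= -raddfB -sumrB.
by congr (lam _); apply: eq_bigr => i _; rewrite coefB mulrBl.
Qed.
HB.instance Definition _ := GRing.isZmodMorphism.Build {poly A} (fps F) yserP yserPB.

Lemma yserPC a : yserP a%:P = yser a.
Proof.
apply: fpsP => n /=; rewrite big_ord_recl coefC eqxx subn0 big1 ?addr0 // => i _.
by rewrite coefC mul0r.
Qed.

Lemma yserPX p : yserP ('X * p) = fpsX F * yserP p.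
Proof.
apply: fpsP => n; rewrite cfXM; case: n => [|n] /=.
  by rewrite big_ord1 coefXM mul0r raddf0.
rewrite big_ord_recl coefXM mul0r add0r.
by congr (lam _); apply: eq_bigr => i _; rewrite coefXM /= subSS.
Qed.

Lemma yserPXn m p : yserP ('X^m * p) = fpsX F ^+ m * yserP p.
Proof.
elim: m => [|m IH]; first by rewrite !mul1r.
by rewrite exprS -mulrA yserPX IH mulrA -exprS.
Qed.

Lemma yserPZ c p : yserP ((iota c)%:P * p) = pofp c%:P * yserP p.
Proof.
apply: fpsP => n; rewrite cfZ /= -lamZ mulr_sumr.
by congr (lam _); apply: eq_bigr => i _; rewrite coefCM mulrA.
Qed.

Lemma yserPM (P : {poly F}) p : yserP (map_poly iota P * p) = pofp P * yserP p.
Proof.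
elim/poly_ind: P => [|P c IH]; first by rewrite !(rmorph0, raddf0, mul0r).
have -> : map_poly iota (P * 'X + c%:P) = 'X * map_poly iota P + (iota c)%:P.
  by rewrite rmorphD rmorphM /= map_polyX map_polyC mulrC.
have -> : pofp (P * 'X + c%:P) = fpsX F * pofp P + pofp c%:P.
  by rewrite rmorphD rmorphM mulrC.
by rewrite !mulrDl raddfD /= -!mulrA yserPX IH yserPZ.
Qed.

Definition frobpol s : {poly A} := \prod_(i < s) (1 - w *: 'X^(q ^ i)).

Lemma frobpolS s : frobpol s.+1 = frobpol s * (1 - w *: 'X^(q ^ s)).
Proof. by rewrite /frobpol big_ord_recr. Qed.

(** Iterating the functional equation gives [Z(t^(q^s)) = frobpol s Z(t)], and since [lam] takes
    values in [F], raising a coordinate to the power [q^s] just substitutes [t^(q^s)] for [t]. *)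
Lemma yser_frobpol s a : yser a ^+ (q ^ s) = yserP (a%:P * frobpol s).
Proof.
elim: s a => [|s IH] a; first by rewrite expr1 /frobpol big_ord0 mulr1 yserPC.
rewrite expnS exprM yser_frob fps_frobB exprMn !IH frobpolS -yserPXn -raddfB /=.
congr yserP; rewrite polyCM -mul_polyC; ring.
Qed.
End Torsor.

Section Functions.
Variables (F : finFieldType) (A : finComUnitRingType) (w : A) (y : A -> fps F).
Hypothesis y_frob : forall a, y a ^+ #|F| = y a - fpsX F * y (w * a).
Local Notation q := #|F|.

(* Weighted algebra of functions on the torsor: t and the coordinates have weight 1. *)
Inductive U : nat -> (A -> fps F) -> Prop :=
| U_const c : U 0 (fun _ => pofp c%:P)
| U_X : U 1 (fun _ => fpsX F)
| U_y a : U 1 (fun x => y (a * x))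
| U_add n f g : U n f -> U n g -> U n (fun x => f x + g x)
| U_mul m n f g : U m f -> U n g -> U (m + n) (fun x => f x * g x)
| U_le m n f : (m <= n)%N -> U m f -> U n f.

Lemma eq_U n f g : f =1 g -> U n f -> U n g.
Proof. by move=> fg; rewrite (_ : f = g) //; apply: functional_extensionality_dep. Qed.

(** The argument of a function stands for a point [x Z] of the torsor: [f 1] is the value at [Z] and
    [f u] its conjugate under [Z |-> u Z]. Shifting the argument permutes the coordinates and keeps
    the weight. *)
Lemma U_shift n f s : U n f -> U n (fun x => f (s * x)).
Proof.
elim=> {n f}; try by econstructor; eauto.
by move=> a; apply: eq_U (U_y (a * s)) => x; rewrite mulrA.
Qed.

Lemma U_0 n : U n (fun _ => 0).
Proof. by apply: (U_le (leq0n n)); apply: eq_U (U_const 0) => x; rewrite raddf0. Qed.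

Lemma U_1 : U 0 (fun _ => 1).
Proof. by apply: eq_U (U_const 1) => x; rewrite rmorph1. Qed.

Lemma U_exp n f k : U n f -> U (k * n) (fun x => f x ^+ k).
Proof.
move=> Uf; elim: k => [|k IH]; first exact: U_1.
by rewrite mulSn; apply: eq_U (U_mul Uf IH) => x; rewrite exprS.
Qed.

Lemma U_Xn k : U k (fun _ => fpsX F ^+ k).
Proof. by have := U_exp k U_X; rewrite muln1. Qed.

Lemma U_sum (I : Type) (s : seq I) (P : pred I) (f : I -> A -> fps F) n :
  (forall i, P i -> U n (f i)) -> U n (fun x => \sum_(i <- s | P i) f i x).
Proof.
move=> Uf; elim: s => [|i s IH].
  by apply: eq_U (U_0 n) => x; rewrite big_nil.
case Pi: (P i); last by apply: eq_U IH => x; rewrite big_cons Pi.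
by apply: eq_U (U_add (Uf i Pi) IH) => x; rewrite big_cons Pi.
Qed.

Lemma U_poly (p : {poly F}) n : (size p <= n.+1)%N -> U n (fun _ => pofp p).
Proof.
move=> sp.
have Up: U n (fun _ => \sum_(i < size p) pofp (p`_i)%:P * fpsX F ^+ i); last first.
  apply: eq_U Up => x; rewrite -[p in RHS]coefK poly_def rmorph_sum; apply: eq_bigr => i _.
  by rewrite -rmorphXn -rmorphM mul_polyC.
apply: U_sum => i _; apply: (U_le (m := 0 + i)).
  by rewrite add0n -ltnS (leq_trans (ltn_ord i)).
exact: U_mul (U_const _) (U_Xn _).
Qed.

Definition wt (v : {ffun A -> 'I_q}) : nat := (\sum_a v a)%N.
Definition ymon (v : {ffun A -> 'I_q}) (x : A) : fps F := \prod_a y (a * x) ^+ v a.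

(** Reduced representatives: the exponents of the coordinates lie in ['I_q], so finitely many
    monomials occur and the weight bounds the degrees of their coefficients. *)
Inductive Rd : nat -> (A -> fps F) -> Prop :=
| Rd_mon n v (p : {poly F}) :
    (size p + wt v <= n.+1)%N -> Rd n (fun x => pofp p * ymon v x)
| Rd_add n f g : Rd n f -> Rd n g -> Rd n (fun x => f x + g x).

Lemma eq_Rd n f g : f =1 g -> Rd n f -> Rd n g.
Proof. by move=> fg; rewrite (_ : f = g) //; apply: functional_extensionality_dep. Qed.

Lemma Rd_le m n f : (m <= n)%N -> Rd m f -> Rd n f.
Proof.
move=> le_mn Rf; elim: Rf le_mn => {m f} [m v p sp|m f g _ IHf _ IHg] le_mn.
  by apply: Rd_mon; apply: leq_trans sp _.
by apply: Rd_add; auto.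
Qed.

Definition vset (v : {ffun A -> 'I_q}) b (k : 'I_q) : {ffun A -> 'I_q} :=
  [ffun a => if a == b then k else v a].

Lemma wt_vset v b k : (wt (vset v b k) + v b = wt v + k)%N.
Proof.
rewrite /wt (bigD1 b) //= [in RHS](bigD1 b) //= ffunE eqxx.
under eq_bigr => a /negPf ab do rewrite ffunE ab.
by rewrite addnC addnCA [RHS]addnC.
Qed.

Lemma ymon_vset v b (k : 'I_q) x :
  ymon (vset v b k) x * y (b * x) ^+ v b = ymon v x * y (b * x) ^+ k.
Proof.
rewrite /ymon (bigD1 b) //= [in RHS](bigD1 b) //= ffunE eqxx.
under eq_bigr => a /negPf ab do rewrite ffunE ab.
by ring.
Qed.

(** When an exponent reaches [q], the relation [y_b^q = y_b - t y_(w b)] trades [q] factors for one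
    coordinate and at most one [t]. As [2 <= q] the weight does not grow, and the monomial left over
    is strictly lighter, which feeds the induction on [N]. *)
Lemma Rd_ymon N v b n (p : {poly F}) : (wt v <= N)%N ->
  (size p + wt v <= n.+1)%N -> Rd n.+1 (fun x => pofp p * (y (b * x) * ymon v x)).
Proof.
have q1 := card_gt1 F.
elim: N v b n p => [|N IH] v b n p le_wN sp.
- have vb : (v b : nat) = 0%N.
    by apply/eqP; rewrite -leqn0 (leq_trans _ le_wN) // /wt (bigD1 b) //= leq_addr.
  have wE := wt_vset v b (Ordinal q1); rewrite vb /= in wE.
  apply: eq_Rd (@Rd_mon n.+1 (vset v b (Ordinal q1)) p _); last first.
    by rewrite addn0 addn1 in wE; rewrite wE addnS ltnS.
  by move=> x; have := ymon_vset v b (Ordinal q1) x; rewrite vb expr0 mulr1 /= expr1 => ->; ring.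
- have [lt_vq|le_qv] := ltnP (v b).+1 q.
    have wE := wt_vset v b (Ordinal lt_vq); rewrite /= in wE.
    apply: eq_Rd (@Rd_mon n.+1 (vset v b (Ordinal lt_vq)) p _); last first.
      by move: wE sp; move: (wt (vset _ _ _)) => W; lia.
    move=> x /=; have [z0|nz] := eqVneq (y (b * x)) 0.
      have vb0 : ymon (vset v b (Ordinal lt_vq)) x = 0.
        by rewrite /ymon (bigD1 b) //= ffunE eqxx /= z0 exprS !mul0r.
      by rewrite vb0 z0; ring.
    have nz' : y (b * x) ^+ v b != 0 by rewrite expf_neq0.
    apply: (mulIf nz'); rewrite -mulrA ymon_vset /= exprS; ring.
  have Ev : ((v b).+1 = q)%N by apply/eqP; rewrite eqn_leq le_qv ltn_ord.
  have q0 : (0 < q)%N by apply: ltnW.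
  pose v' := vset v b (Ordinal q0).
  have wE := wt_vset v b (Ordinal q0); rewrite /= -/v' in wE.
  have lt_v'v : (wt v' < wt v)%N.
    by move: wE Ev q1; move: (wt v') (nat_of_ord (v b)) => W k; lia.
  have le_v'N : (wt v' <= N)%N by rewrite -ltnS (leq_trans lt_v'v).
  apply: (@eq_Rd _ (fun x => pofp p * (y (b * x) * ymon v' x)
                    + pofp (- (p * 'X)) * (y ((w * b) * x) * ymon v' x))).
    move=> x; have E := ymon_vset v b (Ordinal q0) x; rewrite /= expr0 mulr1 -/v' in E.
    rewrite -E [y (b * x) * (_ * _ ^+ _)]mulrCA -exprS Ev y_frob [w * (_ * _)]mulrA.
    by rewrite rmorphN rmorphM -/(fpsX F); ring.
  have sp' : (size p + (wt v').+1 <= n.+1)%N by apply: leq_trans sp; rewrite leq_add2l.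
  apply: Rd_add; first by apply: IH => //; apply: leq_trans sp'; rewrite leq_add2l.
  apply: IH => //; rewrite size_polyN.
  have : (size (p * 'X)%R <= (size p).+1)%N.
    by rewrite (leq_trans (size_polyMleq _ _)) // size_polyX; lia.
  by rewrite -(leq_add2r (wt v')) => /leq_trans-> //; rewrite addSnnS.
Qed.

Lemma Rd_y n f b : Rd n f -> Rd n.+1 (fun x => y (b * x) * f x).
Proof.
elim=> {n f} [n v p sp|n f g _ IHf _ IHg].
  by apply: eq_Rd (Rd_ymon b (leqnn (wt v)) sp) => x; ring.
by apply: eq_Rd (Rd_add IHf IHg) => x; ring.
Qed.

Lemma Rd_poly m n f (r : {poly F}) : (size r <= m.+1)%N -> Rd n f ->
  Rd (m + n) (fun x => pofp r * f x).
Proof.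
move=> sr; elim=> {n f} [n v p sp|n f g _ IHf _ IHg]; last first.
  by apply: eq_Rd (Rd_add IHf IHg) => x; ring.
apply: eq_Rd (@Rd_mon (m + n) v (r * p) _).
  by move=> x; rewrite rmorphM; ring.
have := size_polyMleq r p.
move: (wt v) sp => wv sp; have [->|] := eqVneq p 0; first by rewrite mulr0 size_poly0; lia.
by rewrite -size_poly_gt0; lia.
Qed.

Lemma U_Rd_mul n f : U n f -> forall m g, Rd m g -> Rd (n + m) (fun x => f x * g x).
Proof.
elim=> {n f} [c||a|n f g _ IHf _ IHg|m n f g _ IHf _ IHg|m n f le_mn _ IHf] k h.
- by apply: Rd_poly; apply: leq_trans (size_polyC_leq1 _) _.
- by apply: Rd_poly; rewrite size_polyX.
- by move=> Rh; apply: Rd_y.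
- by move=> Rh; apply: eq_Rd (Rd_add (IHf _ _ Rh) (IHg _ _ Rh)) => x; ring.
- by move=> Rh; rewrite -addnA; apply: eq_Rd (IHf _ _ (IHg _ _ Rh)) => x; ring.
- by move=> Rh; apply: Rd_le (IHf _ _ Rh); rewrite leq_add2r.
Qed.

Lemma U_Rd n f : U n f -> Rd n f.
Proof.
move=> Uf; have q0 : (0 < q)%N := ltnW (card_gt1 F).
rewrite -[n]addn0; apply: eq_Rd (U_Rd_mul Uf (@Rd_mon 0 [ffun=> Ordinal q0] 1 _)).
  move=> x; rewrite rmorph1 mul1r /ymon big1 ?mulr1 // => a _.
  by rewrite ffunE expr0.
by rewrite size_poly1 /wt big1 // => a _; rewrite ffunE.
Qed.

Lemma Rd_coef n f : Rd n f -> exists c : {ffun A -> 'I_q} -> {poly F},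
  (forall v, (size (c v) <= n.+1)%N) /\ f =1 fun x => \sum_v pofp (c v) * ymon v x.
Proof.
elim=> {n f} [n v p sp|n f g _ [c [sc Ec]] _ [d [sd Ed]]].
  exists (fun u => if u == v then p else 0); split.
    by move=> u; case: eqP => _; rewrite ?size_poly0 //; lia.
  move=> x; rewrite (bigD1 v) //= eqxx big1 ?addr0 // => u /negPf->.
  by rewrite raddf0 mul0r.
exists (fun v => c v + d v); split.
  by move=> v; rewrite (leq_trans (size_polyD _ _)) // geq_max sc sd.
by move=> x; rewrite Ec Ed -big_split; apply: eq_bigr => v _; rewrite rmorphD mulrDl.
Qed.

Lemma U_coef n f : U n f -> exists c : {ffun A -> 'I_q} -> {poly F},
  (forall v, (size (c v) <= n.+1)%N) /\ f =1 fun x => \sum_v pofp (c v) * ymon v x.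
Proof. by move=> /U_Rd/Rd_coef. Qed.

Lemma U_ymon v : U (wt v) (ymon v).
Proof.
rewrite /wt /ymon; elim: (index_enum A) => [|a r IH].
  by rewrite big_nil; apply: eq_U U_1 => x; rewrite big_nil.
rewrite big_cons; apply: (@eq_U _ (fun x => y (a * x) ^+ v a * \prod_(b <- r) y (b * x) ^+ v b)).
  by move=> x; rewrite big_cons.
by apply: U_mul IH; rewrite -[X in U X]muln1; apply: U_exp (U_y a).
Qed.
End Functions.

(** * A basis of the values over the polynomial ring *)

Lemma kernel_exists (K : fieldType) (I J : finType) (M : I -> J -> K) :
  (#|J| < #|I|)%N -> exists x : I -> K,
  (exists i, x i != 0) /\ forall j, \sum_i x i * M i j = 0.
Proof.
move=> lt_JI; pose MM := \matrix_(i < #|I|, j < #|J|) M (enum_val i) (enum_val j).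
have : kermx MM != 0.
  rewrite -mxrank_eq0 mxrank_ker -lt0n subn_gt0.
  by apply: leq_ltn_trans lt_JI; apply: rank_leq_col.
case/rowV0Pn => u /sub_kermxP uM nz_u.
exists (fun i => u 0 (enum_rank i)); split.
  case/rV0Pn: nz_u => j nz_j; exists (enum_val j); by rewrite enum_valK.
move=> j; have /rowP/(_ (enum_rank j)) := uM; rewrite !mxE => E; rewrite -[RHS]E.
rewrite (reindex _ (onW_bij _ (enum_val_bij I))) /=.
by apply: eq_bigr => i _; rewrite !mxE !enum_rankK enum_valK.
Qed.

Section PolyIndependence.
Variables (F : fieldType) (V : finType) (m : V -> fps F).

Definition pindep (B : {set V}) : Prop := forall c : V -> {poly F},
  \sum_(v in B) pofp (c v) * m v = 0 -> forall v, v \in B -> c v = 0.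

(** Maximality of [B] gives each [m v] its own relation; the product of the leading coefficients of
    these relations is a denominator common to all [v]. *)
Lemma pindep_max : exists B, pindep B /\ exists D (e : V -> V -> {poly F}),
  D != 0 /\ forall v, pofp D * m v = \sum_(b in B) pofp (e v b) * m b.
Proof.
have ind0 : `[< pindep set0 >] by apply/asboolP => c _ v; rewrite inE.
have [B /maxsetP[/asboolP indB maxB] _] := maxset_exists (P := fun B => `[< pindep B >]) ind0.
exists B; split=> //.
have rel v : exists de : {poly F} * (V -> {poly F}),
    de.1 != 0 /\ pofp de.1 * m v = \sum_(b in B) pofp (de.2 b) * m b.
  have [vB|vB] := boolP (v \in B).
    exists (1, fun b => (b == v)%:R); split; first exact: oner_neq0.
    rewrite rmorph1 mul1r (bigD1 v) //= eqxx rmorph1 mul1r big1 ?addr0 // => u /andP[_ /negPf->].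
    by rewrite raddf0 mul0r.
  have : ~ pindep (v |: B).
    move=> ind; have EB := maxB (v |: B) (asboolT ind) (subsetUr _ _).
    by rewrite -EB setU11 in vB.
  move=> /existsNP[c] /not_implyP[sum0] /existsNP[u /not_implyP[uB /eqP nz_u]].
  rewrite big_setU1 //= in sum0.
  have nz_v : c v != 0.
    apply: contraNneq nz_u => cv0; rewrite cv0 raddf0 mul0r add0r in sum0.
    by case/setU1P: uB => [->|uB]; [apply/eqP | apply/eqP; apply: (indB _ sum0)].
  exists (c v, fun b => - c b); split=> //=.
  apply/eqP; rewrite -subr_eq0 -sumrN -[X in _ == X]sum0; apply/eqP; congr (_ + _).
  by apply: eq_bigr => b _; rewrite rmorphN mulNr opprK.
pose de v := projT1 (cid (rel v)).
have deP v := projT2 (cid (rel v)); rewrite -/de in deP.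
exists (\prod_v (de v).1), (fun v b => (\prod_(u | u != v) (de u).1) * (de v).2 b); split.
  by apply/prodf_neq0 => v _; case: (deP v).
move=> v; rewrite (bigD1 v) //= [_ * \prod_(i | _) _]mulrC rmorphM -mulrA.
have [_ ->] := deP v; rewrite mulr_sumr; apply: eq_bigr => b _.
by rewrite rmorphM mulrA.
Qed.
End PolyIndependence.

Section TorsorBasis.
Variables (F : finFieldType) (A : finComUnitRingType) (w : A) (y : A -> fps F).
Hypothesis y_frob : forall a, y a ^+ #|F| = y a - fpsX F * y (w * a).
Local Notation U := (U y).

(** A basis over [F(t)] of the ring of values [f 1], so that [N] is the degree of the cover. Neither
    the denominator [D] nor the loss [C] depends on the weight [n], hence both affect only terms of
    lower order. *)
Definition is_basis N (bs : 'I_N -> A -> fps F) (D : {poly F}) (C : nat) : Prop :=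
  [/\ D != 0, forall i, U C (bs i),
      forall c : 'I_N -> {poly F}, \sum_i pofp (c i) * bs i 1 = 0 -> forall i, c i = 0
    & forall n f, U n f -> exists c : 'I_N -> {poly F},
        (forall i, (size (c i) <= n + C)%N)
        /\ pofp D * f 1 = \sum_i pofp (c i) * bs i 1].

Lemma basis_exists : exists N bs D C, @is_basis N bs D C.
Proof.
pose m v := ymon y v 1.
have [B [indB [D [e [nzD De]]]]] := pindep_max m.
(* [C] absorbs the degrees of the coefficients [e v u] as well as the weights of the basis
   monomials. *)
pose C := (\max_v \max_u (size (e v u)) + \max_(v : {ffun A -> 'I_#|F|}) wt v).+1%N.
have leC v u : (size (e v u) < C)%N.
  rewrite ltnS; apply: leq_trans (leq_addr _ _).
  apply: leq_trans (leq_bigmax v); exact: (leq_bigmax (F := fun u => size (e v u))).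
have bsum (g : {ffun A -> 'I_#|F|} -> fps F) :
    \sum_(b in B) g b = \sum_(i < #|B|) g (enum_val i) by rewrite big_enum_val.
exists #|B|, (fun i => ymon y (enum_val i)), D, C; split=> //.
- move=> i; apply: U_le (U_ymon y (enum_val i)); apply: leqW.
  by apply: leq_trans (leq_addl _ _); apply: leq_bigmax.
- move=> c sum0 i.
  have [/= b0 EB] : exists b0, b0 \in B by exists (enum_val i); apply: enum_valP.
  pose c' v := if v \in B =P true is ReflectT vB then c (enum_rank_in vB v) else 0.
  have c'E j : c' (enum_val j) = c j.
    rewrite /c'; case: eqP => [vB|]; last by rewrite enum_valP.
    by rewrite enum_valK_in.
  rewrite -c'E; apply: indB; last exact: enum_valP.
  rewrite bsum -[RHS]sum0; apply: eq_bigr => j _; by rewrite c'E.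
- move=> n f /(U_coef y_frob)[c [sc Ef]].
  exists (fun i => \sum_v c v * e v (enum_val i)); split.
    move=> i; apply: leq_trans (size_sum _ _ _) _; apply/bigmax_leqP => v _.
    apply: leq_trans (size_polyMleq _ _) _.
    apply: leq_trans (leq_pred _) _; apply: leq_trans (leq_add (sc v) (leqnn _)) _.
    by rewrite addSnnS leq_add2l leC.
  rewrite Ef mulr_sumr -(bsum (fun b => pofp (\sum_v c v * e v b) * ymon y b 1)).
  under eq_bigr => v _ do rewrite mulrCA -/(m v) De mulr_sumr.
  rewrite exchange_big /=; apply: eq_bigr => b _.
  by rewrite rmorph_sum mulr_suml; apply: eq_bigr => v _; rewrite rmorphM mulrA.
Qed.
End TorsorBasis.

(* [g ^+ r] is [g] with [t] replaced by [t ^ r], so in a vanishing sum the term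
   with the least order of [g i] cannot be cancelled by the others. *)
Lemma frob_independent (F : finFieldType) e (I : finType) (f g : I -> fps F)
    (V : fps F -> Prop) (B : {set I}) :
  V 0 -> (forall u v, V u -> V v -> V (u + v)) -> (forall c u, V u -> V (pofp c%:P * u)) ->
  (forall u, V u -> vanish (#|F| ^ e)%N u -> u = 0) -> (forall i, V (f i)) ->
  (forall c : I -> F, \sum_(i in B) pofp (c i)%:P * g i = 0 -> forall i, i \in B -> c i = 0) ->
  \sum_(i in B) f i * g i ^+ (#|F| ^ e) = 0 -> forall i, i \in B -> f i = 0.
Proof.
set r := (#|F| ^ e)%N => V0 VD VZ Vord.
have r_gt0 : (0 < r)%N by apply: frob_gt0.
have [n] := ubnP #|B|; elim: n B f g => // n IH B f g lt_Bn Vf ind_g sum0.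
have [->|[j0 j0B]] := set_0Vmem B; first by move=> i; rewrite inE.
have nzg i : i \in B -> exists m, vanish m (g i) /\ cf (g i) m != 0.
  move=> iB; apply: fps_order; apply/eqP => gi0.
  have := ind_g (fun j => (j == i)%:R); rewrite big1 => [/(_ erefl i iB)/eqP|j jB].
    by rewrite eqxx oner_eq0.
  by case: eqP => [->|_]; rewrite ?gi0 ?mulr0 // raddf0 mul0r.
have exm : exists m, [exists i in B, `[< vanish m (g i) /\ cf (g i) m != 0 >]].
  have [m vm] := nzg _ j0B; exists m; apply/exists_inP; exists j0 => //; exact/asboolP.
have [m /exists_inP[i0 i0B /asboolP[vi0 nzi0]] min_m] := ex_minnP exm.
have vg i : i \in B -> vanish m (g i).
  move=> iB; have [k [vk nzk]] := nzg i iB => j lt_jm; apply: (vk); apply: leq_trans lt_jm _.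
  apply: min_m; apply/exists_inP; exists i => //; exact: (asboolT (conj vk nzk)).
(* Subtracting [k i] times [g i0] raises every other order above [m]. The constant [k i] is fixed by
   the Frobenius, so the change is compensated by moving the terms [k i * f i] into [f0]. *)
pose k i := cf (g i) m / cf (g i0) m.
pose g' i := g i - pofp (k i)%:P * g i0.
have vg' i : i \in B -> vanish m.+1 (g' i).
  move=> iB j; rewrite ltnS leq_eqVlt => /orP[/eqP->|lt_jm].
    by rewrite cfB cfZ /k divfK ?subrr.
  by rewrite cfB cfZ !vg // mulr0 subrr.
pose B' := B :\ i0.
have sumB (h : I -> fps F) : \sum_(i in B) h i = h i0 + \sum_(i in B') h i.
  by rewrite (big_setD1 i0).
pose f0 := f i0 + \sum_(i in B') pofp (k i)%:P * f i.
have Vf0 : V f0.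
  apply: (VD); first exact: Vf.
  by apply: (big_ind V V0 VD) => i _; apply: (VZ).
have E0 : f0 * g i0 ^+ r + \sum_(i in B') f i * g' i ^+ r = 0.
  rewrite -[RHS]sum0 sumB mulrDl -addrA mulr_suml -big_split; congr (_ + _) => /=.
  apply: eq_bigr => i _; rewrite fps_frobB exprMn -rmorphXn -polyC_exp expf_card_exp; ring.
have f00 : f0 = 0.
  apply: Vord Vf0 _; apply: contrapT => nv.
  have nz_f0 : f0 != 0 by apply/eqP => f00; apply: nv => j _; rewrite f00.
  have [ o [vo nzo]] := fps_order nz_f0.
  have lt_or : (o < r)%N.
    by rewrite ltnNge; apply/negP => le_ro; apply: nv => j lt_jr; apply: vo (leq_trans lt_jr le_ro).
  have vr : vanish (m * r) (g i0 ^+ r).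
    by have [h ->] := vanish_dvd vi0; rewrite exprMn -exprM; apply: dvd_vanish.
  (* With [o < r] the order of [f0], the coefficient at [o + m * r] sees only the first term: the
     others vanish to order [m.+1 * r]. *)
  have : cf (f0 * g i0 ^+ r + \sum_(i in B') f i * g' i ^+ r) (o + m * r) = 0 by rewrite E0.
  rewrite cfD cf_mul_order // cf_sum.
  rewrite big1 ?addr0 => [/eqP|i].
    rewrite mulf_eq0 (negPf nzo) cf_frob dvdn_mull // mulnK //=.
    by rewrite (negPf nzi0).
  rewrite inE => /andP[_ iB]; have [h ->] := vanish_dvd (vg' i iB).
  rewrite exprMn -exprM mulrCA; apply: dvd_vanish.
  by rewrite mulSn ltn_add2r.
rewrite f00 mul0r add0r in E0.
have fB' : forall i, i \in B' -> f i = 0.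
  apply: (IH B' f g') => //.
    by apply: leq_trans (proper_card (properD1 i0B)) _.
  move=> c sumc i iB'; pose c' j := if j == i0 then - \sum_(l in B') c l * k l else c j.
  have := ind_g c' _ i; rewrite /c'; case: eqP iB' => [->|_ iB']; first by rewrite !inE eqxx.
  apply; last by case/setD1P: iB'.
  rewrite sumB eqxx -[RHS]sumc.
  under [in RHS]eq_bigr => j _ do rewrite mulrBr mulrA -rmorphM -polyCM.
  rewrite sumrB -mulr_suml -rmorph_sum -rmorph_sum addrC /= !rmorphN mulNr; congr (_ - _).
  by apply: eq_bigr => j /setD1P[/negPf->].
move=> i iB; have [->|ne_i] := eqVneq i i0; last by apply: fB'; rewrite !inE ne_i.
move: f00; rewrite /f0 big1 ?addr0 // => j jB'.
by rewrite fB' // mulr0.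
Qed.

(** * Zero estimates and the shifts that respect all relations *)

(** Siegel's dimension count: each of the [#|J|] polynomial conditions amounts to at most [K] scalar
    equations. *)
Lemma poly_kernel (F : fieldType) (I J : finType) K (c : I -> J -> {poly F}) :
  (forall i j, (size (c i j) <= K)%N) -> (#|J| * K < #|I|)%N ->
  exists x : I -> F, (exists i, x i != 0) /\ forall j, \sum_i x i *: c i j = 0.
Proof.
move=> sc lt_JI; have [|x [nzx Ex]] := @kernel_exists F I (J * 'I_K)%type (fun i jk => (c i jk.1)`_jk.2).
  by rewrite card_prod card_ord.
exists x; split=> // j; apply/polyP => k; rewrite coef0 coef_sum.
have [lt_kK|le_Kk] := ltnP k K.
  by rewrite -[RHS](Ex (j, Ordinal lt_kK)); apply: eq_bigr => i _; rewrite coefZ.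
by apply: big1 => i _; rewrite coefZ nth_default ?mulr0 // (leq_trans (sc i j)).
Qed.

Section Decomposition.
Variables (F : finFieldType) (A : finComUnitRingType) (w : A) (y : A -> fps F).
Hypothesis y_sep : forall s u, s != u -> exists a, y (a * s) != y (a * u).
Variables (N : nat) (bs : 'I_N -> A -> fps F) (D : {poly F}) (C : nat).
Hypothesis basis : is_basis y bs D C.
Local Notation U := (U y).
Local Notation q := #|F|.

Let nzD : pofp D != 0.
Proof. by case: basis => nz _ _ _; rewrite -(inj_eq (@pofp_inj F)) raddf0 in nz. Qed.
Let Ub i : U C (bs i). Proof. by case: basis. Qed.
Let indb (c : 'I_N -> {poly F}) : \sum_i pofp (c i) * bs i 1 = 0 -> forall i, c i = 0.
Proof. by case: basis => _ _ /(_ c). Qed.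
Let spanb n f : U n f -> exists c : 'I_N -> {poly F},
  (forall i, (size (c i) <= n + C)%N) /\ pofp D * f 1 = \sum_i pofp (c i) * bs i 1.
Proof. by case: basis => _ _ _ /(_ n f). Qed.

Lemma basis_neq0 i : bs i 1 != 0.
Proof.
apply/eqP => bi0; have := indb (c := fun j => (j == i)%:R).
rewrite big1 => [/(_ erefl i)/eqP|j _]; first by rewrite eqxx oner_eq0.
by case: eqP => [->|_]; rewrite ?bi0 ?mulr0 // raddf0 mul0r.
Qed.

(** Coordinates in the basis are unique, so those of [f] are [P] times those of [g]; a nonzero one
    has degree at most that allowed by the weight of [f]. In geometric terms, a function has no more
    zeros than poles. *)
Lemma basis_dvd n f m g (P : {poly F}) : U n f -> U m g -> f 1 != 0 ->
  f 1 = pofp P * g 1 -> (size P <= n + C)%N.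
Proof.
move=> Uf Ug nzf Ef; have [c [sc Ec]] := spanb Uf; have [d [_ Ed]] := spanb Ug.
have cP i : c i = P * d i.
  apply/eqP; rewrite -subr_eq0; apply/eqP; move: i.
  apply: (indb (c := fun i => c i - P * d i)).
  under eq_bigr => i _ do rewrite rmorphB mulrBl rmorphM -mulrA.
  by rewrite sumrB -mulr_sumr -Ed -Ec Ef mulrCA subrr.
have [i nzi] : exists i, c i != 0.
  apply: contrapT => c0; case/negP: nzf; rewrite -(mulrI_eq0 _ (mulfI nzD)) Ec big1 // => i _.
  have [->|nz] := eqVneq (c i) 0; first by rewrite raddf0 mul0r.
  by case: c0; exists i.
apply: leq_trans (sc i); rewrite cP size_mul; last 2 first.
- by apply: contraNneq nzi => P0; rewrite cP P0 mul0r.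
- by apply: contraNneq nzi => d0; rewrite cP d0 mulr0.
have : d i != 0 by apply: contraNneq nzi => d0; rewrite cP d0 mulr0.
by rewrite -size_poly_gt0 => d0; rewrite -subn1 -addnBA // leq_addr.
Qed.

Lemma basis_indep_coef X (x : 'I_X * 'I_N -> F) :
  \sum_ji pofp (x ji)%:P * (fpsX F ^+ ji.1 * bs ji.2 1) = 0 -> forall ji, x ji = 0.
Proof.
have -> : \sum_ji pofp (x ji)%:P * (fpsX F ^+ ji.1 * bs ji.2 1)
    = \sum_j \sum_i pofp (x (j, i))%:P * (fpsX F ^+ j * bs i 1).
  by rewrite pair_bigA; apply: eq_bigr => -[].
rewrite exchange_big /=.
move=> sum0 [j i]; have : \sum_(j < X) x (j, i) *: 'X^j = 0.
  apply: (indb (c := fun i => \sum_(j < X) x (j, i) *: 'X^j)); rewrite -[RHS]sum0.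
  apply: eq_bigr => k _; rewrite rmorph_sum mulr_suml; apply: eq_bigr => l _.
  by rewrite -mul_polyC rmorphM rmorphXn mulrA.
move=> /(congr1 (fun p : {poly F} => p`_j)); rewrite coef0 coef_sum (bigD1 j) //=.
rewrite coefZ coefXn eqxx mulr1 big1 ?addr0 // => k ne_kj.
by rewrite coefZ coefXn eq_sym (negPf (ne_kj : (k : nat) != j)) mulr0.
Qed.

(** A substitute for taking norms: a dimension count yields a nonzero [g] for which all coordinates
    of [f * g] but the one at [i0] vanish. Then [D f g = P b_i0], and the order of [f] is at most
    the degree of [P] plus the order of one basis element. *)
Lemma basis_order : exists K0, forall n f m, U n f -> f 1 != 0 -> vanish m (f 1) ->
  (m <= N.+1 * n + K0)%N.
Proof.
have ob i : exists o, vanish o (bs i 1) /\ cf (bs i 1) o != 0.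
  exact/fps_order/basis_neq0.
pose o i := projT1 (cid (ob i)); pose O := (\max_i o i)%N.
exists (N.+1 * (2 * C) + O)%N => n f m Uf nzf vf.
have [i0] : inhabited 'I_N.
  case: (posnP N) => [N0|N_gt0]; last by constructor; exact: Ordinal N_gt0.
  have [c [_ Ec]] := spanb Uf; case/eqP: (mulf_neq0 nzD nzf); rewrite Ec big1 // => i _.
  by have := ltn_ord i; rewrite [X in (_ < X)%N]N0.
(* Killing [N - 1] coordinates of size at most [X + Y], with [Y = n + 2 * C], takes
   [(N - 1) (X + Y) < X N], that is [X > (N - 1) Y]. *)
pose X := (N * (n + 2 * C)).+1; pose K := (X + (n + 2 * C))%N.
pose h (ji : 'I_X * 'I_N) x := fpsX F ^+ ji.1 * (bs ji.2 x * f x).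
have Uh ji : U (X + (C + n)) (h ji).
  by apply: U_mul (U_mul (Ub _) Uf); apply: U_le (U_Xn _ _); apply: ltnW.
pose c ji := projT1 (cid (spanb (Uh ji))).
have [sc Ec] : (forall ji b, (size (c ji b) <= K)%N) /\
    forall ji, pofp D * h ji 1 = \sum_b pofp (c ji b) * bs b 1.
  split=> [ji b|ji]; rewrite /c; case: (cid _) => /= ? [] // sb _.
  by apply: leq_trans (sb b) _; rewrite /K; lia.
have [||x [[ji nzx] Ex]] := @poly_kernel F ('I_X * 'I_N)%type {b : 'I_N | b != i0} K
    (fun ji b => c ji (val b)); first by move=> ji b; apply: sc.
  rewrite card_prod !card_ord card_sig (eq_card (B := predC1 i0)) // cardC1 card_ord.
  have : (0 < N)%N by apply: leq_ltn_trans (ltn_ord i0).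
  by rewrite /K /X; move: (n + 2 * C)%N => Z; case: (N) => // N' _; clear; nia.
pose g := \sum_ji pofp (x ji)%:P * (fpsX F ^+ ji.1 * bs ji.2 1).
pose P := \sum_ji x ji *: c ji i0.
have fgE : f 1 * (pofp D * g) = pofp P * bs i0 1.
  transitivity (\sum_b pofp (\sum_ji x ji *: c ji b) * bs b 1); last first.
    rewrite (bigD1 i0) //= [X in _ + X]big1 ?addr0 // => b ne_b.
    by rewrite (Ex (exist _ b ne_b)) raddf0 mul0r.
  under eq_bigr => b _ do rewrite rmorph_sum mulr_suml.
  rewrite exchange_big /= /g !mulr_sumr; apply: eq_bigr => kl _.
  have -> : f 1 * (pofp D * (pofp (x kl)%:P * (fpsX F ^+ kl.1 * bs kl.2 1)))
    = pofp (x kl)%:P * (pofp D * h kl 1) by rewrite /h; ring.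
  rewrite Ec mulr_sumr; apply: eq_bigr => b _.
  by rewrite -mul_polyC rmorphM mulrA.
have nzg : g != 0 by apply: contraNneq nzx => /basis_indep_coef->.
have nzPb : pofp P * bs i0 1 != 0 by rewrite -fgE !mulf_neq0.
have nzP : pofp P != 0 by apply: contraNneq nzPb => ->; rewrite mul0r.
have [u [vu nzu]] := fps_order nzP.
have lt_u : (u < K)%N.
  rewrite ltnNge; apply: contra nzu => le_Ku; rewrite /= nth_default //.
  apply: leq_trans le_Ku; apply: leq_trans (size_sum _ _ _) _; apply/bigmax_leqP => kl _.
  by apply: leq_trans (size_scale_leq _ _) (sc _ _).
have [vo nzo] := projT2 (cid (ob i0)); rewrite -/(o i0) in vo nzo.
have le_m : (m <= u + o i0)%N.
  rewrite leqNgt; apply/negP => lt_m.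
  have := cf_mul_order vu vo; rewrite -fgE => /esym/eqP.
  have [f' ->] := vanish_dvd vf.
  by rewrite -mulrA (dvd_vanish _ lt_m) (negPf (mulf_neq0 nzu nzo)).
have le_o : (o i0 <= O)%N by apply: (leq_bigmax (F := o)).
move: lt_u le_m le_o; rewrite /K /X; nia.
Qed.

(** The shift by [s] respects every algebraic relation between [t] and the coordinates, so it acts
    on the field they generate: the decomposition group of the component of the torsor through
    [Z]. *)
Definition decomp s := forall n f, U n f -> f 1 = 0 -> f s = 0.

Lemma decomp1 : decomp 1. Proof. by []. Qed.

Lemma decompM s u : decomp s -> decomp u -> decomp (s * u).
Proof.
move=> Hs Hu n f Uf f0; apply: (Hu n (fun x => f (s * x))); first exact: U_shift.
by rewrite mulr1; apply: Hs Uf f0.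
Qed.

(** The unit group is finite, so [s^-1] is a power of [s]. *)
Lemma decompV s : s \is a GRing.unit -> decomp s -> decomp s^-1.
Proof.
move=> us Hs; pose g := FinRing.unit A us.
have -> : s^-1 = s ^+ #[g]%g.-1.
  apply: (mulrI us); rewrite divrr // -exprS prednK ?order_gt0 //.
  by have := congr1 val (expg_order g); rewrite FinRing.val_unitX => ->.
elim: {g}_.-1 => [|k IH]; first exact: decomp1.
by rewrite exprS; apply: decompM.
Qed.

Lemma decomp_neq0 s n f : s \is a GRing.unit -> decomp s -> U n f -> f 1 != 0 -> f s != 0.
Proof.
move=> us Hs Uf; apply: contraNneq => fs0; apply/eqP.
have := @decompV s us Hs n (fun x => f (s * x)); rewrite mulr1 divrr //; apply=> //.
exact: U_shift.
Qed.

Lemma decomp_span s n f : decomp s -> U n f -> exists c : 'I_N -> {poly F},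
  (forall i, (size (c i) <= n + C)%N) /\ (forall x, x = s \/ x = 1 ->
  pofp D * f x = \sum_i pofp (c i) * bs i x).
Proof.
move=> Hs Uf; have [c [sc Ec]] := spanb Uf; exists c; split=> // x [->|->] //.
apply/eqP; rewrite -subr_eq0; apply/eqP.
have [m Um] : exists m, U m (fun x => pofp D * f x + \sum_i pofp (- c i) * bs i x).
  exists (size D + n + (n + C) + C)%N; apply: U_add.
    by apply: U_le (U_mul (U_poly _ (leqnSn _)) Uf); rewrite -addnA leq_addr.
  apply: U_sum => i _.
  apply: (U_le (m := (n + C) + C)); first by rewrite -[leqRHS]addnA leq_addl.
  by apply: U_mul (Ub i); apply: U_poly; rewrite size_polyN leqW.
have := Hs _ _ Um; rewrite Ec.
have E x0 : \sum_i pofp (- c i) * bs i x0 = - \sum_i pofp (c i) * bs i x0.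
  by rewrite -sumrN; apply: eq_bigr => i _; rewrite rmorphN mulNr.
by rewrite !E; apply; rewrite subrr.
Qed.

(** Artin's bound on the number of automorphisms. More than [N] shifts satisfy a nontrivial linear
    relation on the [N] basis elements; [decomp_span] extends it to all functions, and these
    separate the shifts by [y_sep]. *)
Lemma decomp_card (I : finType) (e : I -> A) : injective e -> (forall i, decomp (e i)) ->
  (#|I| <= N)%N.
Proof.
move=> inj_e He; rewrite leqNgt; apply/negP => lt_N.
have [|x [[i0 nzx] Ex]] := @kernel_exists {fraction (fps F)} I 'I_N
   (fun i j => tofrac (bs j (e i))); first by rewrite card_ord.
have tD : tofrac (pofp D) != 0 by rewrite tofrac_eq0.
have sum0 n f : U n f -> \sum_i x i * tofrac (f (e i)) = 0.
  move=> Uf; have [c [_ Ec]] := decomp_span (@decomp1) Uf.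
  have {}Ec i : pofp D * f (e i) = \sum_j pofp (c j) * bs j (e i).
    have [c' [_ Ec']] := decomp_span (He i) Uf.
    rewrite Ec'; last by left.
    apply: eq_bigr => j _; congr (pofp _ * _); apply/eqP; rewrite -subr_eq0; apply/eqP; move: j.
    apply: (indb (c := fun j => c' j - c j)).
    under eq_bigr => j _ do rewrite rmorphB mulrBl.
    by rewrite sumrB -Ec' -?Ec ?subrr; auto.
  apply: (mulfI tD); rewrite mulr0 mulr_sumr.
  under eq_bigr => i _ do rewrite mulrCA -rmorphM Ec rmorph_sum mulr_sumr.
  rewrite exchange_big big1 // => j _.
  under eq_bigr => i _ do rewrite rmorphM mulrCA.
  by rewrite -mulr_sumr Ex mulr0.
(* Lagrange interpolation: multiply by factors vanishing at the other points. *)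
have sep i : exists a, i != i0 -> y (a * e i) != y (a * e i0).
  have [->|ne] := eqVneq i i0; first by exists 1.
  by have [a ya] := y_sep (s := e i) (u := e i0) (contra_neq (@inj_e i i0) ne); exists a.
pose a i := projT1 (cid (sep i)).
have aP i : i != i0 -> y (a i * e i) != y (a i * e i0) := projT2 (cid (sep i)).
have lag (s : seq I) : forall n f, U n f -> \sum_i x i * tofrac (f (e i)) *
    \prod_(j <- s) (tofrac (y (a j * e i)) - tofrac (y (a j * e j))) = 0.
  elim: s => [|j s IH] n f Uf.
    by under eq_bigr => i _ do rewrite big_nil mulr1; apply: sum0 Uf.
  rewrite -[RHS](IH _ _ (U_mul Uf (U_y y (a j)))) -[LHS]subr0.
  rewrite -[X in _ - X = _](mulr0 (- tofrac (y (a j * e j)))) -[X in _ - _ * X = _](IH _ f Uf).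
  rewrite mulr_sumr -sumrB; apply: eq_bigr => i _; rewrite big_cons.
  have T (b z u c P : {fraction (fps F)}) :
    b * z * ((u - c) * P) - - c * (b * z * P) = b * (z * u) * P by ring.
  by rewrite T -rmorphM.
have := lag (enum (predC1 i0)) _ _ (U_1 y); rewrite (bigD1 i0) //= [X in _ + X]big1 ?addr0.
  rewrite rmorph1 mulr1 => /eqP; rewrite mulf_eq0 (negPf nzx) /= => /eqP/eqP.
  apply/negP; rewrite prodf_seq_neq0; apply/allP => j; rewrite mem_enum inE => ne_j.
  by rewrite /= subr_eq0 eq_sym tofrac_eq aP.
move=> i ne_i; apply/eqP; rewrite mulf_eq0 prodf_seq_eq0; apply/orP; right.
by apply/hasP; exists i; rewrite ?mem_enum //= subrr eqxx.
Qed.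
End Decomposition.

(** The left side counts equations, the right side unknowns. Since [N * m] is about [r], the main
    terms [N r L] agree, and the surplus of order [k N^2 L] has to beat [N r C]. As [L] is about
    [r / (N + 1)], a constant [k] suffices. *)
Lemma stepanov_count N C K1 : (0 < N)%N -> exists k r0, forall r L m : nat,
  (r0 <= r)%N -> (r <= N.+1 * L + K1 + N.+1)%N -> (N * m <= r)%N -> (r < N * m + N)%N ->
  (N * (r * (L + C) + (m + k + C) + C) < (L * N) * ((m + k) * N))%N.
Proof.
move=> N_gt0; pose k' := (2 * (C + 2) * N.+1)%N; pose k := k'.+1.
exists k, (2 * (C + 2) * (K1 + N.+1) + k + 2 * C + 1)%N => r L m r0r rL Nm mr.
rewrite [(L * N)%N]mulnC -mulnA ltn_pmul2l //.
have mkN : (r + 1 + k' * N <= (m + k) * N)%N by rewrite /k; nia.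
have h1 : (L * (r + 1 + k' * N) <= L * ((m + k) * N))%N by rewrite leq_mul2l mkN orbT.
apply: leq_trans h1.
have le_mr : (m <= r)%N by nia.
have h2 : (2 * (C + 2) * r <= 2 * (C + 2) * (N.+1 * L) + 2 * (C + 2) * (K1 + N.+1))%N.
  by rewrite -mulnDr leq_mul2l; apply/orP; right; rewrite addnA.
have h3 : (2 * (C + 2) * (N.+1 * L) <= L * (k' * N))%N by rewrite mulnA mulnC leq_mul2l leq_pmulr ?orbT.
have := leq_trans h2 (leq_add h3 (leqnn _)); move: r0r.
rewrite !mulnDr muln1; move: (L * (k' * N))%N (2 * (C + 2) * K1)%N (2 * (C + 2) * N.+1)%N => a b c.
by clear -le_mr; lia.
Qed.

(** * Stepanov's method *)

Section Stepanov.
Variables (F : finFieldType) (A : finComUnitRingType) (w : A) (y : A -> fps F).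
Hypothesis y_sep : forall s u, s != u -> exists a, y (a * s) != y (a * u).
Variables (N : nat) (bs : 'I_N -> A -> fps F) (D : {poly F}) (C : nat).
Hypothesis basis : is_basis y bs D C.
Local Notation U := (U y).
Local Notation q := #|F|.

Definition Uval (b : fps F) := exists m g, U m g /\ b = g 1.

Lemma Uval_U m g : U m g -> Uval (g 1). Proof. by exists m, g. Qed.
Lemma Uval_D b c : Uval b -> Uval c -> Uval (b + c).
Proof.
move=> [m [f [Uf ->]]] [n [g [Ug ->]]]; exists (m + n)%N, (fun x => f x + g x); split=> //.
by apply: U_add; [apply: U_le Uf; apply: leq_addr | apply: U_le Ug; apply: leq_addl].
Qed.
Lemma Uval_M b c : Uval b -> Uval c -> Uval (b * c).
Proof.
move=> [m [f [Uf ->]]] [n [g [Ug ->]]]; exists (m + n)%N, (fun x => f x * g x); split=> //.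
exact: U_mul.
Qed.
Lemma Uval_pofp (p : {poly F}) : Uval (pofp p).
Proof. by exists (size p), (fun _ => pofp p); split=> //; apply: U_poly. Qed.
Lemma Uval_N b : Uval b -> Uval (- b).
Proof. by move=> Ub; rewrite -mulN1r -(rmorph1 (@pofp F)) -rmorphN; apply: Uval_M Ub; apply: Uval_pofp. Qed.
Lemma Uval_X b n : Uval b -> Uval (b ^+ n).
Proof.
move=> Ub; elim: n => [|n IH]; first by rewrite expr0 -(rmorph1 (@pofp F)); apply: Uval_pofp.
by rewrite exprS; apply: Uval_M.
Qed.
Lemma Uval_sum (I : Type) (s : seq I) (P : pred I) (f : I -> fps F) :
  (forall i, P i -> Uval (f i)) -> Uval (\sum_(i <- s | P i) f i).
Proof.
move=> Uf; apply: (big_ind Uval) => //; last exact: Uval_D.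
by rewrite -(rmorph0 (@pofp F)); apply: Uval_pofp.
Qed.

(* The point of degree dividing [s] under [P] has Frobenius element [u]. *)
Definition tcong s (u : A) (P : {poly F}) := forall n f, U n f ->
  exists2 b, Uval b & f 1 ^+ (q ^ s) = f u + pofp P * b.

Lemma Uval_dvd n f b (P : {poly F}) : U n f -> Uval b -> f 1 != 0 ->
  f 1 = pofp P * b -> (size P <= n + C)%N.
Proof. by move=> Uf [m [g [Ug ->]]]; apply: (basis_dvd basis Uf Ug). Qed.

(** Some relation [f 1 = 0] fails at [u]; the congruence makes [P] divide the nonzero value [f u],
    and the weight of this [f] does not depend on [s] or [P]. *)
Lemma not_decomp_bound u : ~ decomp y u ->
  exists K, forall s P, tcong s u P -> (size P <= K)%N.
Proof.
move=> /existsNP[n /existsNP[f /not_implyP[Uf /not_implyP[f1 /eqP fu]]]].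
exists (n + C)%N => s P /(_ n f Uf)[b Ub].
rewrite f1 expr0n eqn0Ngt frob_gt0 => /eqP; rewrite eq_sym addr_eq0 => /eqP Efu.
have := @Uval_dvd n (fun x => f (u * x)) (- b) P; rewrite !mulr1; apply => //.
- exact: U_shift.
- exact: Uval_N.
- by rewrite Efu mulrN.
Qed.

Let bb X (ji : 'I_X * 'I_N) x := fpsX F ^+ ji.1 * bs ji.2 x.

Let Ubb X (ji : 'I_X * 'I_N) : U (X + C) (bb ji).
Proof.
case: basis => _ Ub _ _; apply: U_mul (Ub _); apply: U_le (U_Xn _ _); exact: ltnW.
Qed.

(** The auxiliary function is [Psi = \sum_v f2 v * bb v ^ r], with coefficients such that
    [\sum_v f2 v 1 ^ r * bb v u = 0]. As [bb v ^ (r * r)] is congruent to [bb v u] modulo [P], this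
    makes [P] divide [Psi 1 ^ r], hence also [Psi u], which is congruent to [Psi 1 ^ (r * r)]. Now
    [Psi u] is nonzero because [Psi 1] is, and its weight is about [r * M] with [M] about [r / N],
    so [basis_dvd] applies. *)
Lemma decomp_bound : exists K r0, forall e u P, u \is a GRing.unit -> decomp y u ->
  tcong (e + e) u P -> (r0 <= q ^ e)%N -> (N * size P <= (q ^ e) ^ 2 + K * q ^ e)%N.
Proof.
have N_gt0 : (0 < N)%N.
  rewrite -card_unit; apply: (decomp_card y_sep basis (e := fun _ : unit => 1)) => [[] []//|_].
  exact: decomp1.
have [K0 ordP] := basis_order basis.
pose K1 := (N.+1 * C + K0).+1.
have [k [r0 countP]] := stepanov_count C K1 N_gt0.
exists (N * (1 + 2 * C) + N * k + N * C)%N, (r0 + K1)%N => e u P uu Hu cong_u r0r.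
have [b0 Ub0] : exists b, Uval b by exists (pofp 0); apply: Uval_pofp.
set r := (q ^ e)%N in r0r *; have r_gt0 : (0 < r)%N := frob_gt0 F e.
have rr : (q ^ (e + e) = r * r)%N by rewrite expnD.
(* [L] is small enough that functions of weight [L + C] cannot vanish to order [r], as
   [frob_independent] demands; [M] exceeds [r / N] by the constant [k], so that the unknowns
   outnumber the equations. *)
pose L := ((r - K1) %/ N.+1)%N; pose m := (r %/ N)%N; pose M := (m + k)%N.
have Ldef : (N.+1 * L <= r - K1)%N by rewrite mulnC leq_trunc_div.
have Ldef' : (r - K1 < N.+1 * L + N.+1)%N by rewrite -mulnSr mulnC ltn_ceil.
have mdef : (N * m <= r)%N by rewrite mulnC leq_trunc_div.
have mdef' : (r < N * m + N)%N by rewrite -mulnSr mulnC ltn_ceil.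
have cnt : (N * (r * (L + C) + (M + C) + C) < (L * N) * (M * N))%N.
  by apply: countP => //; [apply: leq_trans r0r; apply: leq_addr | lia].
have ord_lt : (N.+1 * (L + C) + K0 < r)%N.
  by move: Ldef r0r; rewrite mulnDr /K1; lia.
pose K := (r * (L + C) + (M + C) + C)%N.
pose I1 : finType := ('I_L * 'I_N)%type; pose I2 : finType := ('I_M * 'I_N)%type.
pose h (v : I1 * I2) x := bb v.1 x ^+ r * bb v.2 (u * x).
have Uh v : U (r * (L + C) + (M + C)) (h v).
  exact: U_mul (U_exp _ (Ubb _)) (U_shift _ (Ubb _)).
have spanb n f : U n f -> exists c : 'I_N -> {poly F},
  (forall i, (size (c i) <= n + C)%N) /\ pofp D * f 1 = \sum_i pofp (c i) * bs i 1.
  by case: basis => _ _ _ /(_ n f).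
pose c v := projT1 (cid (spanb _ _ (Uh v))).
have cP v : (forall i, (size (c v i) <= K)%N) /\
    pofp D * h v 1 = \sum_i pofp (c v i) * bs i 1 := projT2 (cid (spanb _ _ (Uh v))).
have [||x [[v0 nzx] Ex]] := @poly_kernel F (I1 * I2)%type 'I_N K c.
- by move=> v i; case: (cP v).
- by rewrite !card_prod !card_ord.
have nzD : pofp D != 0.
  by case: basis => nz _ _ _; rewrite -(inj_eq (@pofp_inj F)) raddf0 in nz.
have sumh : \sum_v pofp (x v)%:P * h v 1 = 0.
  apply: (mulfI nzD); rewrite mulr0 mulr_sumr.
  under eq_bigr => v _ do rewrite mulrCA (proj2 (cP v)) mulr_sumr.
  rewrite exchange_big big1 // => i _.
  transitivity (pofp (\sum_v x v *: c v i) * bs i 1); last by rewrite Ex raddf0 mul0r.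
  rewrite rmorph_sum mulr_suml; apply: eq_bigr => v _.
  by rewrite -mul_polyC rmorphM mulrA.
pose f2 (v : I2) z := \sum_u1 pofp (x (u1, v))%:P * bb u1 z.
have Uf2 v : U (L + C) (f2 v).
  by apply: U_sum => u1 _; apply: (U_mul (U_const y (x (u1, v))) (Ubb u1)).
pose Psi z := \sum_v f2 v z * bb v z ^+ r.
have UPsi : U ((L + C) + r * (M + C)) Psi.
  by apply: U_sum => v _; apply: U_mul (Uf2 v) (U_exp _ (Ubb v)).
have sumf2 : \sum_v f2 v 1 ^+ r * bb v u = 0.
  rewrite -[RHS]sumh (eq_bigr (fun v => \sum_u1 pofp (x (u1, v))%:P * h (u1, v) 1)).
    rewrite exchange_big pair_bigA; by apply: eq_bigr => -[u1 v] _.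
  move=> v _; rewrite fps_frob_sum mulr_suml; apply: eq_bigr => u1 _.
  by rewrite exprMn -rmorphXn -polyC_exp expf_card_exp -mulrA /h [u * 1]mulr1.
pose V b := exists z : I1 -> F, b = \sum_u1 pofp (z u1)%:P * bb u1 1.
have PsiN0 : Psi 1 != 0.
  apply/eqP => Psi0; case/eqP: nzx.
  have f20 v : f2 v 1 = 0.
    apply: (@frob_independent F e I2 (fun v => f2 v 1) (fun v => bb v 1) V setT) => //.
    - by exists (fun _ => 0); rewrite big1 // => i _; rewrite raddf0 mul0r.
    - move=> _ _ [z1 ->] [z2 ->]; exists (fun i => z1 i + z2 i); rewrite -big_split.
      by apply: eq_bigr => i _; rewrite /= -mulrDl -rmorphD -polyCD.
    - move=> a _ [z ->]; exists (fun i => a * z i); rewrite mulr_sumr.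
      by apply: eq_bigr => i _; rewrite mulrA -rmorphM -polyCM.
    - move=> _ [z ->] vr; apply/eqP; apply: contraT => nz.
      have Uz : U (L + C) (fun t => \sum_u1 pofp (z u1)%:P * bb u1 t).
        by apply: U_sum => u1 _; apply: (U_mul (U_const y (z u1)) (Ubb u1)).
      by have := ordP _ _ _ Uz nz vr; rewrite leqNgt ord_lt.
    - by move=> v'; exists (fun u1 => x (u1, v')).
    - move=> z; under eq_bigl => i do rewrite inE.
      by move=> /(basis_indep_coef basis) z0 i _.
    - by under eq_bigl => i do rewrite inE.
  by case: v0 => u1 v; exact: (basis_indep_coef basis (f20 v)).
have cb (v : I2) := cong_u _ _ (Ubb v).
pose g v := s2val (cid2 (cb v)).
have Ug v : Uval (g v) by rewrite /g; case: (cid2 _).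
have gE v : bb v 1 ^+ (r * r) = bb v u + pofp P * g v.
  by rewrite /g -rr; case: (cid2 _).
pose G := \sum_v f2 v 1 ^+ r * g v.
have UG : Uval G.
  by apply: Uval_sum => v _; apply: Uval_M (Ug v); apply: Uval_X (Uval_U (Uf2 v)).
have PsiG : Psi 1 ^+ r = pofp P * G.
  rewrite fps_frob_sum /G mulr_sumr -[LHS]subr0 -[X in _ - X]sumf2 -sumrB.
  apply: eq_bigr => v _; rewrite exprMn -exprM gE; ring.
have [b Ub Eb] := cong_u _ _ UPsi.
have Psiu : Psi u = pofp P * (pofp P ^+ r.-1 * G ^+ r - b).
  apply/eqP; rewrite mulrBr mulrA -exprS prednK // eq_sym subr_eq -Eb rr exprM PsiG.
  by rewrite exprMn.
have sP : (size P <= (L + C) + r * (M + C) + C)%N.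
  have := @Uval_dvd _ (fun z => Psi (u * z)) (pofp P ^+ r.-1 * G ^+ r - b) P (U_shift u UPsi).
  rewrite !mulr1; apply; [|exact: (decomp_neq0 uu Hu UPsi PsiN0)|exact: Psiu].
  apply: Uval_D (Uval_N Ub); apply: Uval_M; apply: Uval_X => //; exact: Uval_pofp.
apply: leq_trans (_ : N * ((L + C) + r * (M + C) + C) <= _)%N.
  by rewrite leq_mul2l sP orbT.
have le_L : (L <= r)%N.
  exact: leq_trans (leq_pmull _ (ltn0Sn N)) (leq_trans Ldef (leq_subr _ _)).
have h1 : (r * (N * m) <= r * r)%N by rewrite leq_mul2l mdef orbT.
have h2 : (N * L <= N * r)%N by rewrite leq_mul2l le_L orbT.
have h3 : (N * (2 * C) <= N * (2 * C) * r)%N by rewrite leq_pmulr.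
rewrite -mulnn /M; clearbody L m r; clear -h1 h2 h3; lia.
Qed.
End Stepanov.

(** * Equidistribution of Frobenius elements *)

Lemma equidistribution_arith N h q2 q1 K1 K3 C0 a b c : (h < N)%N -> (0 < q1)%N ->
  (N * a <= N * c + h * (q2 + K1 * q1))%N -> (N * b <= N * K3)%N ->
  (N * q2 <= N * a + N * b + N * C0)%N ->
  (q2 <= N * c + (K1 + K3 + N * C0 + N * K1 + N * K3) * q1)%N.
Proof.
move=> lt_hN q1_gt0 le_a le_b le_q2.
have h1 : (h * (K1 * q1) <= N * (K1 * q1))%N by rewrite leq_mul2r (ltnW lt_hN) orbT.
have h2 : (h * q2 + q2 <= N * q2)%N by rewrite -mulSnr leq_mul2r lt_hN orbT.
have h3 : (N * C0 <= N * C0 * q1)%N by rewrite leq_pmulr.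
have h4 : (N * K3 <= N * K3 * q1)%N by rewrite leq_pmulr.
by lia.
Qed.

Section Equidistribution.
Variables (F : finFieldType) (A : finComUnitRingType) (w : A) (y : A -> fps F).
Hypothesis y_frob : forall a, y a ^+ #|F| = y a - fpsX F * y (w * a).
Hypothesis y_sep : forall s u, s != u -> exists a, y (a * s) != y (a * u).
Variable G : {set A}.
Hypotheses (G1 : 1 \in G) (GM : forall u v, u \in G -> v \in G -> u * v \in G).
Hypothesis (G_unit : forall u, u \in G -> u \is a GRing.unit).
Variables (P : nat -> A -> {poly F}) (n : nat -> A -> nat) (C0 : nat).
Hypothesis P_cong : forall e u, u \in G -> tcong y (e + e) u (P e u).
Hypothesis size_P : forall e u, u \in G -> size (P e u) = (n e u).+1.
Hypothesis sum_n : forall e, (#|F| ^ (e + e) <= \sum_(u in G) n e u + C0)%N.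
Local Notation q := #|F|.

(** The point is [#|H| <= N]. At most [N] upper bounds [(q^(2e) + O(q^e)) / N], together with [O(1)]
    outside [H], must add up to at least [q^(2e) - C0], so no element of [H] can fall short of its
    bound by more than [O(q^e)]. *)
Lemma torsor_equidistribution : exists (H : {set A}) (N K e0 : nat),
  [/\ (0 < N)%N, 1 \in H /\ H \subset G, forall u v, u \in H -> v \in H -> u * v \in H
   & forall e u, (e0 <= e)%N -> u \in G ->
     if u \in H then (N * n e u <= q ^ (e + e) + K * q ^ e)%N
                     /\ (q ^ (e + e) <= N * n e u + K * q ^ e)%N
     else (n e u <= K)%N].
Proof.
have [N [bs [D [C basis]]]] := basis_exists y_frob.
pose H := [set u in G | `[< decomp y u >]].
have H1 : 1 \in H by rewrite inE G1 asboolT //; apply: decomp1.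
have cardH : (#|H| <= N)%N.
  rewrite -(card_ord #|H|); apply: (decomp_card y_sep basis (e := fun i : 'I_#|H| => enum_val i)).
    exact: enum_val_inj.
  by move=> i; have := enum_valP i; rewrite inE => /andP[_ /asboolP].
have N_gt0 : (0 < N)%N by apply: leq_trans cardH; apply/card_gt0P; exists 1.
have [K1 [r0 boundH]] := decomp_bound y_sep basis.
have boundN u : exists K, u \in G -> u \notin H -> forall e, (n e u <= K)%N.
  case: (boolP ((u \in G) && (u \notin H))) => [/andP[uG uH]|]; last first.
    by move=> nuG; exists 0%N => uG uH; rewrite uG uH in nuG.
  have [] := @not_decomp_bound _ _ _ _ _ _ _ basis u.
    by move=> du; rewrite inE uG asboolT in uH.
  move=> K bK; exists K => _ _ e; have := bK _ _ (P_cong e uG).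
  by rewrite size_P // => /ltnW.
pose K2 u := projT1 (cid (boundN u)).
have K2P u : u \in G -> u \notin H -> forall e, (n e u <= K2 u)%N := projT2 (cid (boundN u)).
pose K3 := (\sum_(u in G) K2 u)%N.
pose K := (K1 + K3 + N * C0 + N * K1 + N * K3)%N.
have Hupper e u : (r0 <= e)%N -> u \in H -> (N * n e u <= q ^ (e + e) + K1 * q ^ e)%N.
  rewrite inE => le_e /andP[uG /asboolP Hu]; rewrite addnn -muln2 expnM.
  apply: leq_trans (boundH e u _ (G_unit uG) Hu (P_cong e uG) _).
    by rewrite leq_mul2l size_P // leqnSn orbT.
  exact: leq_trans le_e (ltnW (ltn_expl _ (card_gt1 F))).
exists H, N, K, r0; split=> //.
- by split=> //; apply/subsetP => u; rewrite inE => /andP[].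
- move=> u v; rewrite !inE => /andP[uG /asboolP Hu] /andP[vG /asboolP Hv].
  by rewrite GM // asboolT //; apply: decompM.
move=> e u le_e uG; have q_gt0 := frob_gt0 F e.
case: ifPn => uH; last first.
  apply: leq_trans (K2P u uG uH e) _; apply: leq_trans (_ : K3 <= _)%N.
    by rewrite /K3 (bigD1 u) //= leq_addr.
  by rewrite /K; lia.
split.
  by apply: leq_trans (Hupper e u le_e uH) _; rewrite leq_add2l leq_mul2r /K -!addnA leq_addr orbT.
have := sum_n e; rewrite (big_setID H) /= => le_sum.
have GH : G :&: H = H by apply/setIidPr/subsetP => v; rewrite inE => /andP[].
rewrite GH in le_sum.
have le_out : (\sum_(i in G :\: H) n e i <= K3)%N.
  apply: leq_trans (_ : \sum_(i in G :\: H) K2 i <= _)%N.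
    by apply: leq_sum => v; rewrite inE => /andP[vH vG]; apply: K2P.
  by rewrite /K3 [leqRHS](big_setID H) /= leq_addl.
have le_in : (N * \sum_(i in H) n e i <= N * n e u + #|H|.-1 * (q ^ (e + e) + K1 * q ^ e))%N.
  rewrite (big_setD1 u) //= mulnDr leq_add2l big_distrr /=.
  have -> : (#|H|.-1 = #|H :\ u|)%N by rewrite (cardsD1 u H) uH.
  rewrite -sum_nat_const; apply: leq_sum => v; rewrite !inE => /andP[_ Hv].
  by apply: Hupper; rewrite ?inE.
have [h hE] : exists h, #|H| = h.+1 by exists #|H|.-1; rewrite prednK //; apply/card_gt0P; exists 1.
rewrite hE /= in le_in cardH.
have : (N * q ^ (e + e) <= N * (\sum_(i in H) n e i + \sum_(i in G :\: H) n e i + C0))%N.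
  by rewrite leq_mul2l le_sum orbT.
rewrite !mulnDr.
have : (N * \sum_(i in G :\: H) n e i <= N * K3)%N by rewrite leq_mul2l le_out orbT.
move=> le_o le_q; apply: (@equidistribution_arith N h _ _ _ _ C0 _ _ _ cardH q_gt0 le_in le_o le_q).
Qed.
End Equidistribution.

(** * L-polynomials and power sums *)

Section Primes.
Variable F : finFieldType.
Implicit Types (f g P : {poly F}) (d e : nat).
Local Notation q := #|F|.

Definition monl e : seq {poly F} := [seq 'X^e + polyn p | p <- enum {poly_e F}].

Lemma mem_monl e f : (f \in monl e) = (f \is monic) && (size f == e.+1).
Proof.
apply/mapP/andP => [[p _ ->]|[mf /eqP sf]].
  have lt_p : (size p < size ('X^e : {poly F}))%N by rewrite size_polyXn ltnS size_npoly.
  by rewrite monicE lead_coefDl // -monicE monicXn size_polyDl // size_polyXn.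
have sr : (size (f - 'X^e)%R <= e)%N.
  apply/leq_sizeP => j le_ej; rewrite coefB coefXn; have [->|ne_j] := eqVneq j e.
    by move: mf; rewrite monicE lead_coefE sf => /eqP->; rewrite subrr.
  rewrite subr0 nth_default // sf ltn_neqAle eq_sym ne_j //.
by exists (NPoly sr); rewrite ?mem_enum //= addrC subrK.
Qed.

Lemma monl_uniq e : uniq (monl e).
Proof. by rewrite map_inj_uniq ?enum_uniq // => p p' /addrI /val_inj. Qed.

Lemma size_monl e : size (monl e) = (q ^ e)%N.
Proof. by rewrite size_map -cardE card_npoly. Qed.

Lemma monl_monic e f : f \in monl e -> f \is monic.
Proof. by rewrite mem_monl => /andP[]. Qed.

Lemma monl_size e f : f \in monl e -> size f = e.+1.
Proof. by rewrite mem_monl => /andP[_ /eqP]. Qed.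

Lemma monlM d e f g : f \in monl d -> g \in monl e -> f * g \in monl (d + e).
Proof.
rewrite !mem_monl => /andP[mf /eqP sf] /andP[mg /eqP sg].
by rewrite monicMr // mf size_monicM ?monic_neq0 // sf sg addSn addnS eqxx.
Qed.

Lemma monlX d f a : f \in monl d -> f ^+ a \in monl (a * d).
Proof.
move=> fd; elim: a => [|a IH]; last by rewrite exprS mulSn monlM.
by rewrite mem_monl monic1 size_poly1.
Qed.

Lemma monl_dvd d e f g : f \in monl d -> g \in monl e -> f %| g ->
  (d <= e)%N /\ exists2 h, h \in monl (e - d) & g = f * h.
Proof.
move=> fd ge fg; have mf := monl_monic fd; have mg := monl_monic ge.
have Eg : g = f * (g %/ f) by rewrite mulrC divpK.
have sg := monl_size ge; have sf := monl_size fd.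
have le_de : (d <= e)%N.
  by have := dvdp_leq (monic_neq0 mg) fg; rewrite sf sg.
split=> //; exists (g %/ f) => //.
rewrite mem_monl; apply/andP; split; first by rewrite -(monicMl _ mf) -Eg.
by rewrite size_divp ?monic_neq0 // sf sg /= subSn.
Qed.

Lemma perm_monl_dvd d e f : f \in monl d -> (d <= e)%N ->
  perm_eq [seq g <- monl e | f %| g] [seq f * k | k <- monl (e - d)].
Proof.
move=> fd le_de; apply: uniq_perm.
- by rewrite filter_uniq ?monl_uniq.
- by rewrite map_inj_uniq ?monl_uniq //; apply: mulfI; rewrite monic_neq0 ?(monl_monic fd).
move=> g; rewrite mem_filter; apply/andP/mapP => [[fg ge]|[k kd ->]].
  by case: (monl_dvd fd ge fg) => _ [k kd ->]; exists k.
by rewrite dvdp_mulr //; have := monlM fd kd; rewrite subnKC.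
Qed.

Lemma monl_dvd_none d e f : f \in monl d -> (e < d)%N -> [seq g <- monl e | f %| g] = [::].
Proof.
move=> fd lt_ed; apply/eqP; rewrite -size_eq0 size_filter eqn0Ngt -has_count.
apply/hasPn => g ge; apply/negP => fg.
by have [] := monl_dvd fd ge fg; rewrite leqNgt lt_ed.
Qed.

Lemma sum_monl_dvd (R : comNzRingType) (chi : {poly F} -> R) d e f :
  f \in monl d -> (forall g h, g \is monic -> h \is monic -> chi (g * h) = chi g * chi h) ->
  \sum_(g <- monl e | f %| g) chi g =
  if (d <= e)%N then chi f * \sum_(h <- monl (e - d)) chi h else 0.
Proof.
move=> fd chiM; rewrite -big_filter; case: leqP => [le_de|lt_ed]; last first.
  by rewrite (monl_dvd_none fd lt_ed) big_nil.
rewrite (perm_big _ (perm_monl_dvd fd le_de)) mulr_sumr big_map big_seq [RHS]big_seq.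
by apply: eq_bigr => h hd; rewrite chiM ?(monl_monic fd) ?(monl_monic hd).
Qed.

Definition irrs d : seq {poly F} := [seq P <- monl d | `[< irreducible_poly P >]].

Lemma mem_irrs d P : (P \in irrs d) = `[< irreducible_poly P >] && (P \in monl d).
Proof. by rewrite mem_filter. Qed.

Lemma irrs_uniq d : uniq (irrs d). Proof. by rewrite filter_uniq ?monl_uniq. Qed.

Lemma irrs_monl d P : P \in irrs d -> P \in monl d.
Proof. by rewrite mem_irrs => /andP[]. Qed.

Lemma irrs_irr d P : P \in irrs d -> irreducible_poly P.
Proof. by rewrite mem_irrs => /andP[/asboolP]. Qed.

Lemma irr_exists e f : f \in monl e -> (0 < e)%N ->
  exists d P, [/\ (0 < d)%N, (d <= e)%N, P \in irrs d & P %| f].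
Proof.
elim/ltn_ind: e f => e IH f fe e_gt0.
have [irrf|nirr] := pselect (irreducible_poly f).
  by exists e, f; rewrite mem_irrs asboolT //= fe.
have sf := monl_size fe; have nzf := monic_neq0 (monl_monic fe).
have [g [sg gf ne]] : exists g, [/\ size g != 1%N, g %| f & ~~ (g %= f)].
  apply: contrapT => nex; apply: nirr; split; first by rewrite sf.
  by move=> g sg gf; apply: contraT => ne; case: nex; exists g.
pose g' := (lead_coef g)^-1 *: g.
have nzg : g != 0 by apply: contraTneq gf => ->; rewrite dvd0p.
have lc : (lead_coef g)^-1 != 0 by rewrite invr_eq0 lead_coef_eq0.
have g'f : g' %| f by rewrite dvdpZl.
have sg' : size g' = size g by rewrite size_scale.
have lt_sg : (size g < size f)%N.
  by rewrite ltn_neqAle dvdp_leq // andbT; apply: contra ne => ss; rewrite -dvdp_size_eqp.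
have g'm : g' \in monl (size g).-1.
  rewrite mem_monl sg' monicE lead_coefZ mulVf ?lead_coef_eq0 // eqxx /=.
  by rewrite prednK // size_poly_gt0.
have sg1 : (1 < size g)%N by rewrite ltn_neqAle eq_sym sg size_poly_gt0.
have [||d [P [d_gt0 le_d Pd Pg]]] := IH (size g).-1 _ g' g'm.
- by rewrite sf in lt_sg; rewrite -ltnS prednK // ltnW.
- by rewrite -ltnS prednK // ltnW.
exists d, P; split=> //; last exact: dvdp_trans Pg g'f.
by apply: leq_trans le_d _; rewrite -ltnS prednK ?(ltnW sg1) // -sf ltnW.
Qed.

Lemma irr_coprime d P f : P \in irrs d -> ~~ (P %| f) -> coprimep P f.
Proof.
move=> /irrs_irr[_ iP]; apply: contraR => /iP/(_ (dvdp_gcdl _ _)) eqP_.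
by rewrite -(eqp_dvdl _ eqP_) dvdp_gcdr.
Qed.

Lemma monic_dvd_eq d e f g : f \in monl d -> g \in monl e -> f %= g -> f = g.
Proof.
by move=> /monl_monic mf /monl_monic mg; rewrite eqp_monic // => /eqP.
Qed.

Lemma irrs_coprime d d' P P' : P \in irrs d -> P' \in irrs d' -> P != P' -> coprimep P P'.
Proof.
move=> Pd Pd' neP; apply: (irr_coprime Pd); apply: contra neP => PP'.
have [sP _] := irrs_irr Pd; have [_ /(_ P)] := irrs_irr Pd'.
rewrite neq_ltn sP orbT => /(_ isT PP') /(monic_dvd_eq (irrs_monl Pd) (irrs_monl Pd')) ->.
exact: eqxx.
Qed.

(** The multiplicity of [P] in [f], cut off at [M]. As a count of dividing powers it can be
    exchanged with sums over [f]. *)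
Definition pval M P f : nat := (\sum_(1 <= a < M.+1) nat_of_bool (P ^+ a %| f)%R)%N.

Lemma sum_pval M e f : f \in monl e -> (e <= M)%N ->
  (\sum_(1 <= d < M.+1) \sum_(P <- irrs d) d * pval M P f)%N = e.
Proof.
elim/ltn_ind: e f M => e IH f M fe le_eM.
have [e0|e_gt0] := posnP e.
  rewrite e0 big_nat big1 // => d /andP[d_gt0 _]; rewrite big_seq big1 // => P Pd.
  rewrite /pval big_nat big1 ?muln0 // => a /andP[a_gt0 _].
  have sf : size f == 1%N by rewrite (monl_size fe) e0.
  apply/eqP; rewrite eqb0; apply: contraTN sf => /dvdp_leq.
  rewrite monic_neq0 ?(monl_monic fe) // (monl_size (monlX a (irrs_monl Pd))) => /(_ isT) h.
  by rewrite neq_ltn (leq_trans _ h) ?orbT // ltnS muln_gt0 a_gt0.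
have [d0 [P0 [d0_gt0 le_d0 P0d P0f]]] := irr_exists fe e_gt0.
have [_ [g ge fE]] := monl_dvd (irrs_monl P0d) fe P0f.
have lt_e : (e - d0 < e)%N by lia.
have nzP0 := monic_neq0 (monl_monic (irrs_monl P0d)).
have nzg := monic_neq0 (monl_monic ge).
have gM P d : P \in irrs d -> (0 < d)%N -> (P ^+ M %| g) = false.
  move=> Pd d_gt0; apply/negP => /(dvdp_leq nzg).
  rewrite (monl_size ge) (monl_size (monlX M (irrs_monl Pd))); nia.
have val P d : P \in irrs d -> (0 < d)%N -> pval M P f = (pval M P g + (P == P0))%N.
  move=> Pd d_gt0; have M_gt0 : (0 < M)%N by lia.
  rewrite /pval; have [->|ne] := eqVneq P P0.
    rewrite big_ltn // expr1 P0f addnC; congr (_ + _)%N.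
    rewrite [in RHS]big_nat_recr //= (gM P0 d0) // addn0 big_add1 /= fE.
    by apply: eq_bigr => a _; rewrite exprS dvdp_mul2l.
  rewrite addn0; apply: eq_bigr => a _; rewrite fE Gauss_dvdpr //.
  by rewrite coprimep_expl // (irrs_coprime Pd P0d).
transitivity ((\sum_(1 <= d < M.+1) \sum_(P <- irrs d) d * pval M P g) +
    \sum_(1 <= d < M.+1) \sum_(P <- irrs d) d * (P == P0))%N.
  rewrite -big_split; apply: eq_big_nat => d /andP[d_gt0 _] /=.
  rewrite -big_split big_seq [RHS]big_seq; apply: eq_bigr => P Pd /=.
  by rewrite (val P d) // mulnDr.
rewrite (IH _ lt_e g M ge); last by lia.
rewrite (bigD1_seq d0) ?iota_uniq //=; last by rewrite mem_index_iota d0_gt0 ltnS (leq_trans le_d0).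
rewrite (bigD1_seq P0) ?irrs_uniq //= eqxx muln1.
rewrite [X in (d0 + X)%N]big1 => [|P /negPf->]; last by rewrite muln0.
rewrite big1 => [|d ne_d]; first by lia.
rewrite big_seq big1 // => P Pd; case: eqP => [EP|_]; last by rewrite muln0.
case/eqP: ne_d; apply: succn_inj.
by rewrite -(monl_size (irrs_monl Pd)) EP (monl_size (irrs_monl P0d)).
Qed.

Section Newton.
Variables (R : comNzRingType) (chi : {poly F} -> R).
Hypothesis chi1 : chi 1 = 1.
Hypothesis chiM : forall g h, g \is monic -> h \is monic -> chi (g * h) = chi g * chi h.

Definition Lcoef e : R := \sum_(f <- monl e) chi f.
Definition prime_sum i : R :=
  \sum_(1 <= d < i.+1 | (d %| i)%N) \sum_(P <- irrs d) d%:R * chi P ^+ (i %/ d).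

Lemma chiX P a : P \is monic -> chi (P ^+ a) = chi P ^+ a.
Proof.
move=> mP; elim: a => [|a IH]; first exact: chi1.
by rewrite !exprS chiM ?IH // monic_exp.
Qed.

Lemma Lcoef0 : Lcoef 0 = 1.
Proof.
rewrite /Lcoef (perm_big [:: 1]) ?big_seq1 //=; apply: uniq_perm; rewrite ?monl_uniq // => f.
rewrite mem_monl inE; apply/andP/eqP => [[mf /eqP sf]|->]; last by rewrite monic1 size_poly1.
move: mf; rewrite monicE; have /size1_polyC-> : (size f <= 1)%N by rewrite sf.
by rewrite lead_coefC => /eqP->.
Qed.

(** The logarithmic derivative of the Euler product, coefficient by coefficient: [e] is written as
    the sum of [d] times the multiplicities of the primes in [f], and the [f] divisible by [P ^+ a]
    contribute [chi P ^+ a] times a lower coefficient. *)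
Lemma Lcoef_newton e : e%:R * Lcoef e = \sum_(1 <= i < e.+1) prime_sum i * Lcoef (e - i).
Proof.
transitivity (\sum_(1 <= d < e.+1) \sum_(P <- irrs d) \sum_(1 <= a < e.+1)
    if (a * d <= e)%N then d%:R * chi P ^+ a * Lcoef (e - a * d) else 0).
  transitivity (\sum_(f <- monl e) \sum_(1 <= d < e.+1) \sum_(P <- irrs d)
      \sum_(1 <= a < e.+1) (d%:R * if P ^+ a %| f then chi f else 0)).
    rewrite mulr_sumr big_seq [RHS]big_seq; apply: eq_bigr => f fe.
    rewrite -{1}(sum_pval fe (leqnn e)) natr_sum mulr_suml; apply: eq_bigr => d _.
    rewrite natr_sum mulr_suml; apply: eq_bigr => P _.
    rewrite natrM natr_sum -mulrA mulr_suml mulr_sumr; apply: eq_bigr => a _.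
    by case: (P ^+ a %| f); rewrite ?mul1r ?mul0r.
  rewrite exchange_big; apply: eq_bigr => d _; rewrite exchange_big big_seq [RHS]big_seq.
  apply: eq_bigr => P Pd; rewrite exchange_big; apply: eq_bigr => a _ /=.
  rewrite -mulr_sumr -big_mkcond (sum_monl_dvd e (monlX a (irrs_monl Pd)) chiM).
  by case: ifP => _; rewrite ?mulr0 // mulrA chiX // (monl_monic (irrs_monl Pd)).
pose S d a i := \sum_(P <- irrs d) d%:R * chi P ^+ a * Lcoef (e - i).
transitivity (\sum_(1 <= d < e.+1) \sum_(1 <= a < e.+1) \sum_(1 <= i < e.+1)
    if (i == a * d)%N then S d a i else 0).
  apply: eq_big_nat => d /andP[d_gt0 _]; rewrite exchange_big; apply: eq_big_nat => a /andP[a_gt0 _].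
  have -> : \sum_(1 <= i < e.+1) (if (i == a * d)%N then S d a i else 0)
      = if (a * d <= e)%N then S d a (a * d)%N else 0.
    case: leqP => [le_ad|lt_ad]; last first.
      rewrite big_nat big1 // => i /andP[_ le_i]; case: eqP => // E.
      by move: le_i; rewrite E ltnS leqNgt lt_ad.
    rewrite (bigD1_seq (a * d)%N) ?iota_uniq //=; last first.
      by rewrite mem_index_iota muln_gt0 a_gt0 d_gt0.
    by rewrite eqxx big1 ?addr0 // => i /negPf->.
  by case: ifP => _ //; rewrite big1.
transitivity (\sum_(1 <= i < e.+1) \sum_(1 <= d < e.+1) \sum_(1 <= a < e.+1)
    if (i == a * d)%N then S d a i else 0).
  by under eq_bigr => d _ do rewrite exchange_big; rewrite exchange_big.
apply: eq_big_nat => i /andP[i_gt0 le_ie].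
rewrite /prime_sum mulr_suml (big_cat_nat (n := i.+1)) //=.
rewrite [X in _ + X]big1_seq ?addr0; last first.
  move=> d /andP[_]; rewrite mem_index_iota => /andP[lt_id _].
  rewrite big_nat big1 // => a /andP[a_gt0 _]; case: eqP => // E; nia.
rewrite [RHS]big_mkcond; apply: eq_big_nat => d /andP[d_gt0 le_di].
case: ifPn => [d_i|nd_i]; last first.
  rewrite big1 // => a _; case: eqP => // E; by rewrite E dvdn_mull in nd_i.
rewrite (bigD1_seq (i %/ d)%N) ?iota_uniq ?mem_index_iota //=; last first.
  by rewrite divn_gt0 // -ltnS le_di ltnS (leq_trans (leq_div _ _)).
rewrite divnK // eqxx big1 ?addr0 => [|a ne_a]; last first.
  by case: eqP => // E; rewrite E mulnK ?eqxx in ne_a.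
by rewrite /S mulr_suml.
Qed.
End Newton.

(** The case [chi = 1], where [Lcoef e] is [q^e]: the recursion then forces [prime_sum i = q^i]. *)
Lemma prime_count i : (0 < i)%N ->
  (\sum_(1 <= d < i.+1 | d %| i) d * size (irrs d))%N = (q ^ i)%N.
Proof.
elim/ltn_ind: i => i IH i_gt0; pose chi := fun _ : {poly F} => 1 : int.
have L e : Lcoef chi e = (q ^ e)%N%:R.
  by rewrite /Lcoef /chi big_const_seq count_predT size_monl iter_addr_0.
have ps j : prime_sum chi j = (\sum_(1 <= d < j.+1 | d %| j) d * size (irrs d))%N%:R.
  rewrite /prime_sum natr_sum; apply: eq_bigr => d _; rewrite /chi.
  under eq_bigr => P _ do rewrite expr1n mulr1.
  by rewrite big_const_seq count_predT iter_addr_0 -mulrnA mulnC.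
have := Lcoef_newton (chi := chi) erefl (fun g h _ _ => erefl) i.
rewrite big_nat_recr //= subnn !L expn0 mulr1 ps.
rewrite (eq_big_nat _ _ (F2 := fun _ => (q ^ i)%N%:R : int)); last first.
  move=> j /andP[j_gt0 lt_ji]; rewrite ps IH // L -natrM -expnD subnKC //; exact: ltnW.
rewrite /= sumr_const_nat -{1}(prednK i_gt0) subn1 -natr1 mulrDl mul1r mulr_natl.
by move=> /addrI /eqP; rewrite eqr_nat => /eqP.
Qed.
End Primes.

(** * Power sums and inverse roots *)

Section PowerSums.
Implicit Types (s : seq algC).

Definition lin_prod s : {poly algC} := \prod_(a <- s) (1 - a%:P * 'X).
Definition power_sum s i : algC := \sum_(a <- s) a ^+ i.

Lemma lin_prod_factor m (L : {poly algC}) : (size L <= m.+1)%N -> L`_0 = 1 ->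
  exists s, (size s <= m)%N /\ L = lin_prod s.
Proof.
elim: m L => [|m IH] L sL L0.
  by exists [::]; split=> //; rewrite /lin_prod big_nil (size1_polyC sL) L0.
have [le_s|lt_s] := leqP (size L) m.+1.
  by have [s [ss ->]] := IH L le_s L0; exists s; split=> //; apply: leqW.
have [|r rL] := closed_rootP L _; first by rewrite neq_ltn orbC (leq_trans _ lt_s).
have nz_r : r != 0.
  apply: contraTneq rL => ->; by rewrite /root horner_coef0 L0 oner_eq0.
have /factor_theorem[M EL] := rL.
have EL' : L = (1 - (r^-1)%:P * 'X) * ((- r)%:P * M).
  have VR : (r^-1)%:P * r%:P = 1 :> {poly algC} by rewrite -polyCM mulVf.
  rewrite EL polyCN -[M in LHS]mul1r.
  transitivity (((r^-1)%:P * r%:P) * 'X * M - r%:P * M); first by rewrite VR; ring.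
  by ring.
have nzL : L != 0 by rewrite -size_poly_gt0 (leq_trans _ lt_s).
have nzM : M != 0 by apply: contraNneq nzL => M0; rewrite EL M0 mul0r.
have [||s [ss Es]] := IH ((- r)%:P * M).
- rewrite mul_polyC size_scale ?oppr_eq0 //.
  by move: sL; rewrite EL size_mul ?polyXsubC_eq0 // size_XsubC addn2.
- by have := L0; rewrite EL' coef0M coefB coefMX coef1 subr0 mul1r.
by exists (r^-1 :: s); split=> //; rewrite EL' Es /lin_prod big_cons.
Qed.

Lemma coef_lin_prodS a s e :
  (lin_prod (a :: s))`_e.+1 = (lin_prod s)`_e.+1 - a * (lin_prod s)`_e.
Proof. by rewrite /lin_prod big_cons mulrBl mul1r coefB -mulrA coefCM coefXM. Qed.

Lemma coef_lin_prod0 s : (lin_prod s)`_0 = 1.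
Proof.
elim: s => [|a s IH]; first by rewrite /lin_prod big_nil coef1.
by rewrite /lin_prod big_cons coef0M coefB coef1 coefCM coefX mulr0 subr0 mul1r -[RHS]IH.
Qed.

Lemma newton_lin_prod s e :
  e%:R * (lin_prod s)`_e = - \sum_(1 <= i < e.+1) power_sum s i * (lin_prod s)`_(e - i).
Proof.
elim: s e => [|a s IH] e.
  rewrite big1 ?oppr0 => [|i _]; last by rewrite /power_sum big_nil mul0r.
  by rewrite /lin_prod big_nil coef1; case: e => [|e]; rewrite ?mul0r ?mulr0.
case: e => [|e]; first by rewrite mul0r big_nil oppr0.
(* The geometric series [a X / (1 - a X)] times [lin_prod (a :: s)] is [a X] times [lin_prod s]. *)
have geo k : \sum_(1 <= i < k.+2) a ^+ i * (lin_prod (a :: s))`_(k.+1 - i) = a * (lin_prod s)`_k.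
  elim: k => [|k IHk].
    by rewrite big_nat1 subnn expr1 !coef_lin_prod0.
  rewrite big_nat_recl // big_add1 /= subSS subn0 coef_lin_prodS.
  transitivity (a * ((lin_prod s)`_k.+1 - a * (lin_prod s)`_k) +
     a * \sum_(1 <= i < k.+2) a ^+ i * (lin_prod (a :: s))`_(k.+1 - i)); last by rewrite IHk; ring.
  congr (_ + _); rewrite mulr_sumr big_add1 /=; apply: eq_bigr => i _.
  by rewrite exprS subSS mulrA.
have sh (u : nat -> algC) : \sum_(1 <= i < e.+2) u i * (lin_prod (a :: s))`_(e.+1 - i) =
    \sum_(1 <= i < e.+2) u i * (lin_prod s)`_(e.+1 - i) -
    a * \sum_(1 <= i < e.+1) u i * (lin_prod s)`_(e - i).
  rewrite big_nat_recr // [X in X - _]big_nat_recr //= subnn !coef_lin_prod0 mulr_sumr.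
  rewrite addrAC; congr (_ + _); rewrite -sumrB; apply: eq_big_nat => i /andP[_ lt_i].
  by rewrite subSn // coef_lin_prodS; ring.
rewrite (eq_bigr (fun i => a ^+ i * (lin_prod (a :: s))`_(e.+1 - i) +
    power_sum s i * (lin_prod (a :: s))`_(e.+1 - i))); last first.
  by move=> i _; rewrite /power_sum big_cons mulrDl.
rewrite big_split /= geo sh coef_lin_prodS mulrBr IH.
have := IH e; rewrite -natr1 => /(congr1 (fun x => a * x)) IHe.
apply/eqP; rewrite -subr_eq0; apply/eqP.
transitivity (- (a * (e%:R * (lin_prod s)`_e)) +
   a * (- \sum_(1 <= i < e.+1) power_sum s i * (lin_prod s)`_(e - i))); last by rewrite IHe addNr.
by ring.
Qed.

(** The identities determine each [p i] from the [c e], and the negated power sums of the inverse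
    roots satisfy the same identities. *)
Lemma newton_roots m (c p : nat -> algC) : c 0%N = 1 -> (forall e, (m < e)%N -> c e = 0) ->
  (forall e, e%:R * c e = \sum_(1 <= i < e.+1) p i * c (e - i)%N) ->
  exists s, (size s <= m)%N /\ forall i, (0 < i)%N -> p i = - power_sum s i.
Proof.
move=> c0 cm newton; pose L : {poly algC} := \poly_(e < m.+1) c e.
have Lc e : L`_e = c e by rewrite coef_poly ltnS; case: leqP => // /cm.
have [||s [ss Es]] := @lin_prod_factor m L; rewrite ?size_poly ?Lc //.
exists s; split=> // i; elim/ltn_ind: i => i IH i_gt0.
have := newton_lin_prod s i; rewrite -Es Lc newton -sumrN !big_nat_recr //= subnn !Lc c0 !mulr1.
rewrite (eq_big_nat _ _ (F2 := fun j => - (power_sum s j * L`_(i - j)))).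
  by move=> /addrI.
by move=> j /andP[j_gt0 lt_j]; rewrite IH // Lc mulNr.
Qed.

Lemma bernoulli (x : algC) n : 0 <= x -> 1 + n%:R * x <= (1 + x) ^+ n.
Proof.
move=> x0; elim: n => [|n IH]; first by rewrite mul0r addr0.
rewrite exprS; apply: le_trans (ler_wpM2l _ IH); last by rewrite addr_ge0.
have -> : (1 + x) * (1 + n%:R * x) = 1 + n.+1%:R * x + n%:R * (x * x).
  by rewrite -natr1; ring.
by rewrite lerDl mulr_ge0 // ?mulr_ge0 ?ler0n.
Qed.

(** Combining shifted power sums with the coefficients of a polynomial [f] that vanishes at all
    other members of [s] isolates a positive multiple of [f.[b] * b ^+ u]. Hence [|b|^u = O(B^u)],
    and Bernoulli's inequality excludes [|b| > B]. *)
Lemma power_sum_bound s (B K : algC) u0 : 0 < B -> 0 <= K ->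
  (forall u, (u0 <= u)%N -> `|power_sum s u| <= K * B ^+ u) ->
  forall a, a \in s -> `|a| <= B.
Proof.
move=> B_gt0 K_ge0 bound b bs; pose T := rem b (undup s).
pose f : {poly algC} := \prod_(g <- T) ('X - g%:P).
have fb : f.[b] != 0.
  rewrite horner_prod prodf_seq_neq0; apply/allP => g gT /=.
  rewrite hornerXsubC subr_eq0; apply: contraTneq gT => <-.
  by rewrite mem_rem_uniqF ?undup_uniq.
have fg g : g \in s -> g != b -> f.[g] = 0.
  move=> gs ne; apply/eqP; rewrite horner_prod prodf_seq_eq0; apply/hasP; exists g.
    by rewrite mem_rem_uniq ?undup_uniq // !inE ne mem_undup.
  by rewrite /= hornerXsubC subrr.
have comb u : \sum_(v < size f) f`_v * power_sum s (u + v) = (count_mem b s)%:R * (f.[b] * b ^+ u).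
  transitivity (\sum_(a <- s) a ^+ u * f.[a]).
    rewrite /power_sum; under eq_bigr => v _ do rewrite mulr_sumr.
    rewrite exchange_big; apply: eq_bigr => a _ /=; rewrite horner_coef mulr_sumr.
    by apply: eq_bigr => v _; rewrite exprD; ring.
  rewrite (bigID (pred1 b)) /= [X in _ + X]big_seq_cond [X in _ + X]big1 ?addr0; last first.
    by move=> g /andP[gs ne]; rewrite fg // mulr0.
  rewrite (eq_bigr (fun _ => f.[b] * b ^+ u)); last by move=> g /eqP->; rewrite mulrC.
  by rewrite big_const_seq iter_addr_0 mulr_natl.
have cb : (0 < count_mem b s)%N by rewrite -has_count has_pred1.
pose K' := (\sum_(v < size f) `|f`_v| * (K * B ^+ v)) / `|f.[b]|.
have nfb : 0 < `|f.[b]| by rewrite normr_gt0.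
have K'_ge0 : 0 <= K'.
  rewrite divr_ge0 ?(ltW nfb) // sumr_ge0 // => v _.
  by rewrite mulr_ge0 ?normr_ge0 // mulr_ge0 // exprn_ge0 // ltW.
have le_b u : (u0 <= u)%N -> `|b| ^+ u <= K' * B ^+ u.
  move=> le_u; rewrite /K' mulrAC ler_pdivlMr // -normrX -normrM mulrC.
  apply: le_trans (_ : `|(count_mem b s)%:R * (f.[b] * b ^+ u)| <= _).
    by rewrite [leRHS]normrM normr_nat ler_peMl ?normr_ge0 // ler1n.
  rewrite -comb mulr_suml; apply: le_trans (ler_norm_sum _ _ _) _; apply: ler_sum => v _.
  rewrite normrM -!mulrA ler_wpM2l ?normr_ge0 // -exprD [(_ + u)%N]addnC.
  by apply: bound; apply: leq_trans le_u (leq_addr _ _).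
have b_real : `|b| \is Num.real by apply: normr_real.
rewrite real_leNgt // ?gtr0_real //; apply/negP => lt_Bb.
pose x := `|b| / B - 1.
have x_gt0 : 0 < x by rewrite subr_gt0 ltr_pdivlMr // mul1r.
pose n := maxn u0 (Num.bound (K' / x)).
have := le_b n (leq_maxl _ _); rewrite -ler_pdivrMr ?exprn_gt0 // -expr_div_n.
have -> : `|b| / B = 1 + x by rewrite /x; ring.
move=> le_K; have := le_trans (bernoulli n (ltW x_gt0)) le_K.
have rK' : K' \is Num.real by rewrite ger0_real.
have rx : 1 + n%:R * x \is Num.real by rewrite ger0_real // addr_ge0 // mulr_ge0 ?ler0n // ltW.
apply/negP; rewrite -real_ltNge //.
have : K' / x < n%:R.
  apply: lt_le_trans (archi_boundP (divr_ge0 K'_ge0 (ltW x_gt0))) _.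
  by rewrite ler_nat leq_maxr.
by rewrite ltr_pdivrMr // => h; apply: lt_trans h _; rewrite ltrDr.
Qed.
End PowerSums.

(** * Reversal of polynomials *)

Section Reversal.
Variable R : comNzRingType.
Implicit Types p r : {poly R}.

(** This is [x^n p(1/x)] for a prescribed [n]; unlike the reversal by the actual degree it is
    additive. *)
Definition revn n p : {poly R} := \poly_(i < n.+1) p`_(n - i).

Lemma coef_revn n p i : (revn n p)`_i = if (i <= n)%N then p`_(n - i) else 0.
Proof. by rewrite coef_poly ltnS. Qed.

Lemma revn_is_zmod n : zmod_morphism (revn n).
Proof. by move=> p r; apply/polyP => i; rewrite coefB !coef_revn coefB; case: ifP; rewrite ?subr0. Qed.
HB.instance Definition _ n := GRing.isZmodMorphism.Build {poly R} {poly R} (revn n) (revn_is_zmod n).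

Lemma revnC n c p : revn n (c%:P * p) = c%:P * revn n p.
Proof. by apply/polyP => i; rewrite coefCM !coef_revn coefCM; case: ifP; rewrite ?mulr0. Qed.

Lemma revnX n p : revn n.+1 ('X * p) = revn n p.
Proof.
apply/polyP => i; rewrite !coef_revn coefXM.
case: (leqP i n) => [le_in|lt_ni]; first by rewrite leqW // subSn.
by case: ifP => // le_i; rewrite (_ : i = n.+1) ?subnn //; apply/eqP; rewrite eqn_leq le_i.
Qed.

Lemma revn_shift m n p : (size p <= n.+1)%N -> revn (m + n) p = 'X^m * revn n p.
Proof.
move=> sp; apply/polyP => i; rewrite coefXnM !coef_revn; case: ltnP => [lt_im|le_mi].
  by case: ifP => // _; rewrite nth_default //; apply: leq_trans sp _; lia.
by rewrite leq_subLR subnBA // [(n + m)%N]addnC.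
Qed.

Lemma revn1 n : revn n 1 = 'X^n.
Proof.
apply/polyP => i; rewrite coef_revn coef1 coefXn subn_eq0 eqn_leq.
by case: leqP.
Qed.

Lemma revnM m n p r : (size p <= m.+1)%N -> (size r <= n.+1)%N ->
  revn (m + n) (p * r) = revn m p * revn n r.
Proof.
elim: m p => [|m IH] p sp sr.
  rewrite (size1_polyC sp) revnC; congr (_ * _); apply/polyP => i.
  by rewrite coef_revn coefC leqn0; case: eqP => // ->; rewrite subnn coefC.
pose p' := \poly_(i < m.+1) p`_i.+1.
have -> : p = 'X * p' + (p`_0)%:P.
  apply/polyP => i; rewrite coefD coefXM coefC; case: i => [|i] /=; first by rewrite add0r.
  by rewrite addr0 coef_poly; case: ltnP => // le_i; rewrite nth_default // (leq_trans sp).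
rewrite mulrDl -mulrA !raddfD /= addSn !revnX revnC IH ?size_poly // mulrDl; congr (_ + _).
by rewrite -addSn revn_shift // -[X in revn m.+1 X]mulr1 revnC revn1 mulrA.
Qed.

Lemma revnK n p : (size p <= n.+1)%N -> revn n (revn n p) = p.
Proof.
move=> sp; apply/polyP => i; rewrite !coef_revn leq_subr.
by case: leqP => [le_in|lt_ni]; [rewrite subKn | rewrite nth_default // (leq_trans sp)].
Qed.

Lemma revn_lin (s : seq R) :
  revn (size s) (\prod_(a <- s) ('X - a%:P)) = \prod_(a <- s) (1 - a%:P * 'X).
Proof.
elim: s => [|a s IH].
  by rewrite !big_nil revn1.
rewrite !big_cons -IH /= -add1n revnM ?size_XsubC //; last first.
  by rewrite size_prod_XsubC.
congr (_ * _); apply/polyP => i; rewrite coef_revn coefB coefC coefX coefB coef1 coefCM coefX.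
by case: i => [|[|i]] /=; rewrite ?mulr0 ?mulr1 ?subr0.
Qed.

End Reversal.

Lemma revn_map (R S : comNzRingType) (f : {rmorphism R -> S}) n (p : {poly R}) :
  map_poly f (revn n p) = revn n (map_poly f p).
Proof.
apply/polyP => i; rewrite coef_map !coef_revn coef_map /=.
by case: ifP => // _; rewrite rmorph0.
Qed.

Lemma in_qpoly_eq0 (K : fieldType) (h p : {poly K}) : h \is monic -> (1 < size h)%N ->
  (in_qpoly h p == 0) = (h %| p).
Proof.
move=> hm sh; rewrite -val_eqE /= /mk_monic sh hm /=.
by rewrite -Pdiv.IdomainMonic.modpE.
Qed.

(** * Frobenius conjugates modulo a prime *)

Section Residue.
Variables (F : finFieldType) (d : nat) (P : {poly F}).
Hypothesis Pd : P \in irrs F d.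
Local Notation q := #|F|.

Let mi : monic_irreducible_poly P.
Proof. by split; [apply: irrs_irr Pd | apply: monl_monic (irrs_monl Pd)]. Qed.
Let sP : size P = d.+1. Proof. exact: monl_size (irrs_monl Pd). Qed.
Let mP : P \is monic. Proof. exact: monl_monic (irrs_monl Pd). Qed.
Let d_gt0 : (0 < d)%N. Proof. by have [] := irrs_irr Pd; rewrite sP. Qed.
Let K : finFieldType := {poly %/ P with mi}.
Let red (p : {poly F}) : K := in_qpoly P p.

Let redB : zmod_morphism red. Proof. exact: (raddfB (in_qpoly P)). Qed.
HB.instance Definition _ := GRing.isZmodMorphism.Build {poly F} K red redB.
Let redM : monoid_morphism red.
Proof. by split; [exact: (rmorph1 (in_qpoly P)) | exact: (rmorphM (in_qpoly P))]. Qed.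
HB.instance Definition _ := GRing.isMonoidMorphism.Build {poly F} K red redM.

Let red_eq0 p : (red p == 0) = (P %| p).
Proof. by rewrite -(in_qpoly_eq0 p mP) // sP. Qed.

Let red_val (x : K) : exists p, x = red p.
Proof.
exists (val x : {poly F}); apply/val_inj => /=.
by rewrite Pdiv.CommonRing.rmodp_small // size_mk_monic.
Qed.

Let cst : {rmorphism F -> K} := red \o polyC.

Let red_comp (p g : {poly F}) : red (p \Po g) = (map_poly cst p).[red g].
Proof.
elim/poly_ind: p => [|p c IH]; first by rewrite comp_poly0 !rmorph0 horner0.
rewrite comp_polyD comp_polyM comp_polyX comp_polyC rmorphD rmorphM /= IH.
by rewrite rmorphD rmorphM /= map_polyX map_polyC hornerMXaddC.
Qed.

Let card_K : #|K| = (q ^ d)%N. Proof. by rewrite card_qfpoly sP. Qed.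

Let redX_frob : red 'X ^+ (q ^ d) = red 'X.
Proof. by rewrite -card_K expf_card. Qed.

Lemma dvd_frobX : P %| 'X^(q ^ d) - 'X.
Proof. by rewrite -red_eq0 rmorphB rmorphXn redX_frob subrr. Qed.

(** If the [q^e]-power map fixed the class of ['X] it would fix all of [K], which has more than
    [q^e] elements. *)
Let redX_order e : (0 < e < d)%N -> red 'X ^+ (q ^ e) != red 'X.
Proof.
move=> /andP[e_gt0 lt_ed]; apply/eqP => fixX.
have fix_all (x : K) : x ^+ (q ^ e) = x.
  have [p ->] := red_val x; elim/poly_ind: p => [|p c IH].
    by rewrite rmorph0 expr0n eqn0Ngt frob_gt0.
  rewrite rmorphD (frobD cst) rmorphM exprMn IH fixX -rmorphXn -polyC_exp.
  by rewrite expf_card_exp.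
have lt1 : (1 < q ^ e)%N by rewrite -{1}(exp1n e) ltn_exp2r // card_gt1.
pose G : {poly K} := 'X^(q ^ e) - 'X.
have sz : size G = (q ^ e).+1.
  by rewrite size_polyDl ?size_polyXn // size_polyN size_polyX ltnS.
have nzG : G != 0 by rewrite -size_poly_eq0 sz.
have rG : all (root G) (enum K).
  by apply/allP => x _; rewrite /root !hornerE fix_all subrr.
have := max_poly_roots nzG rG (enum_uniq _); rewrite -cardE card_K sz ltnS.
by rewrite leq_exp2l ?card_gt1 // leqNgt lt_ed.
Qed.

Let rs : seq K := [seq red 'X ^+ (q ^ (i : 'I_d)) | i <- index_enum 'I_d].
Let srs : size rs = d. Proof. by rewrite size_map -sum1_size big_const_ord iter_addn addn0 mul1n. Qed.

Let roots_P : map_poly cst P = \prod_(a <- rs) ('X - a%:P).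
Proof.
have := @all_roots_prod_XsubC _ (map_poly cst P) rs.
rewrite size_map_poly sP srs => /(_ erefl) ->.
- by rewrite lead_coef_map (monicP mP) rmorph1 scale1r.
- apply/allP => _ /mapP[i _ ->]; rewrite /root -rmorphXn -red_comp -poly_frob.
  by rewrite red_eq0 dvdp_exp // frob_gt0.
- rewrite uniq_rootsE map_inj_uniq ?index_enum_uniq // => i j Eij.
  wlog lt_ij : i j Eij / (i < j)%N.
    by move=> W; case: (ltngtP i j) => [/W->//|/W->//|/val_inj].
  have lt_jd := ltn_ord j.
  have lt_d : (0 < d - (j - i) < d)%N by lia.
  case/eqP: (redX_order lt_d).
  have := congr1 (fun x => x ^+ (q ^ (d - j))) Eij; rewrite -!exprM -!expnD.
  have -> : (j + (d - j) = d)%N by lia.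
  have -> : (i + (d - j) = d - (j - i))%N by lia.
  by rewrite redX_frob.
Qed.

(** The inner variable plays [t], the outer one [w]. Leaving the outer one free gives a single
    congruence modulo [P] that serves every modulus [h]. *)
Definition Phi e : {poly {poly F}} := \prod_(i < e) (1 - ('X^(q ^ i))%:P * 'X).

(** Modulo [P(t)] the powers [t^(q^i)], [i < d], run through the roots of [P], so the product is the
    reversal of [P] in the outer variable. *)
Lemma frob_prod_mod : exists M : {poly {poly F}},
  Phi d = map_poly polyC (revn d P) + P%:P * M.
Proof.
exists (\poly_(k < size (Phi d - map_poly polyC (revn d P)))
   ((Phi d - map_poly polyC (revn d P))`_k %/ P)).
apply/eqP; rewrite addrC -subr_eq; apply/eqP/polyP => k; rewrite coefCM coef_poly.
case: ltnP => [_|le_k]; last by rewrite nth_default ?mulr0.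
rewrite mulrC divpK // -red_eq0 coefB rmorphB subr_eq0; apply/eqP.
rewrite -!coef_map; congr (_`_k).
have -> : map_poly red (map_poly polyC (revn d P)) = revn d (map_poly cst P).
  by rewrite -map_poly_comp revn_map.
have -> : map_poly red (Phi d) = \prod_(i < d) (1 - (red 'X ^+ (q ^ i))%:P * 'X).
  rewrite rmorph_prod; apply: eq_bigr => i _.
  by rewrite rmorphB rmorph1 rmorphM /= map_polyC map_polyX /= rmorphXn.
by rewrite roots_P -[X in revn X]srs revn_lin big_map.
Qed.
End Residue.

Lemma coprime_modulus (R : comNzRingType) (F : finFieldType) (io : {rmorphism F -> R})
    (P Q : {poly F}) (x : {poly R}) : coprimep P Q ->
  (exists M, x = map_poly io P * M) -> (exists M, x = map_poly io Q * M) ->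
  exists M, x = map_poly io (P * Q) * M.
Proof.
move=> /Bezout_eq1_coprimepP[[u v] /= E] [M EM] [N EN].
have {}E : map_poly io u * map_poly io P + map_poly io v * map_poly io Q = 1.
  by rewrite -!rmorphM -rmorphD E rmorph1.
exists (map_poly io u * N + map_poly io v * M).
rewrite -[LHS]mul1r -E rmorphM mulrDl {1}EN EM /=; ring.
Qed.

(** * The torsor of a modulus and its Frobenius elements *)

Section QuotientTorsor.
Variables (F : finFieldType) (h : {poly F}).
Hypotheses (hm : h \is monic) (sh : (1 < size h)%N).
Local Notation q := #|F|.
Local Notation A := {poly %/ h}.

Definition qiota : {rmorphism F -> A} := qpolyC h.
(** The highest coefficient of a residue; with it the form [(a, b) |-> lam(a b)] is nondegenerate,
    so the coordinates determine the point. *)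
Definition qlam (a : A) : F := (a : {poly F})`_(size h - 2).

Lemma qlamB : zmod_morphism qlam. Proof. by move=> a b; rewrite /qlam coefB. Qed.
HB.instance Definition _ := GRing.isZmodMorphism.Build A F qlam qlamB.

Lemma mk_monicE' : mk_monic h = h. Proof. by rewrite /mk_monic sh hm. Qed.

Lemma qiotaM c (a : A) : (qiota c * a : A) = c *: a :> {poly F}.
Proof.
rewrite poly_of_qpolyM qpolyCE mul_polyC Pdiv.CommonRing.rmodp_small //.
by apply: leq_ltn_trans (size_scale_leq _ _) (size_mk_monic _).
Qed.

Lemma qlamZ c (a : A) : qlam (qiota c * a) = c * qlam a.
Proof. by rewrite /qlam qiotaM coefZ. Qed.

Definition qw : A := in_qpoly h 'X.
Definition qy : A -> fps F := yser qw qlam.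

Lemma qy_frob a : qy a ^+ q = qy a - fpsX F * qy (qw * a).
Proof. exact: yser_frob. Qed.

Lemma qsmall (p : {poly F}) : (size p < size h)%N -> in_qpoly h p = p :> {poly F}.
Proof. by move=> sp; rewrite in_qpoly_small // mk_monicE'. Qed.

Lemma qsize (b : A) : (size b < size h)%N.
Proof.
have E : size (mk_monic h) = size h by rewrite mk_monicE'.
by rewrite -E size_mk_monic.
Qed.

Lemma qval (b : A) : in_qpoly h b = b.
Proof. by apply/val_inj; apply: (qsmall (qsize b)). Qed.

(** A power of the variable moves the leading coefficient of [b] to the top position without any
    reduction modulo [h]. *)
Lemma qlam_nondeg (b : A) : b != 0 -> exists a : A, qlam (a * b) != 0.
Proof.
move=> nzb; have nzb' : (b : {poly F}) != 0 by apply: contraNneq nzb => b0; rewrite -[b]qval b0 rmorph0.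
have sb := qsize b; have sb_gt0 : (0 < size (b : {poly F}))%N by rewrite size_poly_gt0.
pose j := (size h - (size b).+1)%N; exists (in_qpoly h 'X^j).
rewrite /qlam -[b in _ * b]qval -rmorphM qsmall; last first.
  rewrite size_monicM ?monicXn // size_polyXn addSn /= /j -ltnS.
  by rewrite -[X in (X < _)%N]addnS subnK.
rewrite coefXnM /j; have -> : (size h - 2 < size h - (size b).+1)%N = false by lia.
have -> : (size h - 2 - (size h - (size b).+1) = (size b).-1)%N by lia.
by rewrite -lead_coefE lead_coef_eq0.
Qed.

Lemma qy_sep (s u : A) : s != u -> exists a, qy (a * s) != qy (a * u).
Proof.
rewrite -subr_eq0 => /qlam_nondeg[a nz]; exists a; apply: contraNneq nz => E.
rewrite mulrBr raddfB /= subr_eq0.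
by have /= := congr1 (fun f => cf f 0) E; rewrite !mulr1 => ->.
Qed.

Lemma Uval_yserP (p : {poly A}) : Uval qy (yserP qw qlam p).
Proof.
elim/poly_ind: p => [|p c IH]; first by rewrite raddf0 -(rmorph0 (@pofp F)); apply: Uval_pofp.
rewrite raddfD /= mulrC yserPX yserPC; apply: Uval_D.
  by apply: Uval_M IH; apply: Uval_pofp.
by rewrite -[c]mulr1; apply: (Uval_U (U_y qy c)).
Qed.

(** Induction on the construction of functions: constants are fixed by the Frobenius, [t] is covered
    by the divisibility of ['X^(q ^ s) - 'X], the coordinates by the congruence of [frobpol], and
    congruences add and multiply. *)
Lemma tcong_frobpol s (u : A) (Q : {poly F}) :
  (exists M, frobpol F qw s - u%:P = map_poly qiota Q * M) -> Q %| 'X^(q ^ s) - 'X ->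
  tcong qy s u Q.
Proof.
move=> [M EM] /dvdpP[k Ek] n f.
elim=> {n f} [c||a|n f g _ [b Ub Eb] _ [c Uc Ec]|m n f g Uf [b Ub Eb] Ug [c Uc Ec]|//].
- exists (pofp 0); first exact: Uval_pofp.
  by rewrite -rmorphXn -polyC_exp expf_card_exp rmorph0 mulr0 addr0.
- exists (pofp k); first exact: Uval_pofp.
  rewrite -rmorphXn -(subrK 'X 'X^_) Ek rmorphD rmorphM addrC; congr (_ + _); exact: mulrC.
- exists (yserP qw qlam (a%:P * M)); first exact: Uval_yserP.
  rewrite mulr1 /qy yser_frobpol -(yserPM qw qlamZ) mulrCA -EM mulrBr raddfB /=.
  by rewrite -polyCM yserPC addrC subrK.
- exists (b + c); first exact: Uval_D.
  by rewrite fps_frobD Eb Ec; ring.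
- exists (f u * c + g u * b + pofp Q * b * c).
    have Uu (z : A -> fps F) l : U qy l z -> Uval qy (z u).
      by move=> Uk; have := Uval_U (U_shift u Uk); rewrite mulr1.
    apply: Uval_D; first by apply: Uval_D; apply: Uval_M => //; apply: Uu; eassumption.
    by apply: Uval_M => //; apply: Uval_M => //; apply: Uval_pofp.
  by rewrite exprMn Eb Ec; ring.
Qed.

Definition qev (p : {poly {poly F}}) : {poly A} := (map_poly (map_poly qiota) p).[qw%:P].

Lemma qevC (p : {poly F}) : qev (map_poly polyC p) = (in_qpoly h p)%:P.
Proof.
rewrite /qev; elim/poly_ind: p => [|p c IH]; first by rewrite !rmorph0 horner0.
rewrite !rmorphD !rmorphM /= !map_polyX !map_polyC /= !map_polyC /= hornerMXaddC IH.
congr (_ + _%:P); apply/val_inj => /=.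
by rewrite [RHS]Pdiv.CommonRing.rmodp_small // (leq_ltn_trans (size_polyC_leq1 _)) // size_mk_monic_gt1.
Qed.

Lemma qev_frobpol d : qev (Phi F d) = frobpol F qw d.
Proof.
rewrite /qev /Phi rmorph_prod horner_prod; apply: eq_bigr => i _.
rewrite rmorphB rmorph1 rmorphM /= !map_polyC map_polyX /= hornerD hornerN hornerM hornerC.
by rewrite hornerC hornerX map_polyXn mulrC mul_polyC.
Qed.

Lemma frobpol_prime d P : P \in irrs F d ->
  exists M, frobpol F qw d - (in_qpoly h (revn d P))%:P = map_poly qiota P * M.
Proof.
move=> Pd; have [M EM] := frob_prod_mod Pd; exists (qev M).
rewrite -qev_frobpol -qevC EM /qev rmorphD hornerD addrC addKr.
by rewrite rmorphM hornerM /= map_polyC hornerC.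
Qed.

Lemma dvd_frobX_mul d m P : P \in irrs F d -> P %| 'X^(q ^ (m * d)) - 'X.
Proof.
move=> Pd; elim: m => [|m IH]; first by rewrite expr1 subrr dvdp0.
rewrite mulSn expnD [(q ^ d * _)%N]mulnC exprM.
have -> : 'X^(q ^ (m * d)) ^+ (q ^ d) - 'X =
    ('X^(q ^ (m * d)) - 'X) ^+ (q ^ d) + ('X^(q ^ d) - 'X) :> {poly F}.
  have E : 'X^(q ^ (m * d)) = ('X^(q ^ (m * d)) - 'X) + 'X :> {poly F} by rewrite subrK.
  by rewrite {1}E poly_frobD addrA.
by rewrite dvdp_add ?(dvd_frobX Pd) // dvdp_exp // frob_gt0.
Qed.

(** Modulo [P] one has [t^(q^d) = t], so the product splits into [m] blocks, each congruent to
    [frobpol d]. *)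
Lemma frobpol_prime_mul d m P : P \in irrs F d ->
  exists M, frobpol F qw (m * d) - ((in_qpoly h (revn d P)) ^+ m)%:P = map_poly qiota P * M.
Proof.
move=> Pd; have [M1 E1] := frobpol_prime Pd; set th := in_qpoly h _ in E1 *.
elim: m => [|m [M EM]].
  by exists 0; rewrite /frobpol big_ord0 expr0 subrr mulr0.
have cong n : exists M2, \prod_(i < n) (1 - qw *: 'X^(q ^ (m * d + i)))
    - frobpol F qw n = map_poly qiota P * M2.
  rewrite /frobpol; elim: n => [|n [M2 E2]]; first by exists 0; rewrite !big_ord0 subrr mulr0.
  rewrite !big_ord_recr /=.
  have /dvdpP[k Ek] : P %| 'X^(q ^ (m * d + n)) - 'X^(q ^ n).
    rewrite expnD exprM -(subrK 'X 'X^(q ^ (m * d))) poly_frobD addrK.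
    by apply: dvdp_trans (dvd_frobX_mul m Pd) (dvdp_exp _ _); rewrite ?frob_gt0.
  have {}Ek : 'X^(q ^ (m * d + n)) = map_poly qiota (k * P) + 'X^(q ^ n).
    by rewrite -Ek rmorphB /= !map_polyXn subrK.
  exists (M2 * (1 - qw *: 'X^(q ^ n)) - (\prod_(i < n) (1 - qw *: 'X^(q ^ (m * d + i)))) *
     (qw%:P * map_poly qiota k)).
  have T (a b W x k' P' m' : {poly A}) : a - b = P' * m' ->
      a * (1 - W * (k' * P' + x)) - b * (1 - W * x) = P' * (m' * (1 - W * x) - a * (W * k')).
    by move=> E; rewrite [P' * (_ - _)]mulrBr [P' * (m' * _)]mulrA -E; ring.
  by rewrite Ek rmorphM -!mul_polyC; apply: T E2.
have [M2 E2] := cong d.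
have -> : frobpol F qw (m.+1 * d) = frobpol F qw (m * d) *
    \prod_(i < d) (1 - qw *: 'X^(q ^ (m * d + i))).
  rewrite mulSn addnC /frobpol big_split_ord /=; congr (_ * _).
exists (M * \prod_(i < d) (1 - qw *: 'X^(q ^ (m * d + i))) + (th ^+ m)%:P * (M2 + M1)).
have T (a b c d' t P' x y z : {poly A}) : a - b = P' * x -> c - d' = P' * y -> d' - t = P' * z ->
    a * c - b * t = P' * (x * c + b * (y + z)).
  move=> e1 e2 e3; rewrite [P' * (_ + _)]mulrDr [P' * (x * c)]mulrA -e1 [P' * (b * _)]mulrCA [P' * (y + z)]mulrDr -e2 -e3; ring.
by rewrite exprSr polyCM; apply: T EM E2 E1.
Qed.

(** A prime of degree [d] dividing [s] carries [d] points over the field with [q^s] elements, and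
    their Frobenius element is the [(s %/ d)]-th power of that of the prime. *)
Definition prime_list s (u : A) : seq {poly F} :=
  flatten [seq [seq P <- irrs F d | in_qpoly h (revn d P) ^+ (s %/ d) == u]
          | d <- index_iota 1 s.+1 & (d %| s)%N].

Lemma mem_prime_list s u P : P \in prime_list s u -> exists d,
  [/\ (0 < d)%N, (d %| s)%N, P \in irrs F d & in_qpoly h (revn d P) ^+ (s %/ d) = u].
Proof.
move=> /flattenP[_ /mapP[d ds ->]]; rewrite mem_filter => /andP[/eqP E Pd].
by move: ds; rewrite mem_filter mem_index_iota => /and3P[ds d_gt0 _]; exists d.
Qed.

Lemma prime_list_uniq s u : uniq (prime_list s u).
Proof.
rewrite /prime_list; have: uniq [seq d <- index_iota 1 s.+1 | (d %| s)%N].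
  by rewrite filter_uniq ?iota_uniq.
elim: [seq d <- _ | _] => //= d r IH /andP[dr ur].
rewrite cat_uniq filter_uniq ?irrs_uniq // IH // andbT; apply/hasPn => P.
move=> /flattenP[_ /mapP[d' d'r ->]]; rewrite mem_filter => /andP[_ Pd'].
apply/negP; rewrite mem_filter => /andP[_ Pd]; have := monl_size (irrs_monl Pd).
by rewrite (monl_size (irrs_monl Pd')) => -[E]; rewrite -E d'r in dr.
Qed.

Definition prime_prod s u : {poly F} := \prod_(P <- prime_list s u) P.

Lemma size_prime_prod s u : size (prime_prod s u) =
  (\sum_(1 <= d < s.+1 | d %| s)
     d * count (fun P => in_qpoly h (revn d P) ^+ (s %/ d) == u) (irrs F d)).+1%N.
Proof.
have szprod (r : seq {poly F}) : all (fun P => P \is monic) r ->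
    size (\prod_(P <- r) P) = (\sum_(P <- r) (size P).-1).+1.
  elim: r => [|P r IH] /=; first by rewrite !big_nil size_poly1.
  case/andP=> mP mr; rewrite !big_cons size_monicM ?monic_neq0 //; last first.
    by rewrite big_seq monic_prod // => Q Qr; apply: (allP mr).
  by rewrite IH // addnS /= -addSn prednK // size_poly_gt0 monic_neq0.
rewrite /prime_prod szprod; last first.
  by apply/allP => P /mem_prime_list[d [_ _ Pd _]]; apply: monl_monic (irrs_monl Pd).
congr _.+1; rewrite big_flatten big_map big_filter; apply: eq_bigr => d _.
rewrite big_filter -big_filter -size_filter -sum1_size big_distrr /=.
rewrite big_seq [RHS]big_seq; apply: eq_bigr => P; rewrite mem_filter => /andP[_ Pd].
by rewrite muln1 (monl_size (irrs_monl Pd)).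
Qed.

Lemma prime_prod_tcong s u : tcong qy s u (prime_prod s u).
Proof.
suff H (r : seq {poly F}) : uniq r -> {subset r <= prime_list s u} ->
    (exists M, frobpol F qw s - u%:P = map_poly qiota (\prod_(P <- r) P) * M) /\
    \prod_(P <- r) P %| 'X^(q ^ s) - 'X.
  have [H1 H2] := H _ (prime_list_uniq s u) (fun x h => h).
  exact: tcong_frobpol.
elim: r => [_ _|P r IH /= /andP[Pr ur] sub].
  by rewrite big_nil; split; [exists (frobpol F qw s - u%:P); rewrite rmorph1 mul1r | exact: dvd1p].
have [IH1 IH2] := IH ur (fun x xr => sub x (mem_behead (s := P :: r) xr)).
have [d [d_gt0 ds Pd Eu]] := mem_prime_list (sub P (mem_head _ _)).
have Es : (s = s %/ d * d)%N by rewrite divnK.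
have co : coprimep P (\prod_(Q <- r) Q).
  rewrite big_seq; apply: (big_ind (coprimep P)) => [|f g Pf Pg|Q Qr].
  - exact: coprimep1.
  - by rewrite coprimepMr Pf Pg.
  have [d' [_ _ Qd _]] := mem_prime_list (sub Q (mem_behead (s := P :: r) Qr)).
  by apply: (irrs_coprime Pd Qd); apply: contraNneq Pr => ->.
rewrite big_cons; split; last first.
  by rewrite Gauss_dvdp // IH2 Es dvd_frobX_mul.
apply: coprime_modulus co _ IH1; have [M EM] := frobpol_prime_mul (s %/ d) Pd.
by exists M; rewrite -EM -Es Eu.
Qed.
End QuotientTorsor.

(** * Weil's bound *)

Section Theta.
Variables (F : finFieldType) (h : {poly F}).
Hypotheses (hm : h \is monic) (sh : (1 < size h)%N) (h0 : h`_0 = 0).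
Local Notation q := #|F|.
Local Notation A := {poly %/ h}.
Implicit Types (f g P : {poly F}) (u v : A).

Definition theta f : A := in_qpoly h (revn (size f).-1 f).

Lemma thetaE d f : f \in monl F d -> theta f = in_qpoly h (revn d f).
Proof. by move=> fd; rewrite /theta (monl_size fd). Qed.

Lemma theta1 : theta 1 = 1.
Proof. by rewrite /theta size_poly1 revn1 expr0 rmorph1. Qed.

Lemma thetaM f g : f \is monic -> g \is monic -> theta (f * g) = theta f * theta g.
Proof.
move=> mf mg; rewrite /theta size_monicM ?monic_neq0 //.
have -> : ((size f + size g).-1.-1 = (size f).-1 + (size g).-1)%N.
  by rewrite -[size f]prednK ?size_poly_gt0 ?monic_neq0 // -[size g]prednK ?size_poly_gt0 ?monic_neq0 // addSn addnS.
by rewrite revnM ?leqSpred // in_qpolyM.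
Qed.

Lemma in_qpoly_coef0 p : (in_qpoly h p)`_0 = p`_0.
Proof.
have -> : (in_qpoly h p : {poly F}) = p %% h.
  by rewrite /= mk_monicE' // -Pdiv.IdomainMonic.modpE.
by rewrite [in RHS](divp_eq p h) coefD coef0M h0 mulr0 add0r.
Qed.

Lemma qpoly_coef0M u v : (u * v : A)`_0 = u`_0 * v`_0.
Proof.
have -> : u * v = in_qpoly h ((u : {poly F}) * (v : {poly F})) by rewrite in_qpolyM !qval.
by rewrite in_qpoly_coef0 coef0M.
Qed.

(** As [h] vanishes at 0, the constant coefficient of a residue is well defined; it is 1 for
    reversals of monic polynomials. *)
Definition units1 : {set A} := [set u : A | (u \is a GRing.unit) && ((u : {poly F})`_0 == 1)].

Lemma units1_unit u : u \in units1 -> u \is a GRing.unit.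
Proof. by rewrite inE => /andP[]. Qed.

Lemma units1_1 : 1 \in units1.
Proof. by rewrite inE unitr1 -(rmorph1 (in_qpoly h)) in_qpoly_coef0 coef1 eqxx. Qed.

Lemma units1M u v : u \in units1 -> v \in units1 -> u * v \in units1.
Proof.
rewrite !inE => /andP[uu /eqP u0] /andP[uv /eqP v0].
by rewrite unitrM uu uv qpoly_coef0M u0 v0 mulr1 eqxx.
Qed.

Lemma theta_coef0 f : f \is monic -> (theta f : {poly F})`_0 = 1.
Proof.
by move=> mf; rewrite in_qpoly_coef0 coef_revn subn0 leq0n -lead_coefE (monicP mf).
Qed.

Lemma theta_units1 f : f \is monic -> (theta f \in units1) = (theta f \is a GRing.unit).
Proof. by move=> mf; rewrite inE theta_coef0 // eqxx andbT. Qed.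

Local Notation m := (size h - 2)%N.

(** Reversal matches the monic polynomials of degree [e] with the polynomials of size at most [e.+1]
    and constant coefficient 1, and adding multiples of [h] keeps that coefficient. *)
Lemma theta_fiber e u : (m <= e)%N -> (u : {poly F})`_0 = 1 ->
  perm_eq [seq f <- monl F e | theta f == u]
          [seq revn e ((u : {poly F}) + h * polyn k) | k <- enum {poly_(e - m) F}].
Proof.
have ar1 a b c : (1 < b)%N -> (b - 2 <= c)%N -> (a <= c - (b - 2))%N -> ((b + a).-1 <= c.+1)%N.
  by lia.
have ar2 a b c : (1 < b)%N -> (b - 2 <= c)%N -> (0 < a)%N -> ((a + b).-1 <= c.+1)%N ->
  (a <= c - (b - 2))%N by lia.
move=> le_me u0; have le_he : (size h <= e.+2)%N by lia.
have sz (k : {poly_(e - m) F}) : (size ((u : {poly F}) + h * k)%R <= e.+1)%N.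
  rewrite (leq_trans (size_polyD _ _)) // geq_max; apply/andP; split.
    by rewrite -ltnS; apply: leq_trans (qsize hm sh u) le_he.
  by apply: leq_trans (size_polyMleq _ _) _; apply: ar1 (size_npoly k).
have c0 (k : {poly_(e - m) F}) : ((u : {poly F}) + h * k)`_0 = 1.
  by rewrite coefD coef0M h0 mul0r addr0.
have memf (k : {poly_(e - m) F}) : revn e ((u : {poly F}) + h * k) \in monl F e.
  have ce : (revn e ((u : {poly F}) + h * k))`_e = 1 by rewrite coef_revn leqnn subnn.
  have se : size (revn e ((u : {poly F}) + h * k)) = e.+1.
    apply/eqP; rewrite eqn_leq size_poly ltnNge; apply/negP => le_s.
    by move/eqP: ce; rewrite nth_default // eq_sym oner_eq0.
  by rewrite mem_monl se eqxx monicE lead_coefE se ce eqxx.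
apply: uniq_perm.
- by rewrite filter_uniq ?monl_uniq.
- rewrite map_inj_uniq ?enum_uniq // => k k' /(congr1 (revn e)); rewrite !revnK //.
  by move=> /addrI /(mulfI (monic_neq0 hm)) /val_inj.
move=> f; rewrite mem_filter; apply/andP/mapP => [[/eqP tf fe]|[k _ ->]]; last first.
  split=> //; rewrite (thetaE (memf k)) revnK // rmorphD rmorphM /= qval //.
  have -> : in_qpoly h h = 0 by apply/eqP; rewrite in_qpoly_eq0.
  by rewrite mul0r addr0.
have: h %| revn e f - (u : {poly F}).
  by rewrite -(in_qpoly_eq0 _ hm sh) rmorphB /= qval // -(thetaE fe) tf subrr.
move=> /dvdpP[k Ek].
have sk : (size k <= e - m)%N.
  have [->|nzk] := eqVneq k 0; first by rewrite size_poly0.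
  have : (size (k * h)%R <= e.+1)%N.
    rewrite -Ek (leq_trans (size_polyD _ _)) // geq_max size_poly size_polyN.
    by rewrite -ltnS; apply: leq_trans (qsize hm sh u) le_he.
  rewrite size_mul ?(monic_neq0 hm) //.
  by rewrite -size_poly_gt0 in nzk; apply: ar2.
exists (NPoly sk); rewrite ?mem_enum //= mulrC -Ek addrC subrK revnK //.
by rewrite (monl_size fe).
Qed.

Lemma theta_count e u : (m <= e)%N -> (u : {poly F})`_0 = 1 ->
  count (fun f => theta f == u) (monl F e) = (q ^ (e - m))%N.
Proof.
move=> le_me u0; rewrite -size_filter (perm_size (theta_fiber le_me u0)) size_map.
by rewrite -cardE card_npoly.
Qed.

Lemma in_qpoly_unit p : (in_qpoly h p \is a GRing.unit) = coprimep p h.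
Proof.
apply/idP/idP => [/unitrP[y [yp _]]|/Bezout_eq1_coprimepP[[a b] /= E]].
  have : h %| (y : {poly F}) * p - 1.
    by rewrite -(in_qpoly_eq0 _ hm sh) rmorphB rmorphM rmorph1 /= qval // yp subrr.
  move=> /dvdpP[k Ek]; apply/Bezout_eq1_coprimepP; exists ((y : {poly F}), - k) => /=.
  by rewrite mulNr -Ek opprB addrC subrK.
apply/unitrP; exists (in_qpoly h a).
have E1 : in_qpoly h a * in_qpoly h p = 1.
  have -> : (1 : A) = in_qpoly h (a * p + b * h) by rewrite E rmorph1.
  rewrite in_qpolyD [b * h]mulrC !in_qpolyM.
  have -> : in_qpoly h h = 0 by apply/eqP; rewrite in_qpoly_eq0.
  by rewrite mul0r addr0.
by rewrite E1 mulrC E1.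
Qed.

(** Reversing a Bezout relation turns the 1 into a power of ['X], so a common divisor of [revn d f]
    and [h] divides that power; but [revn d f] has constant coefficient 1. *)
Lemma coprimep_revn d f : f \in monl F d -> coprimep f (revn (size h).-1 h) ->
  coprimep (revn d f) h.
Proof.
set g := revn _ h => fd /Bezout_eq1_coprimepP[[a b] /= E].
have hg : revn (size h).-1 g = h by rewrite revnK // prednK // ltnW.
have sf := monl_size fd; have sg : (size g <= (size h).-1.+1)%N by apply: size_poly.
pose N := (size a + size b)%N.
have rE k (c z : {poly F}) n : (size c <= k.+1)%N -> (size z <= n.+1)%N ->
    (k + n = N + d + (size h).-1)%N ->
    revn (N + d + (size h).-1) (c * z) = revn k c * revn n z.
  by move=> sc sz <-; apply: revnM.
have := congr1 (revn (N + d + (size h).-1)) E; rewrite raddfD /= revn1.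
rewrite (rE (N + (size h).-1)%N a f d) ?sf //; last 2 first.
- by apply: leqW; rewrite /N -addnA leq_addr.
- by rewrite addnAC.
rewrite (rE (N + d)%N b g (size h).-1) //; last first.
  by apply: leqW; rewrite /N addnAC leq_addl.
rewrite hg => E2.
have cop : coprimep (revn d f) 'X.
  rewrite coprimepX /root horner_coef0 coef_revn leq0n subn0 -[d]/(d.+1.-1) -sf -lead_coefE.
  by rewrite (monicP (monl_monic fd)) oner_eq0.
apply/coprimepP => z zf zh.
apply: (coprimepP _ _ (coprimep_expr (N + d + (size h).-1) cop)) => //.
by rewrite -E2 dvdp_add // dvdp_mull.
Qed.

(** The primes whose residue is not a unit divide the reversal of [h], so their total degree is at
    most its degree. *)
Lemma bad_count : exists C0, forall s,
  (\sum_(1 <= d < s.+1) \sum_(P <- irrs F d | theta P \isn't a GRing.unit) d <= C0)%N.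
Proof.
pose g := revn (size h).-1 h.
have nzg : g != 0.
  apply: contraTneq hm => g0; have := @revnK F (size h).-1 h; rewrite -/g g0 raddf0.
  move=> h_0; rewrite -h_0 ?monicE ?lead_coef0 1?eq_sym ?oner_eq0 //.
  by rewrite prednK // ltnW.
pose g' := (lead_coef g)^-1 *: g.
have lc : (lead_coef g)^-1 != 0 by rewrite invr_eq0 lead_coef_eq0.
have g'm : g' \in monl F (size g).-1.
  rewrite mem_monl size_scale // prednK ?size_poly_gt0 // eqxx andbT.
  by rewrite monicE lead_coefZ mulVf ?lead_coef_eq0.
exists (size g).-1 => s; pose M := (s + (size g).-1)%N.
rewrite -[leqRHS](sum_pval g'm (leq_addl s _)) -/M.
rewrite [leqRHS](big_cat_nat (n := s.+1)) //=; last by rewrite ltnS leq_addr.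
apply: leq_trans (leq_addr _ _); rewrite big_nat [leqRHS]big_nat.
apply: leq_sum => d /andP[d_gt0 le_ds]; rewrite big_mkcond big_seq [leqRHS]big_seq.
apply: leq_sum => P Pd; case: ifPn => // nu; rewrite leq_pmulr // /pval big_ltn; last first.
  by rewrite ltnS /M; lia.
apply: leq_trans (leq_addr _ _); rewrite expr1 lt0b.
have Pm := irrs_monl Pd; rewrite dvdpZr //; apply: contraR nu => nPg.
rewrite (thetaE Pm) in_qpoly_unit; apply: (coprimep_revn Pm); exact: irr_coprime Pd nPg.
Qed.
End Theta.

Section Weil.
Variables (F : finFieldType) (h : {poly F}).
Hypotheses (hm : h \is monic) (hs : (2 < size h)%N) (h0 : h`_0 = 0).
Local Notation q := #|F|.
Local Notation A := {poly %/ h}.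
Local Notation G := (units1 h).
Variable chi : A -> algC.
Hypotheses (chi1 : chi 1 = 1) (chiM : {in G &, forall u v, chi (u * v) = chi u * chi v}).
Hypotheses (chi_out : forall u, u \notin G -> chi u = 0) (chi_norm : forall u, `|chi u| <= 1).
Hypothesis chi_sum : \sum_(u in G) chi u = 0.

Let sh : (1 < size h)%N. Proof. exact: ltnW. Qed.
Let chif (f : {poly F}) := chi (theta h f).

Let thetaG f : f \is monic -> (theta h f \in G) = (theta h f \is a GRing.unit).
Proof. exact: (theta_units1 hm sh h0). Qed.

Let chif1 : chif 1 = 1. Proof. by rewrite /chif theta1. Qed.

Let chifM f g : f \is monic -> g \is monic -> chif (f * g) = chif f * chif g.
Proof.
move=> mf mg; rewrite /chif thetaM //.
case: (boolP (theta h f \in G)) => fG; case: (boolP (theta h g \in G)) => gG.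
- exact: chiM.
- by rewrite [chi (theta h g)]chi_out // mulr0 chi_out // -thetaM // thetaG ?monicMr // thetaM // unitrM -!thetaG // (negPf gG) andbF.
- by rewrite [chi (theta h f)]chi_out // mul0r chi_out // -thetaM // thetaG ?monicMr // thetaM // unitrM -!thetaG // (negPf fG).
- by rewrite [chi (theta h f)]chi_out // mul0r chi_out // -thetaM // thetaG ?monicMr // thetaM // unitrM -!thetaG // (negPf fG).
Qed.

Let chi_X u n : u \in G -> chi (u ^+ n) = chi u ^+ n /\ u ^+ n \in G.
Proof.
move=> uG; elim: n => [|n [IH1 IH2]]; first by rewrite units1_1.
by rewrite exprS chiM // IH1 exprS; split=> //; apply: units1M.
Qed.

Lemma sum_theta e (g : A -> algC) :
  \sum_(f <- monl F e) g (theta h f) =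
  \sum_(u : A) (count (fun f => theta h f == u) (monl F e))%:R * g u.
Proof.
rewrite (eq_bigr (fun f => \sum_(u : A) (theta h f == u)%:R * g u)); last first.
  move=> f _; rewrite (bigD1 (theta h f)) //= eqxx mul1r big1 ?addr0 // => u.
  by rewrite eq_sym => /negPf->; rewrite mul0r.
rewrite exchange_big; apply: eq_bigr => u _ /=.
rewrite -mulr_suml; congr (_ * _); elim: (monl F e) => [|f r IH]; first by rewrite big_nil.
by rewrite big_cons IH /= natrD.
Qed.

(** In these degrees all residues in [G] occur equally often, so the coefficient is a multiple of
    [chi_sum]. This leaves at most [size h - 3] inverse roots. *)
Lemma Lcoef_eq0 e : (size h - 2 <= e)%N -> Lcoef chif e = 0.
Proof.
move=> le_e; rewrite /Lcoef (sum_theta e chi).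
transitivity ((q ^ (e - (size h - 2)))%:R * \sum_(u in G) chi u); last by rewrite chi_sum mulr0.
rewrite mulr_sumr [RHS]big_mkcond; apply: eq_bigr => u _.
case: ifP => uG; last by rewrite chi_out ?uG ?mulr0.
by rewrite theta_count //; move: uG; rewrite inE => /andP[_ /eqP].
Qed.

Let n e (u : A) : nat := (\sum_(1 <= d < (e + e).+1 | d %| e + e)
  d * count (fun P => in_qpoly h (revn d P) ^+ ((e + e) %/ d) == u) (irrs F d))%N.

Let size_n e (u : A) : size (prime_prod (e + e) u) = (n e u).+1.
Proof. exact: size_prime_prod. Qed.

Let n_gt : exists C0, forall e, (q ^ (e + e) <= \sum_(u in G) n e u + C0)%N.
Proof.
have [C0 bad] := bad_count hm sh.
exists C0.+1 => e; have [->|e_gt0] := posnP e; first by rewrite expn0 addnS.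
rewrite -prime_count ?addn_gt0 ?e_gt0 //.
apply: leq_trans (_ : \sum_(u in G) n e u + C0 <= _)%N; last by rewrite leq_add2l.
apply: leq_trans (leq_add (leqnn _) (bad (e + e)%N)); rewrite /n exchange_big /=.
rewrite [X in (_ <= _ + X)%N](bigID (fun d => d %| e + e)%N) /= addnA.
apply: leq_trans (leq_addr _ _); rewrite -big_split /=.
rewrite big_nat_cond [leqRHS]big_nat_cond; apply: leq_sum => d /andP[/andP[d_gt0 le_d] d_e].
have -> : (\sum_(P <- irrs F d | theta h P \isn't a GRing.unit) d
    = d * count (fun P => theta h P \isn't a GRing.unit) (irrs F d))%N.
  by rewrite -sum1_count big_distrr /=; apply: eq_bigr => P _; rewrite muln1.
rewrite -big_distrr /= -mulnDr leq_mul2l; apply/orP; right.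
have -> : (\sum_(u in G) count (fun P => in_qpoly h (revn d P) ^+ ((e + e) %/ d) == u) (irrs F d)
    = count (fun P => (in_qpoly h (revn d P) ^+ ((e + e) %/ d) : A) \in G) (irrs F d))%N.
  elim: (irrs F d) => [|P r IH] /=; first by rewrite big1.
  rewrite big_split /= IH; congr (_ + _)%N; set x := (_ ^+ _).
  have [xG|xG] := boolP (x \in G); last first.
    by rewrite big1 // => u uG; apply/eqP; rewrite eqb0; apply: contraNneq xG => ->.
  by rewrite (bigD1 x) //= eqxx big1 ?addn0 // => u /andP[_]; rewrite eq_sym => /negPf->.
rewrite -(count_predC (fun P => theta h P \is a GRing.unit)) leq_add2r.
rewrite -!size_filter; apply: uniq_leq_size; first by rewrite filter_uniq ?irrs_uniq.
move=> P; rewrite !mem_filter => /andP[uP Pd]; rewrite Pd andbT.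
move: Pd => /andP[_ Pm].
by rewrite -(thetaE h Pm); apply: (chi_X _ _).2; rewrite thetaG // (monl_monic Pm).
Qed.

Lemma character_bound : `|\sum_(f <- monl F 1) chi (theta h f)| <= ((size h - 3)%:R) * sqrtC q%:R.
Proof.
have [C0 sum_n] := n_gt.
have [H [N [K [e0 [N_gt0 [H1 HG] HM eqd]]]]] := @torsor_equidistribution F A (qw h) (@qy F h)
  (@qy_frob F h) (qy_sep hm sh) G (units1_1 hm sh h0) (units1M hm sh h0)
  (@units1_unit F h) (fun e (u : A) => prime_prod (e + e) u) n C0
  (fun e u _ => prime_prod_tcong (e + e) u) (fun e u _ => size_n e u) sum_n.
have q1 := card_gt1 F; have q_gt0 : 0 < q%:R :> algC by rewrite ltr0n ltnW.
have [|e lt_e|s [ss ps]] := @newton_roots (size h - 3) (Lcoef chif) (prime_sum chif) _ _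
   (Lcoef_newton chif1 chifM); first exact: Lcoef0 chif1.
  by apply: Lcoef_eq0; lia.
have psE e : prime_sum chif (e + e) = \sum_(u in G) chi u * (n e u)%:R.
  transitivity (\sum_(1 <= d < (e + e).+1 | (d %| e + e)%N) \sum_(u in G)
     chi u * (d * count (fun P => in_qpoly h (revn d P) ^+ ((e + e) %/ d) == u) (irrs F d))%:R);
    last first.
    rewrite exchange_big /=; apply: eq_bigr => u _.
    by rewrite /n natr_sum mulr_sumr.
  rewrite /prime_sum big_nat_cond [RHS]big_nat_cond; apply: eq_bigr => d /andP[/andP[d_gt0 le_d] d_e].
  have ed_gt0 : (0 < (e + e) %/ d)%N by rewrite divn_gt0 // -ltnS.
  transitivity (\sum_(P <- irrs F d) \sum_(u in G)
     chi u * (d%:R * (in_qpoly h (revn d P) ^+ ((e + e) %/ d) == u)%:R)).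
    rewrite big_seq [RHS]big_seq; apply: eq_bigr => P /irrs_monl Pm.
    rewrite /chif -(thetaE h Pm).
    have [tG|tG] := boolP (theta h P \in G).
      have [EX XG] := chi_X ((e + e) %/ d) tG.
      rewrite (bigD1 (theta h P ^+ ((e + e) %/ d))) //= eqxx mulr1 EX big1 ?addr0 1?mulrC // => u.
      by rewrite eq_sym => /andP[_ /negPf->]; rewrite !mulr0.
    rewrite chi_out // expr0n eqn0Ngt ed_gt0 mulr0 big1 // => u uG.
    case: eqP => [E|_]; last by rewrite !mulr0.
    case/negP: tG; rewrite thetaG ?(monl_monic Pm) //.
    by move: (units1_unit uG); rewrite -E -(prednK ed_gt0) exprS unitrM => /andP[].
  rewrite exchange_big; apply: eq_bigr => u _ /=; rewrite -!mulr_sumr natrM; congr (_ * (_ * _)).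
  elim: (irrs F d) => [|P r IH]; first by rewrite big_nil.
  by rewrite big_cons IH /= natrD.
pose S := \sum_(u in H) chi u.
pose K' : algC := (#|G| * (N * K + K))%:R.
have HinG u : u \in H -> u \in G by move/(subsetP HG).
have main e : (e0 <= e)%N ->
    `|N%:R * prime_sum chif (e + e) - S * (q ^ (e + e))%:R| <= K' * (q ^ e)%:R.
  move=> le_e; have q_e : (0 < q ^ e)%N := frob_gt0 F e.
  have -> : N%:R * prime_sum chif (e + e) - S * (q ^ (e + e))%:R =
      \sum_(u in G) chi u * ((N * n e u)%:R - if u \in H then (q ^ (e + e))%:R else 0).
    under [RHS]eq_bigr => u _ do rewrite mulrBr.
    rewrite sumrB; congr (_ - _).
      by rewrite psE mulr_sumr; apply: eq_bigr => u _; rewrite natrM mulrCA.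
    rewrite /S mulr_suml [RHS](big_setID H) /= [X in _ + X]big1 ?addr0; last first.
      by move=> u; rewrite inE => /andP[/negPf-> _]; rewrite /= mulr0.
    have -> : G :&: H = H by apply/setIidPr.
    by apply: eq_bigr => u ->.
  apply: le_trans (ler_norm_sum _ _ _) _.
  have -> : K' * (q ^ e)%:R = \sum_(u in G) ((N * K + K) * q ^ e)%:R :> algC.
    by rewrite sumr_const /K' -natrM -[RHS]mulr_natr -natrM -mulnA mulnC.
  apply: ler_sum => u uG; rewrite normrM; apply: le_trans (ler_pM _ _ (chi_norm u) (lexx _)) _;
    rewrite ?normr_ge0 // mul1r.
  have := eqd e u le_e uG; case: ifP => _; last first.
    move=> le_n; rewrite subr0 normr_nat ler_nat; apply: leq_trans (_ : N * K <= _)%N.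
      by rewrite leq_mul2l le_n orbT.
    by apply: leq_trans (leq_addr K _) _; rewrite leq_pmulr.
  move=> [le1 le2]; have leK : (K * q ^ e <= (N * K + K) * q ^ e)%N by rewrite leq_mul2r leq_addl orbT.
  case/orP: (leq_total (q ^ (e + e)) (N * n e u)) => le_.
    rewrite -natrB // normr_nat ler_nat leq_subLR.
    by apply: leq_trans le1 _; rewrite leq_add2l.
  rewrite distrC -natrB // normr_nat ler_nat leq_subLR.
  by apply: leq_trans le2 _; rewrite leq_add2l.
(* Only even power sums of [s] are controlled; they are the power sums of the squares. *)
pose s2 := [seq a ^+ 2 | a <- s].
have ps2 e : power_sum s2 e = power_sum s (e + e).
  by rewrite /power_sum big_map; apply: eq_bigr => a _; rewrite -exprM mul2n addnn.
have q_ge0 : 0 <= q%:R :> algC by apply: ltW.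
have q1r : 1 < q%:R :> algC by rewrite ltr1n.
have ps_cat r1 r2 e : power_sum (r1 ++ r2) e = power_sum r1 e + power_sum r2 e.
  by rewrite /power_sum big_cat.
have ps_rep k r e : power_sum (flatten (nseq k r)) e = k%:R * power_sum r e.
  elim: k => [|k IH]; first by rewrite /power_sum big_nil mul0r.
  by rewrite /= ps_cat IH -natr1 mulrDl mul1r addrC.
have ps_nseq k (b : algC) e : power_sum (nseq k b) e = k%:R * b ^+ e.
  by rewrite /power_sum big_nseq iter_addr_0 mulr_natl.
have K'_ge0 : 0 <= K' by apply: ler0n.
(* [S] is 0 unless [chi] is trivial on [H]. In that case [S = #|H|], and since [prime_sum] is minus
   a power sum, the list of [N] copies of the squares and [#|H|] copies of [q^2] has power sums
   [O(q^e)]. Positive multiplicities leave no room for cancellation, so [q^2 <= q] would follow. *)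
have S0 : S = 0.
  have [triv|] := boolP [forall u in H, chi u == 1]; last first.
    rewrite negb_forall_in => /exists_inP[v vH nv].
    have Sv : S = chi v * S.
      rewrite /S mulr_sumr (reindex_onto (fun u => v * u) (fun u => v^-1 * u)) /=; last first.
        by move=> u uH; rewrite mulVKr // (units1_unit (HinG _ vH)).
      rewrite (eq_bigl (fun u => u \in H)); last first.
        move=> u; rewrite mulKr ?(units1_unit (HinG _ vH)) // eqxx andbT.
        apply/idP/idP => [vuH|uH]; last exact: HM.
        have inj : {in H &, injective (fun u => v * u)}.
          by move=> a b _ _; apply: mulrI; apply: units1_unit (HinG _ vH).
        have im : [set v * a | a in H] = H.
          apply/eqP; rewrite eqEcard card_in_imset // leqnn andbT.
          by apply/subsetP => _ /imsetP[a aH ->]; apply: HM.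
        move: vuH; rewrite -{1}im => /imsetP[a aH].
        by move/(mulrI (units1_unit (HinG _ vH))) => ->.
      by apply: eq_bigr => u uH; rewrite chiM ?HinG.
    apply/eqP; move/eqP: Sv; rewrite -subr_eq0 -{1}[S]mul1r -mulrBl mulf_eq0 subr_eq0.
    by rewrite eq_sym (negPf nv).
  have SE : S = #|H|%:R.
    by rewrite /S (eq_bigr (fun _ => 1)) ?sumr_const // => u uH; apply/eqP/(forall_inP triv).
  pose big := flatten (nseq N s2) ++ nseq #|H| (q%:R ^+ 2 : algC).
  have bigP u : (maxn e0 1 <= u)%N -> `|power_sum big u| <= K' * q%:R ^+ u.
    rewrite geq_max => /andP[le_u u_gt0]; have := main u le_u; rewrite SE !natrX.
    rewrite -normrN opprB ps ?addn_gt0 ?u_gt0 // mulrN opprK addrC.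
    by rewrite /big ps_cat ps_rep ps2 ps_nseq -exprM mul2n addnn.
  have H_gt0 : (0 < #|H|)%N by apply/card_gt0P; exists 1.
  have in_big : (q%:R ^+ 2 : algC) \in big.
    by rewrite mem_cat mem_nseq H_gt0 eqxx orbT.
  have := power_sum_bound q_gt0 K'_ge0 bigP in_big.
  rewrite ger0_norm ?exprn_ge0 // expr2 -[leRHS]mulr1 ler_pM2l // => le_q1.
  by have := lt_le_trans q1r le_q1; rewrite ltxx.
have bound a : a \in s -> `|a| <= sqrtC q%:R.
  move=> as_; have bigP u : (maxn e0 1 <= u)%N ->
      `|power_sum (flatten (nseq N s2)) u| <= K' * q%:R ^+ u.
    rewrite geq_max => /andP[le_u u_gt0]; have := main u le_u; rewrite S0 mul0r subr0 natrX.
    by rewrite ps_rep ps2 ps ?addn_gt0 ?u_gt0 // mulrN normrN.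
  have in_big : a ^+ 2 \in flatten (nseq N s2).
    apply/flattenP; exists s2; last exact: map_f.
    by rewrite mem_nseq N_gt0 eqxx.
  have := power_sum_bound q_gt0 K'_ge0 bigP in_big; rewrite normrX => le_a2.
  by rewrite -(@ler_pXn2r _ 2) ?nnegrE ?normr_ge0 ?sqrtC_ge0 // sqrtCK.
have -> : \sum_(f <- monl F 1) chi (theta h f) = - power_sum s 1.
  have := Lcoef_newton chif1 chifM 1; rewrite big_nat1 subnn (Lcoef0 chif1) mulr1 mul1r ps //.
rewrite normrN; apply: le_trans (ler_norm_sum _ _ _) _.
apply: le_trans (_ : \sum_(a <- s) sqrtC q%:R <= _).
  by rewrite big_seq [leRHS]big_seq; apply: ler_sum => a /bound; rewrite expr1.
rewrite big_const_seq count_predT iter_addr_0 -[leLHS]mulr_natl.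
by rewrite ler_wpM2r ?sqrtC_ge0 // ler_nat.
Qed.
End Weil.

(** * Subset products *)

Lemma prod_add_subsets (R : comNzRingType) (I : finType) (D : {set I}) (a : R) (g : I -> R) :
  \prod_(x in D) (a + g x) =
  \sum_(S : {set I} | S \subset D) a ^+ (#|D| - #|S|) * \prod_(x in S) g x.
Proof.
pose f x (b : bool) : R :=
  if x \in D then (if b then g x else a) else (if b then 0 else 1).
transitivity (\prod_x \sum_(b : bool) f x b).
  rewrite big_mkcond; apply: eq_bigr => x _; rewrite big_bool /f.
  by case: ifP => _; [exact: addrC | exact/esym/add0r].
rewrite (bigA_distr_bigA f) (reindex (fun S : {set I} => [ffun x => x \in S])) /=; last first.
  exists (fun b : {ffun I -> bool} => [set x | b x]) => [S _|b _].
    by apply/setP => x; rewrite inE ffunE.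
  by apply/ffunP => x; rewrite ffunE inE.
rewrite [RHS]big_mkcond; apply: eq_bigr => S _; case: ifPn => [SD|/subsetPn[x xS xD]]; last first.
  by rewrite (bigD1 x) //= ffunE /f (negPf xD) xS mul0r.
rewrite (bigID (fun x => x \in D)) /= [X in _ * X]big1 ?mulr1; last first.
  by move=> x xD; rewrite ffunE /f (negPf xD); case: ifP => // /(subsetP SD); rewrite (negPf xD).
rewrite (bigID (fun x => x \in S)) /= mulrC; congr (_ * _).
  rewrite (eq_bigr (fun _ => a)); last first.
    by move=> x /andP[xD xS]; rewrite ffunE /f xD (negPf xS).
  rewrite prodr_const; congr (a ^+ _); rewrite -(cardsID S D) (setIidPr SD) addKn.
  by apply: eq_card => x; rewrite !inE andbC.
rewrite (eq_bigl (fun x => x \in S)); last first.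
  by move=> x; rewrite andb_idl // => /(subsetP SD).
by apply: eq_bigr => x xS; rewrite ffunE /f (subsetP SD) // xS.
Qed.

Definition subset_sum (R : comNzRingType) (I : finType) (D : {set I}) (c : I -> R) j : R :=
  \sum_(S : {set I} | (S \subset D) && (#|S| == j)) \prod_(x in S) c x.

Lemma prod_subset_sum (R : comNzRingType) (I : finType) (D : {set I}) (a b : R) (c : I -> R) :
  \prod_(x in D) (a + b * c x) =
  \sum_(j < #|D|.+1) a ^+ (#|D| - j) * b ^+ j * subset_sum D c j.
Proof.
rewrite prod_add_subsets.
rewrite (partition_big (fun S : {set I} => inord #|S| : 'I_#|D|.+1) xpredT) //=.
apply: eq_bigr => j _; rewrite /subset_sum mulr_sumr.
have E (S : {set I}) : (S \subset D) && (inord #|S| == j) = (S \subset D) && (#|S| == j).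
  case SD: (S \subset D) => //=; rewrite -val_eqE /= inordK // ltnS.
  exact: subset_leq_card.
rewrite (eq_bigl _ _ E); apply: eq_bigr => S /andP[_ /eqP <-].
rewrite -mulrA; congr (_ * _); rewrite -prodr_const -big_split /=.
by [].
Qed.

(** Cauchy's estimate in discrete form: averaging over the [n.+1]-th roots of unity extracts the
    [j]-th coefficient of a polynomial of degree at most [n] in [z]. *)
Lemma subset_sum_norm (I : finType) (D : {set I}) (c : I -> algC) (a b j : nat) (Y : algC)
    (n := #|D|) : (j <= n)%N ->
  (forall z, `|z| = 1 -> `|\prod_(x in D) (a%:R + b%:R * (z * c x))| <= Y) ->
  a%:R ^+ (n - j) * b%:R ^+ j * `|subset_sum D c j| <= Y.
Proof.
move=> le_jn bound.
have [w wP] := C_prim_root_exists (ltn0Sn n).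
have w1 : w ^+ n.+1 = 1 by apply: prim_expr_order.
have nzw : w != 0.
  by apply/eqP => w0; move/eqP: w1; rewrite w0 expr0n /= eq_sym oner_eq0.
have norm_w : `|w| = 1.
  by apply/eqP; rewrite -(@pexpr_eq1 _ _ n.+1) // -normrX w1 normr1.
pose T (i : nat) : algC := a%:R ^+ (n - i) * b%:R ^+ i * subset_sum D c i.
have PT z : \prod_(x in D) (a%:R + b%:R * (z * c x)) = \sum_(i < n.+1) T i * z ^+ i.
  under eq_bigr => x _ do rewrite mulrA.
  rewrite prod_subset_sum; apply: eq_bigr => i _; rewrite exprMn /T; ring.
have avg : n.+1%:R * T j =
    \sum_(v < n.+1) (w ^+ j) ^- v * \prod_(x in D) (a%:R + b%:R * (w ^+ v * c x)).
  under [RHS]eq_bigr => v _ do rewrite PT mulr_sumr.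
  have lt_j : (j < n.+1)%N by [].
  rewrite exchange_big (bigD1 (Ordinal lt_j)) //= [X in _ + X]big1 ?addr0; last first.
    move=> i ne_ij; pose zt := w ^+ i / w ^+ j.
    have zt1 : zt != 1.
      rewrite /zt -subr_eq0 -(mulfV (expf_neq0 j nzw)) -mulrBl mulf_eq0 invr_eq0 expf_eq0 (negPf nzw) andbF orbF.
      rewrite subr_eq0 (eq_prim_root_expr wP) !modn_small //.
    transitivity (T i * \sum_(v < n.+1) zt ^+ v).
      rewrite mulr_sumr; apply: eq_bigr => v _.
      by rewrite /zt expr_div_n -!exprM [(v * i)%N]mulnC; ring.
    have : (zt - 1) * \sum_(v < n.+1) zt ^+ v = 0.
      by rewrite -subrX1 /zt expr_div_n -!exprM ![(_ * n.+1)%N]mulnC !exprM w1 !expr1n divr1 subrr.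
    by move/eqP; rewrite mulf_eq0 subr_eq0 (negPf zt1) => /eqP->; rewrite mulr0.
  rewrite (eq_bigr (fun _ => T j)); last first.
    move=> v _; rewrite -!exprM [(v * j)%N]mulnC mulrCA mulVf ?mulr1 //.
    by rewrite expf_neq0.
  by rewrite sumr_const card_ord mulr_natl.
have E : a%:R ^+ (n - j) * b%:R ^+ j * `|subset_sum D c j| = `|T j|.
  by rewrite /T !normrM !normrX !normr_nat.
rewrite E -(ler_pM2l (x := n.+1%:R)) ?ltr0n // -[X in X * `|_|]normr_nat -normrM avg.
apply: le_trans (ler_norm_sum _ _ _) _.
apply: le_trans (_ : \sum_(v < n.+1) Y <= _); last by rewrite sumr_const card_ord mulr_natl.
apply: ler_sum => v _; rewrite normrM normfV normrX normrX norm_w !expr1n invr1 mul1r.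
by apply: bound; rewrite normrX norm_w expr1n.
Qed.

(* AM-GM applied to the squared factors [|a + b c_x|^2 = a^2 + b^2 + 2ab Re c_x]. *)
Lemma prod_norm_bound (I : finType) (D : {set I}) (c : I -> algC) (a b K n : nat) :
  #|D| = n -> (0 < n)%N -> (0 < K)%N -> (a + b)%N = n -> (forall x, x \in D -> `|c x| = 1) ->
  K%:R * `|\sum_(x in D) c x| <= (K.-1 * n)%:R ->
  `|\prod_(x in D) (a%:R + b%:R * c x)| ^+ 2 * K%:R ^+ n <= (K * n ^ 2 - 2 * a * b)%:R ^+ n.
Proof.
move=> cD n_gt0 K_gt0 abn c1 sum_le.
pose E x : algC := (a ^ 2 + b ^ 2)%:R + (a * b)%:R * (c x + (c x)^*).
have Esq x : x \in D -> `|a%:R + b%:R * c x| ^+ 2 = E x.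
  move=> xD; have cc : c x * (c x)^* = 1 by rewrite -normCK c1 // expr1n.
  rewrite normCK rmorphD rmorphM /= !conjC_nat /E natrD !natrX natrM.
  transitivity (a%:R ^+ 2 + b%:R ^+ 2 * (c x * (c x)^*) + a%:R * b%:R * (c x + (c x)^*)); first by ring.
  by rewrite cc; ring.
have E_ge0 x : x \in D -> 0 <= E x.
  by move=> xD; rewrite -Esq // exprn_ge0 // normr_ge0.
have -> : `|\prod_(x in D) (a%:R + b%:R * c x)| ^+ 2 = \prod_(x in D) E x.
  by rewrite normr_prod -prodrXl; apply: eq_bigr.
have [agm _] := leif_AGM (I := I) (A := D) (E := E) (fun x xD => E_ge0 x xD).
have K_gt0r : 0 < K%:R :> algC by rewrite ltr0n.
have n_gt0r : 0 < n%:R :> algC by rewrite ltr0n.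
apply: le_trans (ler_wpM2r _ agm) _; first by rewrite exprn_ge0 // ltW.
rewrite cD -exprMn; apply: lerXn2r; rewrite ?nnegrE ?ler0n //.
  by rewrite mulr_ge0 ?(ltW K_gt0r) // divr_ge0 ?ler0n // sumr_ge0.
set S := \sum_(x in D) c x in sum_le.
have -> : \sum_(x in D) E x = n%:R * (a ^ 2 + b ^ 2)%:R + (a * b)%:R * (S + S^*).
  by rewrite /E big_split /= sumr_const cD mulr_natl -mulr_sumr big_split /= rmorph_sum.
have SS : S + S^* <= 2 * `|S|.
  have -> : S + S^* = 2 * 'Re S by rewrite ReE mulrCA divff ?mulr1 ?pnatr_eq0.
  rewrite ler_pM2l ?ltr0n //; apply: le_trans (real_ler_norm (Creal_Re S)) _.
  exact: (leif_normC_Re_Creal S).1.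
apply: le_trans (_ : (n%:R * (a ^ 2 + b ^ 2)%:R + (a * b)%:R * (2 * `|S|)) / n%:R * K%:R <= _).
  rewrite ler_pM2r // ler_pM2r ?invr_gt0 // lerD2l.
  by apply: ler_wpM2l SS; apply: ler0n.
have le2 : (2 * a * b)%:R * (K%:R * `|S|) <= (2 * a * b)%:R * (K.-1 * n)%:R.
  by apply: ler_wpM2l sum_le; apply: ler0n.
rewrite mulrAC ler_pdivrMr //.
have -> : (n%:R * (a ^ 2 + b ^ 2)%:R + (a * b)%:R * (2 * `|S|)) * K%:R
   = (K * n * (a ^ 2 + b ^ 2))%:R + (2 * a * b)%:R * (K%:R * `|S|) by rewrite !natrM; ring.
apply: le_trans (_ : (K * n * (a ^ 2 + b ^ 2))%:R + (2 * a * b)%:R * (K.-1 * n)%:R <= _).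
  by rewrite lerD2l.
rewrite -natrM -natrD -natrM ler_nat.
have Kn : (K * n ^ 2 = K * (a ^ 2 + b ^ 2) + K.-1 * (2 * a * b) + 2 * a * b)%N.
  by rewrite -abn; case: (K) K_gt0 => // k _; rewrite /= -!mulnn; lia.
rewrite Kn addnK; clear; lia.
Qed.

(** In the expansion of [((n - j) + j) ^ n] the [j]-th of the [n.+1] terms is the largest. This
    compares the weights of the Cauchy estimate with ['C(n, j)]. *)
Lemma binomial_mode n j : (j <= n)%N -> (n ^ n <= n.+1 * ('C(n, j) * j ^ j * (n - j) ^ (n - j)))%N.
Proof.
move=> le_jn; pose t i := ('C(n, i) * (n - j) ^ (n - i) * j ^ i)%N.
have -> : (n ^ n = \sum_(i < n.+1) t i)%N.
  rewrite -{1}(subnK le_jn) expnDn; apply: eq_bigr => i _.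
  by rewrite /t mulnA.
have -> : ('C(n, j) * j ^ j * (n - j) ^ (n - j) = t j)%N by rewrite /t mulnAC.
have step i : (i < n)%N -> (t i.+1 * (i.+1 * (n - j)) = t i * ((n - i) * j))%N.
  move=> lt_in; rewrite /t expnSr -(subnSK lt_in) expnSr.
  have := mul_bin_left n i; rewrite -(subnSK lt_in) => E.
  transitivity (i.+1 * 'C(n, i.+1) * (n - j) ^ (n - i.+1) * (n - j) * j ^ i * j)%N; first by ring.
  by rewrite E; ring.
have up k : (k <= j)%N -> (t (j - k) <= t j)%N.
  elim: k => [|k IH] lt_k; first by rewrite subn0.
  apply: leq_trans (IH (ltnW lt_k)).
  have Ek : ((j - k.+1).+1 = j - k)%N by rewrite subnSK.
  have pos : (0 < (n - (j - k.+1)) * j)%N.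
    by rewrite muln_gt0 subn_gt0 (leq_ltn_trans _ lt_k) // andbT; lia.
  rewrite -(leq_pmul2r pos) -step; last by lia.
  rewrite Ek leq_mul2l; apply/orP; right; rewrite mulnC.
  by apply: leq_mul; lia.
have down k : (k <= n - j)%N -> (t (j + k) <= t j)%N.
  elim: k => [|k IH] lt_k; first by rewrite addn0.
  apply: leq_trans (IH (ltnW lt_k)).
  have pos : (0 < (j + k).+1 * (n - j))%N by rewrite muln_gt0 /=; lia.
  rewrite addnS -(leq_pmul2r pos) step; last by lia.
  rewrite leq_mul2l; apply/orP; right; rewrite mulnC.
  by apply: leq_mul; lia.
have le_t i : (i <= n)%N -> (t i <= t j)%N.
  move=> le_in; have [le_ij|lt_ji] := leqP i j.
    by have := up (j - i)%N (leq_subr _ _); rewrite subKn.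
  by have := down (i - j)%N (leq_sub2r _ le_in); rewrite subnKC // ltnW.
apply: leq_trans (_ : \sum_(i < n.+1) t j <= _)%N.
  by apply: leq_sum => i _; apply: le_t; rewrite -ltnS.
by rewrite sum_nat_const card_ord.
Qed.

Definition distn (a b : nat) : nat := ((a - b) + (b - a))%N.

Lemma distn_norm (R : numDomainType) a b : `|a%:R - b%:R| = (distn a b)%:R :> R.
Proof.
rewrite /distn; case/orP: (leq_total a b) => le_.
  by rewrite distrC -natrB // normr_nat; congr _%:R; lia.
by rewrite -natrB // normr_nat; congr _%:R; lia.
Qed.

(** * Equidistribution of subset products among the residues *)

Section UnitCharacters.
Variables (F : finFieldType) (h : {poly F}).
Hypotheses (hm : h \is monic) (hs : (2 < size h)%N) (h0 : h`_0 = 0).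
Local Notation q := #|F|.
Local Notation A := {poly %/ h}.
Local Notation G := (units1 h).

Let sh : (1 < size h)%N. Proof. exact: ltnW. Qed.

Definition ugroup : {set {unit A}} := [set v : {unit A} | val v \in G].

Lemma ugroup_group_set : group_set ugroup.
Proof.
apply/group_setP; split=> [|u v]; rewrite !inE.
  by have := units1_1 hm sh h0; rewrite inE.
move=> uG vG; have := units1M hm sh h0 (u := val u) (v := val v).
by rewrite !inE; apply.
Qed.
Canonical ugroup_group := Group ugroup_group_set.

Lemma ugroup_abelian : abelian ugroup.
Proof. by apply/centsP => u _ v _; apply/val_inj; rewrite /= mulrC. Qed.

Lemma ugroupP (u : A) : u \in G -> exists2 v, v \in ugroup & val v = u.
Proof.
move=> uG; have uu := units1_unit uG.
by exists (FinRing.unit A uu) => //; rewrite inE.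
Qed.

Lemma ugroup_image : G = [set val v | v in ugroup].
Proof.
apply/setP => u; apply/idP/imsetP => [/ugroupP[v vG <-]|[v vG ->]]; first by exists v.
by move: vG; rewrite [_ \in ugroup]inE.
Qed.

Lemma card_ugroup : #|ugroup| = #|G|.
Proof. by rewrite ugroup_image card_imset //; apply: val_inj. Qed.

Lemma sum_units1 (f : A -> algC) : \sum_(u in G) f u = \sum_(v in ugroup) f (val v).
Proof. by rewrite {1}ugroup_image big_imset //= => u v _ _; apply: val_inj. Qed.

(** Extension by zero to all residues, as for Dirichlet characters. *)
Definition uchar (i : Iirr ugroup) (u : A) : algC :=
  if insub u is Some v then 'chi_i (v : {unit A}) else 0.

Lemma ucharE i (v : {unit A}) : uchar i (val v) = 'chi_i v.
Proof. by rewrite /uchar valK. Qed.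

Lemma uchar_lin i : 'chi[ugroup]_i \is a linear_char.
Proof. exact/char_abelianP/ugroup_abelian. Qed.

Lemma uchar1 i : uchar i 1 = 1.
Proof. by rewrite -[X in uchar i X]/(val (1%g : {unit A})) ucharE lin_char1 ?uchar_lin. Qed.

Lemma ucharM i : {in G &, forall u v, uchar i (u * v) = uchar i u * uchar i v}.
Proof.
move=> _ _ /ugroupP[u uG <-] /ugroupP[v vG <-].
rewrite -(FinRing.val_unitM u v) !ucharE; exact: (lin_charM (uchar_lin i)).
Qed.

Lemma uchar_out i u : u \notin G -> uchar i u = 0.
Proof.
move=> uG; rewrite /uchar; case: insubP => // v _ E.
by rewrite cfun0 // inE E.
Qed.

Lemma uchar_norm1 i u : u \in G -> `|uchar i u| = 1.
Proof. by move=> /ugroupP[v vG <-]; rewrite ucharE normC_lin_char ?uchar_lin. Qed.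

Lemma uchar_norm i u : `|uchar i u| <= 1.
Proof.
have [uG|uG] := boolP (u \in G); first by rewrite uchar_norm1.
by rewrite uchar_out // normr0.
Qed.

Lemma uchar_sum i : i != 0 -> \sum_(u in G) uchar i u = 0.
Proof.
move=> nz_i; rewrite sum_units1; have := cfdot_irr i (0 : Iirr ugroup).
rewrite (negPf nz_i) irr0 cfdotE => /eqP; rewrite mulf_eq0 invr_eq0.
rewrite pnatr_eq0 eqn0Ngt cardG_gt0 orFb => /eqP E; rewrite -[RHS]E.
by apply: eq_bigr => v vG; rewrite ucharE cfun1E vG conjC1 mulr1.
Qed.

Lemma uchar0 u : u \in G -> uchar 0 u = 1.
Proof. by move=> /ugroupP[v vG <-]; rewrite ucharE irr0 cfun1E vG. Qed.

Lemma uchar_orth u v : u \in G -> v \in G ->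
  \sum_i uchar i u * (uchar i v)^* = (#|G| * (u == v))%:R.
Proof.
move=> /ugroupP[x xG <-] /ugroupP[y yG <-].
under eq_bigr => i _ do rewrite !ucharE.
rewrite second_orthogonality_relation //.
have -> : ('C_ugroup[x] = ugroup)%g.
  by apply/setIidPl/subsetP => g gG; apply/cent1P; apply: (centsP ugroup_abelian).
rewrite card_ugroup (inj_eq val_inj) natrM -mulr_natr; congr (_ * (nat_of_bool _)%:R).
apply/imsetP/eqP => [[g gG ->]|->]; last by exists 1%g; rewrite ?group1 // conjg1.
by rewrite conjgE (centsP ugroup_abelian y yG g gG) mulKg.
Qed.

Lemma card_Iirr_ugroup : #|Iirr ugroup| = #|G|.
Proof. by rewrite card_Iirr_abelian ?ugroup_abelian // card_ugroup. Qed.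

Definition lin (x : F) : A := in_qpoly h (1 - x%:P * 'X).

Lemma theta_lin x : theta h ('X - x%:P) = lin x.
Proof.
rewrite /theta size_XsubC /=; congr in_qpoly.
by have := revn_lin [:: x]; rewrite !big_seq1.
Qed.

Lemma monl1 : perm_eq (monl F 1) [seq 'X - x%:P | x <- enum F].
Proof.
apply: uniq_perm; rewrite ?monl_uniq //.
  by rewrite map_inj_uniq ?enum_uniq // => x y /addrI/oppr_inj/polyC_inj.
move=> f; rewrite mem_monl; apply/andP/mapP => [[mf /eqP sf]|[x _ ->]]; last first.
  by rewrite monicXsubC size_XsubC.
exists (- f`_0); rewrite ?mem_enum //; apply/polyP => i.
rewrite coefB coefX coefC; case: i => [|[|i]] /=; first by rewrite opprK add0r.
  by move: mf; rewrite monicE lead_coefE sf subr0 => /eqP.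
by rewrite subr0; apply: nth_default; rewrite sf.
Qed.

Definition lin_dom : {set F} := [set x | lin x \in G].

Lemma uchar_lin_sum i : i != 0 ->
  `|\sum_(x in lin_dom) uchar i (lin x)| <= (size h - 3)%:R * sqrtC q%:R.
Proof.
move=> nz_i; have := character_bound hm hs h0 (uchar1 i) (@ucharM i) (@uchar_out i)
  (@uchar_norm i) (uchar_sum nz_i).
congr (`|_| <= _); rewrite (perm_big _ monl1) big_map big_enum [RHS]big_mkcond.
apply: eq_big => // x _; rewrite theta_lin inE.
by case: ifPn => // /uchar_out.
Qed.

Lemma prod_lin (S : {set F}) : S \subset lin_dom ->
  \prod_(x in S) lin x \in G /\
  forall i, uchar i (\prod_(x in S) lin x) = \prod_(x in S) uchar i (lin x).
Proof.
move=> SD; suff H (r : seq F) : all (fun x => lin x \in G) r ->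
    \prod_(x <- r) lin x \in G /\
    forall i, uchar i (\prod_(x <- r) lin x) = \prod_(x <- r) uchar i (lin x).
  have := H (enum S); rewrite !big_enum; case=> [|H1 H2].
    by apply/allP => x; rewrite mem_enum => /(subsetP SD); rewrite inE.
  by split=> // i; rewrite H2 big_enum.
elim: r => [_|x r IH /= /andP[xG /IH[IH1 IH2]]].
  by rewrite big_nil (units1_1 hm sh h0); split=> // i; rewrite !big_nil uchar1.
rewrite big_cons units1M //; split=> // i.
by rewrite big_cons ucharM // IH2.
Qed.

Definition lin_subsets j (u : A) : nat :=
  #|[set S : {set F} | [&& S \subset lin_dom, #|S| == j & \prod_(x in S) lin x == u]]|.

Lemma lin_subsets_char j u : u \in G ->
  (#|G| * lin_subsets j u)%:R =
  \sum_i (uchar i u)^* * subset_sum lin_dom (fun x => uchar i (lin x)) j.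
Proof.
move=> uG; rewrite /subset_sum; under [RHS]eq_bigr => i _ do rewrite mulr_sumr.
rewrite exchange_big /= /lin_subsets -sum1_card natrM natr_sum mulr_sumr.
rewrite big_mkcond [RHS]big_mkcond; apply: eq_bigr => S _; rewrite inE.
case SD: (S \subset lin_dom) => //=; case: (#|S| == j) => //=.
have [SG SE] := prod_lin SD.
under [RHS]eq_bigr => i _ do rewrite -SE mulrC.
by rewrite uchar_orth //; case: eqP => _; rewrite ?muln1 ?mulr1 ?muln0.
Qed.

Lemma subset_sum_uchar0 j : subset_sum lin_dom (fun x => uchar 0 (lin x)) j = 'C(#|lin_dom|, j)%:R.
Proof.
rewrite /subset_sum (eq_bigr (fun _ => 1)); last first.
  move=> S /andP[SD _]; rewrite big1 // => x /(subsetP SD); rewrite inE; exact: uchar0.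
rewrite -(cards_draws lin_dom j) -sum1_card natr_sum.
by apply: eq_bigl => S; rewrite inE.
Qed.

Variable K : nat.
Hypotheses (K_gt0 : (0 < K)%N) (D_gt0 : (0 < #|lin_dom|)%N).
Local Notation n := #|lin_dom|.
(** Weil's bound is at most [(1 - 1/K) n], squared to stay in the integers; [K] will be chosen with
    [K * delta0 >= 1]. *)
Hypothesis weil_small : ((K * (size h - 3)) ^ 2 * q <= (K.-1 * n) ^ 2)%N.

(** In quotients: [(|e_j| / 'C(n, j))^2 <= (n + 1)^2 (1 - 2 (n - j) j / (K n^2))^n]. The Cauchy
    estimate and AM-GM are used with weights [n - j] and [j], the ones for which [binomial_mode]
    loses only the factor [n + 1]. *)
Lemma subset_sum_uchar i j : i != 0 -> (j <= n)%N ->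
  `|subset_sum lin_dom (fun x => uchar i (lin x)) j| ^+ 2 * (n ^ (2 * n) * K ^ n)%:R
  <= (n.+1 ^ 2 * 'C(n, j) ^ 2 * (K * n ^ 2 - 2 * (n - j) * j) ^ n)%:R.
Proof.
move=> nz_i le_jn; set e := subset_sum _ _ _.
pose X := (K * n ^ 2 - 2 * (n - j) * j)%N.
have K_gt0r : 0 < K%:R ^+ n :> algC by rewrite exprn_gt0 // ltr0n.
pose Y : algC := sqrtC ((X ^ n)%:R / K%:R ^+ n).
have Y2 : Y ^+ 2 = (X ^ n)%:R / K%:R ^+ n by rewrite sqrtCK.
have Y_ge0 : 0 <= Y by rewrite sqrtC_ge0 divr_ge0 ?ler0n // ltW.
have small : K%:R * `|\sum_(x in lin_dom) uchar i (lin x)| <= (K.-1 * n)%:R.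
  apply: le_trans (ler_wpM2l (ler0n _ K) (uchar_lin_sum nz_i)) _.
  rewrite mulrA -natrM -(@ler_pXn2r _ 2) ?nnegrE ?mulr_ge0 ?sqrtC_ge0 ?ler0n //.
  by rewrite exprMn sqrtCK -!natrX -natrM ler_nat.
have le_Y : (n - j)%:R ^+ (n - j) * j%:R ^+ j * `|e| <= Y.
  apply: subset_sum_norm => // z z1.
  rewrite -(@ler_pXn2r _ 2) ?nnegrE ?normr_ge0 // Y2 ler_pdivlMr //.
  have := @prod_norm_bound F lin_dom (fun x => z * uchar i (lin x)) (n - j) j K n erefl D_gt0 K_gt0.
  rewrite -mulr_sumr normrM z1 mul1r subnK // natrX => /(_ erefl) ->//.
  by move=> x; rewrite inE normrM z1 mul1r => /uchar_norm1->.
have e_ge0 : 0 <= `|e| := normr_ge0 e.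
have mode := binomial_mode le_jn.
pose B := ((n - j) ^ (n - j) * j ^ j)%N.
have le_n : (n ^ n <= n.+1 * 'C(n, j) * B)%N.
  by apply: leq_trans mode _; rewrite /B -!mulnA leq_mul2l leq_mul2l mulnC leqnn !orbT.
have le_eY : (n ^ n)%:R * `|e| <= (n.+1 * 'C(n, j))%:R * Y.
  apply: le_trans (_ : (n.+1 * 'C(n, j) * B)%:R * `|e| <= _).
    by rewrite ler_wpM2r // ler_nat.
  rewrite natrM -mulrA ler_wpM2l ?ler0n //.
  by move: le_Y; rewrite /B natrM !natrX.
have : ((n ^ n)%:R * `|e|) ^+ 2 <= ((n.+1 * 'C(n, j))%:R * Y) ^+ 2.
  by rewrite lerXn2r ?nnegrE ?mulr_ge0 ?ler0n.
rewrite !exprMn Y2 => le2.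
have -> : `|e| ^+ 2 * (n ^ (2 * n) * K ^ n)%:R = ((n ^ n)%:R ^+ 2 * `|e| ^+ 2) * K%:R ^+ n.
  by rewrite natrM [(2 * n)%N]mulnC expnM natrX [(K ^ n)%:R]natrX mulrA [_ * (n ^ n)%:R ^+ 2]mulrC.
apply: le_trans (ler_wpM2r (ltW K_gt0r) le2) _.
rewrite mulrA divfK ?gt_eqF // -!natrX -natrM ler_nat.
by rewrite expnMn.
Qed.

(** By orthogonality the trivial character contributes ['C(n, j)]; each of the others, fewer than
    [#|G|], is bounded by [subset_sum_uchar]. *)
Lemma subset_equidistribution j u : u \in G -> (j <= n)%N ->
  (distn (#|G| * lin_subsets j u) 'C(n, j) ^ 2 * (n ^ (2 * n) * K ^ n) <=
   #|G| ^ 2 * (n.+1 ^ 2 * 'C(n, j) ^ 2 * (K * n ^ 2 - 2 * (n - j) * j) ^ n))%N.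
Proof.
move=> uG le_jn; set R0 := (n.+1 ^ 2 * _ * _)%N; set T := (n ^ (2 * n) * K ^ n)%N.
have T_gt0 : (0 < T)%N by rewrite muln_gt0 !expn_gt0 K_gt0 D_gt0.
have T_gt0r : 0 < T%:R :> algC by rewrite ltr0n.
pose E : algC := sqrtC (R0%:R / T%:R).
have E_ge0 : 0 <= E by rewrite sqrtC_ge0 divr_ge0 ?ler0n.
rewrite -(ler_nat algC) (natrM _ (distn _ _ ^ 2) T) (natrM _ (_ ^ 2) R0) !(natrX _ _ 2) -distn_norm.
have -> : (#|G| * lin_subsets j u)%:R - 'C(n, j)%:R =
    \sum_(i | i != 0) (uchar i u)^* * subset_sum lin_dom (fun x => uchar i (lin x)) j.
  rewrite lin_subsets_char // (bigD1 0) //= subset_sum_uchar0 uchar0 //.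
  by rewrite conjC1 mul1r addrAC subrr add0r.
have le_E : `|\sum_(i | i != 0) (uchar i u)^* * subset_sum lin_dom (fun x => uchar i (lin x)) j|
    <= #|G|%:R * E.
  apply: le_trans (ler_norm_sum _ _ _) _.
  apply: le_trans (_ : \sum_(i : Iirr ugroup) E <= _); last first.
    by rewrite sumr_const card_Iirr_ugroup mulr_natl.
  rewrite big_mkcond; apply: ler_sum => i _; case: ifPn => // nz_i.
  rewrite normrM norm_conjC uchar_norm1 // mul1r.
  rewrite -(@ler_pXn2r _ 2) ?nnegrE ?normr_ge0 // sqrtCK ler_pdivlMr //.
  exact: subset_sum_uchar.
have := lerXn2r 2 _ _ le_E; rewrite ?nnegrE ?normr_ge0 ?mulr_ge0 ?ler0n // => /(_ isT isT) le2.
apply: le_trans (ler_wpM2r (ltW T_gt0r) le2) _.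
by rewrite exprMn sqrtCK -mulrA divfK ?gt_eqF.
Qed.
End UnitCharacters.

(** * Moments of the number of zeros *)

Section Modulus.
Variables (F : finFieldType) (l t : nat) (Q : {poly F}).
Hypotheses (Qm : Q \in monl F t) (Q0 : Q`_0 != 0) (l_gt0 : (0 < l)%N).
Local Notation q := #|F|.

(* After a shift making [Q`_0] nonzero, the residue modulo [modulus] of the reversal
   of [f] records both congruences of Hayes equivalence, in each fixed degree. *)
Definition modulus : {poly F} := 'X^(l.+1) * ((Q`_0)^-1 *: revn t Q).
Local Notation h := modulus.

Let size_rQ : size (revn t Q) = t.+1.
Proof.
apply/eqP; rewrite eqn_leq size_poly ltnNge; apply/negP => le_s.
have : (revn t Q)`_t = 0 by rewrite nth_default.
by rewrite coef_revn leqnn subnn; apply/eqP.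
Qed.

Let lead_rQ : lead_coef (revn t Q) = Q`_0.
Proof. by rewrite lead_coefE size_rQ coef_revn leqnn subnn. Qed.

Let iQ0 : (Q`_0)^-1 != 0. Proof. by rewrite invr_eq0. Qed.

Lemma modulus_monic : h \is monic.
Proof. by rewrite monicMl ?monicXn // monicE lead_coefZ lead_rQ mulVf. Qed.

Lemma size_modulus : size h = (t + l).+2.
Proof.
rewrite size_monicM ?monicXn //; last by rewrite scaler_eq0 negb_or iQ0 -size_poly_gt0 size_rQ.
by rewrite size_polyXn size_scale // size_rQ !addSn /= !addnS addnC.
Qed.

Lemma modulus_coef0 : h`_0 = 0.
Proof. by rewrite coef0M coefXn mul0r. Qed.

Lemma modulus_gt2 : (2 < size h)%N.
Proof. by rewrite size_modulus; lia. Qed.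
Let hm := modulus_monic.
Let hs := modulus_gt2.
Let h0 := modulus_coef0.
Let sh : (1 < size h)%N. Proof. exact: ltnW. Qed.

Lemma revn_modulus : revn (size h).-1 h = (Q`_0)^-1 *: Q.
Proof.
have -> : ((size h).-1 = l.+1 + t)%N by rewrite size_modulus /=; lia.
rewrite /modulus revnM ?size_polyXn ?size_scale ?size_rQ //.
have -> : revn l.+1 'X^(l.+1) = 1 :> {poly F} by rewrite -(revn1 F l.+1) revnK // size_poly1.
by rewrite mul1r -!mul_polyC revnC revnK // (monl_size Qm).
Qed.

Lemma dvd_revn d e f (z : {poly F}) : z \in monl F e -> f \in monl F d -> z %| f ->
  revn e z %| revn d f.
Proof.
move=> ze fd zf; have [le_ed [y yd Ef]] := monl_dvd ze fd zf.
by rewrite Ef -[in revn d](subnKC le_ed) revnM ?(monl_size ze) ?(monl_size yd) // dvdp_mulr.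
Qed.

(** A common prime factor [z] of [f] and [Q] has [z(0) != 0] because [Q(0) != 0]; its reversal
    therefore keeps the degree and divides both the reversal of [f] and the modulus. *)
Lemma theta_unitE d f : f \in monl F d -> (theta h f \is a GRing.unit) = coprimep f Q.
Proof.
move=> fd; rewrite (thetaE h fd) in_qpoly_unit //; apply/idP/idP => [co|co]; last first.
  by apply: coprimep_revn => //; rewrite revn_modulus coprimepZr.
apply: contraT => nco; pose g := gcdp f Q.
have nzQ := monic_neq0 (monl_monic Qm).
have nzg : g != 0 by rewrite gcdp_eq0 negb_and nzQ orbT.
have lc : (lead_coef g)^-1 != 0 by rewrite invr_eq0 lead_coef_eq0.
have gm : (lead_coef g)^-1 *: g \in monl F (size g).-1.
  rewrite mem_monl size_scale // prednK ?size_poly_gt0 // eqxx andbT.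
  by rewrite monicE lead_coefZ mulVf ?lead_coef_eq0.
have sg : (0 < (size g).-1)%N.
  rewrite -ltnS prednK ?size_poly_gt0 // ltn_neqAle size_poly_gt0 nzg andbT.
  by move: nco; rewrite /coprimep eq_sym.
have [e [z [e_gt0 _ /irrs_monl ze]]] := irr_exists gm sg.
rewrite dvdpZr // => zg.
have zf : z %| f := dvdp_trans zg (dvdp_gcdl _ _).
have zQ : z %| Q := dvdp_trans zg (dvdp_gcdr _ _).
have z_h : revn e z %| h.
  by rewrite dvdp_mull // dvdpZr // (dvd_revn ze Qm zQ).
have z_f := dvd_revn ze fd zf.
have z0 : z`_0 != 0.
  move: zQ => /dvdpP[y Ey]; move: Q0; rewrite Ey coef0M; by apply: contraNneq => ->; rewrite mulr0.
have : size (revn e z) = e.+1.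
  apply/eqP; rewrite eqn_leq size_poly ltnNge; apply/negP => le_s.
  have : (revn e z)`_e = 0 by rewrite nth_default.
  by rewrite coef_revn leqnn subnn; apply/eqP.
have := coprimepP _ _ co _ z_f z_h; rewrite -size_poly_eq1 => /eqP -> [E].
by rewrite -E in e_gt0.
Qed.

Lemma lin_domE x : (x \in lin_dom h) = ~~ root Q x.
Proof.
rewrite inE -theta_lin theta_units1 ?monicXsubC // (@theta_unitE 1).
  by rewrite coprimep_sym coprimep_XsubC.
by rewrite mem_monl monicXsubC size_XsubC.
Qed.

Definition unit_count e := count (fun f => theta h f \in units1 h) (monl F e).

Lemma unit_count_le e : (unit_count e <= q ^ e)%N.
Proof. by rewrite -size_monl count_size. Qed.

Lemma count_dvd e d P : P \in irrs F d -> (0 < d)%N -> (count (fun f => (P %| f)%R) (monl F e) <= q ^ e.-1)%N.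
Proof.
move=> Pd d_gt0; have := @sum_monl_dvd F int (fun _ => 1) d e P (irrs_monl Pd) (fun _ _ _ _ => esym (mulr1 1)).
have cE (r : seq {poly F}) (p : pred {poly F}) : \sum_(f <- r | p f) 1 = (count p r)%:R :> int.
  by rewrite -sum1_count natr_sum.
rewrite !cE; case: ifP => _ /eqP; last by rewrite pnatr_eq0 => /eqP->.
rewrite mul1r eqr_nat count_predT size_monl => /eqP->; rewrite leq_exp2l ?card_gt1 //; lia.
Qed.

(** Union bound over the primes dividing [Q]: each removes at most [q^(e-1)] polynomials, and
    weighting each prime by its degree the total weight is at most [t]. *)
Lemma unit_count_ge e : (q ^ e <= unit_count e + t * q ^ e.-1)%N.
Proof.
have -> : (q ^ e = unit_count e + count (fun f => theta h f \notin units1 h) (monl F e))%N.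
  by rewrite -size_monl -(count_predC (fun f => theta h f \in units1 h)).
rewrite leq_add2l.
pose B := (e + t)%N.
apply: leq_trans (_ : \sum_(1 <= d < B.+1) \sum_(P <- irrs F d | (P %| Q)%R)
    count (fun f => (P %| f)%R) (monl F e) <= _)%N.
  have cov f : f \in monl F e -> theta h f \notin units1 h ->
      (0 < \sum_(1 <= d < B.+1) \sum_(P <- irrs F d | (P %| Q)%R) nat_of_bool (P %| f)%R)%N.
    move=> fe; rewrite theta_units1 ?(monl_monic fe) // (theta_unitE fe) => nco.
    have nzQ := monic_neq0 (monl_monic Qm).
    pose g := gcdp f Q; have nzg : g != 0 by rewrite gcdp_eq0 negb_and nzQ orbT.
    have gm : (lead_coef g)^-1 *: g \in monl F (size g).-1.
      rewrite mem_monl size_scale ?invr_eq0 ?lead_coef_eq0 // prednK ?size_poly_gt0 // eqxx andbT.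
      by rewrite monicE lead_coefZ mulVf ?lead_coef_eq0.
    have sg : (0 < (size g).-1)%N.
      rewrite -ltnS prednK ?size_poly_gt0 // ltn_neqAle size_poly_gt0 nzg andbT.
      by move: nco; rewrite /coprimep eq_sym.
    have [d [P [d_gt0 _ Pd]]] := irr_exists gm sg.
    rewrite dvdpZr ?invr_eq0 ?lead_coef_eq0 // => Pg.
    have Pf := dvdp_trans Pg (dvdp_gcdl _ _); have PQ := dvdp_trans Pg (dvdp_gcdr _ _).
    have le_d : (d <= B)%N.
      by apply: leq_trans (leq_addr _ _); have [] := monl_dvd (irrs_monl Pd) fe Pf.
    rewrite (bigD1_seq d) ?iota_uniq ?mem_index_iota ?d_gt0 //=.
    by rewrite (big_rem P) //= PQ Pf.
  elim: (monl F e) cov => [|f r IH] cov /=.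
    by [].
  have {}IH := IH (fun g gr => cov g (mem_behead (s := f :: r) gr)).
  under eq_bigr => d _ do rewrite big_split /=.
  rewrite big_split /=; apply: leq_add => //.
  by case: (theta h f \notin _) (cov f (mem_head _ _)) => // ->.
apply: leq_trans (_ : \sum_(1 <= d < B.+1) \sum_(P <- irrs F d | (P %| Q)%R) d * q ^ e.-1 <= _)%N.
  rewrite big_nat [leqRHS]big_nat; apply: leq_sum => d /andP[d_gt0 _].
  rewrite big_seq_cond [leqRHS]big_seq_cond; apply: leq_sum => P /andP[Pd _].
  by apply: leq_trans (count_dvd e Pd d_gt0) _; rewrite leq_pmull.
rewrite -[t in leqRHS](sum_pval Qm (leq_addl e t)) -/B big_distrl /= big_nat [leqRHS]big_nat.
apply: leq_sum => d /andP[d_gt0 le_dB]; rewrite big_distrl big_mkcond /=.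
apply: leq_sum => P _; case: ifPn => // PQ; rewrite leq_mul2r; apply/orP; right.
rewrite leq_pmulr // /pval big_ltn; last by rewrite ltnS (leq_trans d_gt0).
by rewrite expr1 PQ.
Qed.

Lemma card_units1 : #|units1 h| = unit_count (t + l).
Proof.
have := sum_theta (t + l) (fun u : {poly %/ h} => (u \in units1 h)%:R : algC).
have -> : \sum_(f <- monl F (t + l)) (theta h f \in units1 h)%:R = (unit_count (t + l))%:R :> algC.
  rewrite /unit_count; elim: (monl F (t + l)) => [|f r IH]; first by rewrite big_nil.
  by rewrite big_cons IH /= natrD.
move=> E; apply/eqP; rewrite -(eqr_nat algC) E -sum1_card natr_sum big_mkcond; apply/eqP.
apply: eq_bigr => u _; case: ifPn => uG; last by rewrite mulr0.
have u0 : (u : {poly F})`_0 = 1 by move: uG; rewrite inE => /andP[_ /eqP].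
have Em : (size h - 2 = t + l)%N by rewrite size_modulus subSS subn1.
by rewrite theta_count ?Em // subnn expn0 mulr1.
Qed.
End Modulus.

Section Moments.
Variables (F : finFieldType) (l t : nat) (Q : {poly F}).
Hypotheses (Qm : Q \in monl F t) (Q0 : Q`_0 != 0) (l_gt0 : (0 < l)%N).
Local Notation q := #|F|.
Local Notation h := (modulus l t Q).
Local Notation D := (lin_dom h).
Local Notation n := #|D|.
Local Notation G := (units1 h).
Let hm := modulus_monic l t Q0.
Let hs := modulus_gt2 Qm Q0 l_gt0.
Let h0 := modulus_coef0 l t Q.
Let sh : (1 < size h)%N. Proof. exact: ltnW hs. Qed.

Definition dom_zeros (f : {poly F}) : nat := #|[set x in D | root f x]|.
Definition split_poly (S : {set F}) : {poly F} := \prod_(x in S) ('X - x%:P).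
Definition moment d j (u : {poly %/ h}) : nat :=
  (\sum_(f <- monl F d | theta h f == u) 'C(dom_zeros f, j))%N.

Lemma split_poly_dvd S f : (split_poly S %| f) = [forall x in S, root f x].
Proof.
apply/idP/forall_inP => [Sf x xS|rS].
  by rewrite root_factor_theorem; apply: dvdp_trans Sf; rewrite /split_poly (bigD1 x) //= dvdp_mulr.
have rts : all (root f) (enum S) by apply/allP => x; rewrite mem_enum => /rS.
have un : uniq_roots (enum S) by rewrite uniq_rootsE enum_uniq.
have [p ->] := uniq_roots_prod_XsubC rts un.
by rewrite big_enum dvdp_mull.
Qed.

Lemma split_poly_monl S : split_poly S \in monl F #|S|.
Proof. by rewrite mem_monl /split_poly -big_enum monic_prod_XsubC size_prod_XsubC -cardE eqxx. Qed.

Lemma theta_split_poly S : theta h (split_poly S) = \prod_(x in S) lin h x.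
Proof.
rewrite /split_poly -!big_enum /=; elim: (enum S) => [|x r IH]; first by rewrite !big_nil theta1.
by rewrite !big_cons thetaM ?monicXsubC ?monic_prod_XsubC // IH theta_lin.
Qed.

Lemma binomial_zeros f j :
  'C(dom_zeros f, j) = (\sum_(S : {set F} | (S \subset D) && (#|S| == j)) (split_poly S %| f)%R)%N.
Proof.
rewrite -cards_draws -sum1_card big_mkcond [RHS]big_mkcond; apply: eq_bigr => S _.
rewrite inE split_poly_dvd; case: (#|S| == j); rewrite ?andbF //= !andbT.
have -> : (S \subset [set x in D | root f x]) = (S \subset D) && [forall x in S, root f x].
  apply/subsetP/andP => [sub|[/subsetP SD /forall_inP rS] x xS].
    by split; [apply/subsetP | apply/forall_inP] => x /sub; rewrite inE => /andP[].
  by rewrite inE SD ?rS.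
by case: (S \subset D) => //=; case: ifP.
Qed.

Lemma moment_subsets d j u : moment d j u =
  (\sum_(S : {set F} | (S \subset D) && (#|S| == j))
     count (fun f => (theta h f == u) && (split_poly S %| f)%R) (monl F d))%N.
Proof.
rewrite /moment; under eq_bigr => f _ do rewrite binomial_zeros.
rewrite exchange_big; apply: eq_bigr => S _ /=.
elim: (monl F d) => [|f r IH]; first by rewrite big_nil.
by rewrite big_cons IH /=; case: (theta h f == u).
Qed.

Lemma count_split S d u : count (fun f => (theta h f == u) && (split_poly S %| f)%R) (monl F d) =
  if (#|S| <= d)%N then count (fun g => theta h (split_poly S) * theta h g == u) (monl F (d - #|S|))
  else 0%N.
Proof.
rewrite -size_filter filter_predI size_filter.
case: leqP => [le_d|lt_d]; last by rewrite (monl_dvd_none (split_poly_monl S) lt_d).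
rewrite (seq.permP (perm_monl_dvd (split_poly_monl S) le_d)) count_map.
apply: eq_in_count => g gd /=.
by rewrite thetaM ?(monl_monic gd) ?(monl_monic (split_poly_monl S)).
Qed.

(** Once the [j] zeros are fixed, the cofactor still has degree at least [t + l] and is therefore
    uniform among the residues. *)
Lemma moment_small d j u : u \in G -> (j + (t + l) <= d)%N ->
  moment d j u = ('C(n, j) * q ^ (d - j - (t + l)))%N.
Proof.
move=> uG le_jd; rewrite moment_subsets.
rewrite (eq_bigr (fun _ => (q ^ (d - j - (t + l)))%N)); last first.
  move=> S /andP[SD /eqP cS]; rewrite count_split cS ifT; last by lia.
  have [SG _] := prod_lin hm hs h0 SD; rewrite -theta_split_poly in SG.
  have sU := units1_unit SG.
  rewrite (eq_count (a2 := fun g => theta h g == (theta h (split_poly S))^-1 * u)); last first.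
    by move=> g; rewrite /= -[in RHS](inj_eq (mulrI sU)) mulVKr.
  have Em : (size h - 2 = t + l)%N by rewrite (size_modulus l t Q0) subSS subn1.
  rewrite theta_count ?Em //; last first.
    rewrite qpoly_coef0M //; have u0 : (u : {poly F})`_0 = 1.
      by move: uG; rewrite inE => /andP[_ /eqP].
    rewrite u0 mulr1; have := qpoly_coef0M hm sh h0 (theta h (split_poly S)) (theta h (split_poly S))^-1.
    rewrite divrr // theta_coef0 ?(monl_monic (split_poly_monl S)) // mul1r => <-.
    by rewrite -(rmorph1 (in_qpoly h)) in_qpoly_coef0 // coef1.
  by lia.
rewrite sum_nat_const; congr (_ * _)%N; rewrite -cards_draws.
by apply: eq_card => S; rewrite !inE.
Qed.

(** With the roles exchanged: the cofactor [g] is fixed, and the sets of zeros with a prescribed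
    product of residues are counted. *)
Lemma moment_large d j u : u \in G -> (j <= d)%N -> moment d j u =
  (\sum_(g <- monl F (d - j) | theta h g \in G) lin_subsets j (u * (theta h g)^-1)%R)%N.
Proof.
move=> uG le_jd; rewrite moment_subsets.
transitivity (\sum_(g <- monl F (d - j)) \sum_(S : {set F} | (S \subset D) && (#|S| == j))
    nat_of_bool ((theta h (split_poly S) * theta h g)%R == u))%N.
  rewrite exchange_big; apply: eq_bigr => S /andP[_ /eqP cS].
  rewrite count_split cS le_jd; elim: (monl F (d - j)) => [|g r IH]; first by rewrite big_nil.
  by rewrite big_cons /= IH.
rewrite [RHS]big_mkcond big_seq [RHS]big_seq; apply: eq_bigr => g gd.
rewrite theta_units1 ?(monl_monic gd) //; case: ifPn => gU; last first.
  apply: big1 => S _; apply/eqP; rewrite eqb0; apply: contra gU => /eqP E.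
  by move: (units1_unit uG); rewrite -E unitrM => /andP[].
rewrite /lin_subsets -sum1_card big_mkcond [RHS]big_mkcond; apply: eq_bigr => S _.
rewrite inE -theta_split_poly -[in RHS](inj_eq (mulIr gU)) mulrVK //.
by case: (S \subset D) => //=; case: (#|S| == j) => //=; case: eqP.
Qed.

(** Multiplying by [q] removes the truncated [e.-1] and makes the bound uniform in [e]. *)
Lemma unit_count_ge' e : (q * q ^ e <= q * unit_count l t Q e + t * q ^ e)%N.
Proof.
case: e => [|e].
  rewrite /unit_count expn0 !muln1; apply: leq_trans (leq_addr _ _); rewrite leq_pmulr //.
  rewrite -has_count; apply/hasP; exists 1; first by rewrite mem_monl monic1 size_poly1.
  by rewrite theta1 units1_1.
have := unit_count_ge Qm Q0 l_gt0 e.+1; rewrite /= => le_q.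
by apply: leq_trans (leq_mul (leqnn q) le_q) _; rewrite mulnDr leq_add2l [in leqRHS]expnS mulnCA.
Qed.

Section Approximation.
Variables (R : realFieldType) (eta : R) (j : nat).
Hypothesis le_j : forall u, u \in G ->
  `|(#|G| * lin_subsets j u)%:R - 'C(n, j)%:R| <= eta * 'C(n, j)%:R :> R.
Hypothesis small_t : (2 * t <= q)%N.

Lemma moment_dev d u : u \in G -> (j <= d)%N ->
  `|(moment d j u)%:R * #|G|%:R - (unit_count l t Q (d - j))%:R * 'C(n, j)%:R|
    <= (unit_count l t Q (d - j))%:R * (eta * 'C(n, j)%:R) :> R.
Proof.
move=> uG le_jd; rewrite moment_large // /unit_count.
elim: (monl F (d - j)) => [|g r IH]; first by rewrite big_nil !mul0r subrr normr0.
rewrite big_cons /=; case: ifP => gG; rewrite /= ?add0n // add1n.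
have T (a b c v w : R) : (a + b) * v - (c + 1) * w = (v * a - w) + (b * v - c * w) by ring.
rewrite natrD -natr1 T mulrDl mul1r.
apply: le_trans (ler_normD _ _) _; rewrite [leRHS]addrC; apply: lerD => //.
rewrite -natrM; apply: le_j.
have gU := units1_unit gG.
move: uG gG; rewrite !inE => /andP[uU /eqP u0] /andP[_ /eqP g0].
rewrite unitrMl ?unitrV // uU qpoly_coef0M // u0 mul1r.
have := qpoly_coef0M hm sh h0 (theta h g) (theta h g)^-1.
rewrite divrr // g0 mul1r => <-.
by rewrite -(rmorph1 (in_qpoly h)) in_qpoly_coef0 // coef1 eqxx.
Qed.

(** [U / B] is the number of admissible cofactors over the order of the group, [T / N] the ratio of
    the corresponding powers of [q]; each quantity is within the factor [1 - s] of its model, where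
    [s] will be [t / q]. The 2 comes from [N <= 2 * B]. *)
Lemma ratio_bound (M B U T N C s : R) : 0 <= eta -> 0 <= C -> 0 <= T -> 0 < N -> 0 <= s -> 2 * s <= 1 ->
  U <= T -> (1 - s) * T <= U -> B <= N -> (1 - s) * N <= B ->
  `|M * B - U * C| <= U * (eta * C) ->
  `|M - C * T / N| <= 2 * (eta + s) * (C * T / N).
Proof.
move=> e0 C0 T0 N0 s0 s2 UT lU BN lB dev.
have N2B : N <= 2 * B.
  apply: le_trans (_ : 2 * ((1 - s) * N) <= _); last by rewrite ler_pM2l.
  rewrite mulrA ler_peMl ?(ltW N0) //; rewrite mulrBr mulr1 lerBrDr; apply: le_trans (lerD (lexx _) s2) _.
  by rewrite -natr1.
have B0 : 0 < B by rewrite -(@pmulr_rgt0 _ 2) // (lt_le_trans N0).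
have sTN : 0 <= s * T * N by rewrite !mulr_ge0 // ltW.
have dUT : `|U * N - T * B| <= s * T * N.
  rewrite ler_norml; apply/andP; split.
    rewrite lerBrDr; apply: le_trans (ler_wpM2r (ltW N0) lU).
    have := ler_wpM2l T0 BN; set x := T * B => le_x.
    have -> : (1 - s) * T * N = - (s * T * N) + T * N by ring.
    by rewrite lerD2l.
  rewrite lerBlDr; apply: le_trans (ler_wpM2r (ltW N0) UT) _.
  have := ler_wpM2l T0 lB; set x := T * B => le_x.
  apply: le_trans (lerD (lexx (s * T * N)) le_x).
  by rewrite le_eqVlt; apply/orP; left; apply/eqP; ring.
have key : `|M * B * N - C * T * B| <= (eta + s) * (C * T * N).
  have -> : M * B * N - C * T * B = (M * B - U * C) * N + C * (U * N - T * B) by ring.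
  apply: le_trans (ler_normD _ _) _; rewrite !normrM (gtr0_norm N0) (ger0_norm C0).
  apply: le_trans (lerD (ler_wpM2r (ltW N0) dev) (ler_wpM2l C0 dUT)) _.
  have : U * (eta * C) * N <= T * (eta * C) * N.
    by rewrite !ler_wpM2r ?(ltW N0) // mulr_ge0.
  move=> le_UT; apply: le_trans (lerD le_UT (lexx _)) _.
  by rewrite le_eqVlt; apply/orP; left; apply/eqP; ring.
have BN0 : 0 < B * N by rewrite mulr_gt0.
rewrite -(ler_pM2r BN0) -{1}(gtr0_norm BN0) -normrM.
have nN : N != 0 by rewrite gt_eqF.
have -> : (M - C * T / N) * (B * N) = M * B * N - C * T * B by field.
apply: le_trans key _.
have -> : 2 * (eta + s) * (C * T / N) * (B * N) = (eta + s) * (C * T * (2 * B)) by field.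
by apply: ler_wpM2l; rewrite ?addr_ge0 // ler_wpM2l ?mulr_ge0.
Qed.

Lemma moment_approx d u : 0 <= eta -> u \in G -> (j <= d)%N ->
  let c := 'C(n, j)%:R * (q ^ (d - j))%:R / (q ^ (t + l))%:R in
  `|(moment d j u)%:R - c| <= 2 * (eta + t%:R / q%:R) * c :> R.
Proof.
move=> e0 uG le_jd /=.
have q0 : (0 < q)%N by apply/card_gt0P; exists 0.
have q0R : 0 < (q%:R : R) by rewrite ltr0n.
have lower e : (1 - t%:R / q%:R) * (q ^ e)%:R <= (unit_count l t Q e)%:R :> R.
  rewrite -(ler_pM2l q0R) mulrA mulrBr mulr1 mulrCA divff ?gt_eqF // mulr1 mulrBl lerBlDr.
  by rewrite -!natrM -natrD ler_nat unit_count_ge'.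
have upper e : (unit_count l t Q e)%:R <= (q ^ e)%:R :> R by rewrite ler_nat unit_count_le.
apply: (ratio_bound (U := (unit_count l t Q (d - j))%:R) (B := #|G|%:R)) => //.
- by rewrite ltr0n expn_gt0 q0.
- by rewrite mulrA ler_pdivrMr // mul1r -natrM ler_nat.
- by rewrite (card_units1 Qm Q0 l_gt0).
- by rewrite (card_units1 Qm Q0 l_gt0).
exact: moment_dev.
Qed.
End Approximation.
End Moments.

(** * Hayes classes *)

Section Translation.
Variables (F : finFieldType) (l t : nat) (Q : {poly F}) (x0 : F).
Hypotheses (Qt : Q \in monl F t) (Qx0 : ~~ root Q x0) (l_gt0 : (0 < l)%N).
Local Notation q := #|F|.
Local Notation sft f := (f \Po ('X + x0%:P)).
Local Notation Q' := (sft Q).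
Local Notation h := (modulus l t Q').

Lemma shiftK (f : {poly F}) : sft f \Po ('X - x0%:P) = f.
Proof. exact: comp_polyXaddC_K. Qed.

Lemma unshiftK (f : {poly F}) : sft (f \Po ('X - x0%:P)) = f.
Proof. by have := comp_polyXaddC_K f (- x0); rewrite polyCN opprK. Qed.

Lemma size_shift (f : {poly F}) : size (sft f) = size f.
Proof. by rewrite size_comp_poly2 // size_XaddC. Qed.

Lemma shift_monl d (f : {poly F}) : (sft f \in monl F d) = (f \in monl F d).
Proof.
rewrite !mem_monl size_shift !monicE lead_coef_comp ?size_XaddC // lead_coefXaddC.
by rewrite expr1n mulr1.
Qed.

Lemma dvdp_shift (f g : {poly F}) : (sft f %| sft g) = (f %| g).
Proof.
apply/idP/idP => [|fg]; last exact: dvdp_comp_poly.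
by move/(dvdp_comp_poly ('X - x0%:P)); rewrite !shiftK.
Qed.

Lemma coprimep_shift (f g : {poly F}) : coprimep (sft f) (sft g) = coprimep f g.
Proof.
apply/idP/idP => [|co]; last exact: coprimep_comp_poly.
by move/(coprimep_comp_poly ('X - x0%:P)); rewrite !shiftK.
Qed.

Lemma perm_shift d : perm_eq [seq sft f | f <- monl F d] (monl F d).
Proof.
apply: uniq_perm; rewrite ?monl_uniq //.
  by rewrite map_inj_uniq ?monl_uniq //; apply: (can_inj shiftK).
move=> f; apply/mapP/idP => [[g gd ->]|fd]; first by rewrite shift_monl.
by exists (f \Po ('X - x0%:P)); rewrite ?unshiftK // -shift_monl unshiftK.
Qed.

Lemma shift_coef0 (f : {poly F}) : (sft f)`_0 = f.[x0].
Proof. by rewrite -horner_coef0 horner_comp !hornerE. Qed.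

Let Q't : Q' \in monl F t. Proof. by rewrite shift_monl. Qed.
Let Q'0 : Q'`_0 != 0. Proof. by rewrite shift_coef0. Qed.

Lemma eq_modp (f g z : {poly F}) : (f %% z == g %% z) = (z %| f - g).
Proof. by apply/eqP/modp_eq0P => E; first rewrite modpD modpN E subrr; last by apply/eqP; rewrite -subr_eq0 -modpN -modpD E. Qed.

Lemma dvdp_Xn m (f : {poly F}) : (forall i, (i < m)%N -> f`_i = 0) -> 'X^m %| f.
Proof.
move=> f0; rewrite (_ : f = drop_poly m f * 'X^m) ?dvdp_mull //.
apply/polyP => i; rewrite coefMXn coef_drop_poly; case: ltnP => le_i; last by rewrite subnK.
exact: f0.
Qed.

Lemma dvdp_Xn_revn m d (f : {poly F}) : (m <= d)%N -> (size f <= d.+1)%N ->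
  ('X^(m.+1) %| revn d f) = (size f <= d - m)%N.
Proof.
move=> le_md sf; apply/idP/idP => [/dvdpP[g E]|le_s].
  apply/leq_sizeP => i le_i; have [le_id|lt_di] := leqP i d; last first.
    by rewrite nth_default // (leq_trans sf).
  have : (revn d f)`_(d - i) = 0 by rewrite E coefMXn ifT //; lia.
  by rewrite coef_revn leq_subr subKn.
apply: dvdp_Xn => i le_i; rewrite coef_revn; case: ifP => // le_id; rewrite nth_default // (leq_trans le_s) //; lia.
Qed.

Lemma dvdp_revn d (f : {poly F}) : (t <= d)%N -> (size f <= d.+1)%N ->
  (revn t Q' %| revn d f) = (Q' %| f).
Proof.
move=> le_td sf; apply/idP/idP => [/dvdpP[g E]|/dvdpP[g E]].
  have sg : (size g <= (d - t).+1)%N.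
    have [->|nzg] := eqVneq g 0; first by rewrite size_poly0.
    have sr : size (revn t Q') = t.+1.
      apply/eqP; rewrite eqn_leq size_poly ltnNge; apply/negP => le_s.
      have : (revn t Q')`_t = 0 by rewrite nth_default.
      by rewrite coef_revn leqnn subnn; apply/eqP.
    have : (size (revn d f) <= d.+1)%N by apply: size_poly.
    rewrite E size_proper_mul ?sr; first by rewrite addnS /=; move: (size g) => s; lia.
    by rewrite mulf_neq0 ?lead_coef_eq0 // -size_poly_gt0 sr.
  rewrite -(revnK sf) E -{1}(subnK le_td) revnM ?size_poly //.
  by rewrite revnK ?dvdp_mull // (monl_size Q't).
have sg : (size g <= (d - t).+1)%N.
  have [->|nzg] := eqVneq g 0; first by rewrite size_poly0.
  move: sf; rewrite E size_Mmonic ?(monl_monic Q't) // (monl_size Q't) addnS /=; move: (size g) => s; lia.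
by rewrite E -{1}(subnK le_td) revnM ?dvdp_mull // (monl_size Q't).
Qed.

(** The power of ['X] tests the degree of [f], which the shift of variable preserves although it
    changes the coefficients; the other factor tests divisibility by [Q]. They are coprime because
    the reversal of a monic polynomial is 1 at 0. *)
Lemma modulus_dvd d (f : {poly F}) : (l <= d)%N -> (t <= d)%N -> (size f <= d.+1)%N ->
  (h %| revn d (sft f)) = (size f <= d - l)%N && (Q %| f).
Proof.
move=> le_ld le_td sf; rewrite /modulus Gauss_dvdp; last first.
  rewrite coprimep_expl // coprimepZr ?invr_eq0 // coprimep_sym -[X in coprimep _ X]subr0 -polyC0.
  rewrite coprimep_XsubC rootE horner_coef0 coef_revn /= subn0.
  by have := monl_monic Q't; rewrite monicE lead_coefE (monl_size Q't) /= => /eqP ->; rewrite oner_eq0.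
rewrite dvdpZl ?invr_eq0 // dvdp_Xn_revn // ?size_shift // dvdp_revn ?size_shift //.
by rewrite dvdp_shift.
Qed.

Lemma revp_monl d (f : {poly F}) : f \in monl F d -> revp f = revn d f.
Proof. by move=> fd; rewrite /revp /revn /deg (monl_size fd). Qed.

Lemma theta_shift_eq d (f g : {poly F}) : (l <= d)%N -> (t <= d)%N ->
  f \in monl F d -> g \in monl F d ->
  (theta h (sft f) == theta h (sft g)) =
  (revp f %% 'X^(l.+1) == revp g %% 'X^(l.+1)) && (f %% Q == g %% Q).
Proof.
move=> le_ld le_td fd gd.
have hm := modulus_monic l t Q'0; have sh := ltnW (modulus_gt2 Q't Q'0 l_gt0).
have sfg : (size (f - g)%R <= d.+1)%N.
  by apply: leq_trans (size_polyD _ _) _; rewrite size_polyN (monl_size fd) (monl_size gd) maxnn.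
rewrite !(thetaE _ (d := d)) ?shift_monl // !eq_modp !(revp_monl (d := d)) //.
rewrite -raddfB dvdp_Xn_revn // -modulus_dvd // -subr_eq0 -rmorphB -raddfB.
by rewrite -comp_polyB in_qpoly_eq0.
Qed.

Lemma theta_shift_units1 d (f : {poly F}) : f \in monl F d ->
  (theta h (sft f) \in units1 h) = coprimep f Q.
Proof.
move=> fd; have sfd : sft f \in monl F d by rewrite shift_monl.
have hm := modulus_monic l t Q'0; have sh := ltnW (modulus_gt2 Q't Q'0 l_gt0).
rewrite (theta_units1 hm sh (modulus_coef0 l t Q') (monl_monic sfd)).
by rewrite (theta_unitE Q't Q'0 l_gt0 sfd) coprimep_shift.
Qed.

Lemma lin_dom_shift x : (x \in lin_dom h) = (x + x0 \in nonzeros Q).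
Proof. by rewrite lin_domE // inE root_comp !hornerE. Qed.

Lemma card_nonzeros : #|nonzeros Q| = #|lin_dom h|.
Proof.
rewrite -(card_imset (mem (lin_dom h)) (addIr x0)); apply: eq_card => x.
apply/idP/imsetP => [xD|[y yD ->]]; last by rewrite -lin_dom_shift.
by exists (x - x0); rewrite ?subrK //; have := lin_dom_shift (x - x0); rewrite subrK xD.
Qed.

Lemma num_zeros_shift (f : {poly F}) : num_zeros Q f = dom_zeros l t Q' (sft f).
Proof.
rewrite /num_zeros /dom_zeros -[in RHS](card_imset _ (addIr x0)); apply: eq_card => x.
rewrite finset.in_set; apply/andP/imsetP => [[xD xf]|[y]].
  by exists (x - x0); rewrite ?subrK // finset.in_set lin_dom_shift root_comp !hornerE subrK xD.
by rewrite finset.in_set lin_dom_shift root_comp !hornerE => /andP[? ?] ->.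
Qed.

(** A class is given by a member of arbitrary degree. In degree at least [t + l] the top [l.+1]
    coefficients and the residue modulo [Q] can be prescribed independently: [g] provides the
    former, and [r], of degree below [t], corrects the latter. *)
Lemma hayes_class_rep d (f0 : {poly F}) : (t + l <= d)%N -> f0 \is monic -> coprimep f0 Q ->
  exists2 f1, f1 \in monl F d & hayes_equiv l Q f0 f1.
Proof.
move=> le_d mf0 co0; have mQ := monl_monic Qt; have nQ := monic_neq0 mQ.
pose g := revn d (take_poly l.+1 (revp f0)); pose r := (f0 - g) %% Q.
have sr : (size r <= t)%N by rewrite -ltnS -(monl_size Qt) ltn_modp.
have cg i : (i <= l)%N -> (g + r)`_(d - i) = (revp f0)`_i.
  move=> le_i; rewrite coefD (nth_default _ (leq_trans sr _)) ?addr0; last by lia.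
  by rewrite coef_revn leq_subr subKn ?coef_take_poly ?ltnS ?le_i //; lia.
have sg : size (g + r) = d.+1.
  apply/eqP; rewrite eqn_leq; apply/andP; split.
    apply: leq_trans (size_polyD _ _) _; rewrite geq_max size_poly (leq_trans sr) //; lia.
  rewrite ltnNge; apply/negP => le_s; have := cg 0%N isT; rewrite subn0 nth_default //.
  rewrite /revp coef_poly size_poly_gt0 (monic_neq0 mf0) subn0 => E.
  by move: mf0; rewrite monicE lead_coefE -/(deg f0) -E eq_sym oner_eq0.
have E1 : (g + r) %% Q = f0 %% Q by apply/eqP; rewrite modpD modp_id -modpD subrKC.
have f1d : g + r \in monl F d.
  rewrite mem_monl sg eqxx andbT monicE lead_coefE sg /= -[d in _`_d]subn0 cg //.
  by rewrite /revp coef_poly size_poly_gt0 (monic_neq0 mf0) subn0 -lead_coefE -monicE.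
exists (g + r) => //; split=> //; first by rewrite -coprimep_modl E1 coprimep_modl.
apply/eqP; rewrite eq_modp; apply: dvdp_Xn => i; rewrite ltnS => le_i.
rewrite coefB (revp_monl f1d) coef_revn ifT ?cg ?subrr //; lia.
Qed.

Lemma hayes_class_theta d (eps : set {poly F}) : (t + l <= d)%N -> hayes_classes l Q eps ->
  exists2 u, u \in units1 h &
    forall f, f \in monl F d -> (f \in eps) = (theta h (sft f) == u).
Proof.
move=> le_d [f0 [mf0 co0 ->]].
have [f1 f1d [_ co1 E1 E2]] := hayes_class_rep le_d mf0 co0.
exists (theta h (sft f1)) => [|f fd]; first by rewrite (theta_shift_units1 f1d).
rewrite (theta_shift_eq (d := d)) //; [|lia|lia].
apply/idP/andP => [|[/eqP E3 /eqP E4]].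
  by rewrite in_setE => -[_ [_ cof E3 E4]]; rewrite -E3 -E4 E1 E2 !eqxx.
rewrite in_setE; split; first exact: monl_monic fd.
split=> //; rewrite ?E3 ?E4 //.
rewrite -(theta_shift_units1 fd).
suff /eqP -> : theta h (sft f) == theta h (sft f1) by rewrite (theta_shift_units1 f1d).
by rewrite (theta_shift_eq (d := d)) ?E3 ?E4 ?eqxx //; lia.
Qed.

Lemma card_monics_in d (eps : set {poly F}) (P : pred {poly F}) :
  #|finset (fun f : {poly_(d.+1) F} => (f \in monics_in d eps) && P f)| =
  count (fun f => (f \in eps) && P f) (monl F d).
Proof.
rewrite -size_filter cardE -(size_map (fun f : {poly_(d.+1) F} => (f : {poly F}))).
apply: perm_size; apply: uniq_perm.
- by rewrite map_inj_uniq ?enum_uniq //; apply: val_inj.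
- by rewrite filter_uniq ?monl_uniq.
move=> f; rewrite mem_filter mem_monl; apply/mapP/idP.
  move=> [g]; rewrite mem_enum !inE => /andP[/and3P[mg /eqP dg ge] Pg] ->.
  rewrite ge Pg mg /=; apply/eqP; have := congr1 S dg.
  by rewrite /deg prednK // size_poly_gt0 monic_neq0.
move=> /and3P[/andP[fe Pf] mf /eqP sf].
have sf' : (size f <= d.+1)%N by rewrite sf.
exists (npolyp d.+1 f); last by rewrite npolypK.
by rewrite mem_enum !inE npolypK // mf fe Pf /deg sf eqxx.
Qed.
End Translation.

(** * The sieve *)

Section Alternating.
Variable R : realDomainType.
Implicit Types b : nat -> R.

Lemma alternating_bounds b M : (forall i, 0 <= b i.+1 <= b i) ->
  0 <= \sum_(0 <= i < M) (-1) ^+ i * b i <= b 0%N.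
Proof.
elim: M b => [|M IH] b dec; first by rewrite big_geq // lexx; have /andP[/le_trans] := dec 0%N; apply.
rewrite big_nat_recl // expr0 mul1r.
have -> : \sum_(0 <= i < M) (-1) ^+ i.+1 * b i.+1 = - \sum_(0 <= i < M) (-1) ^+ i * b i.+1.
  by rewrite -sumrN; apply: eq_bigr => i _; rewrite exprS mulN1r mulNr.
have /andP[s0 s1] := IH (fun i => b i.+1) (fun i => dec i.+1).
have /andP[b0 b1] := dec 0%N.
by rewrite subr_ge0 (le_trans s1 b1) lerBlDr lerDl s0.
Qed.

(** Bonferroni: stopping a decreasing alternating sum after an even number of terms underestimates
    it. *)
Lemma alternating_ge b J M : (forall i, 0 <= b i.+1 <= b i) -> ~~ odd J -> (J <= M)%N ->
  \sum_(0 <= i < J) (-1) ^+ i * b i <= \sum_(0 <= i < M) (-1) ^+ i * b i.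
Proof.
move=> dec eJ le_JM; rewrite [leRHS](big_cat_nat (n := J)) //= lerDl.
rewrite -{1}[J]add0n big_addn.
have /andP[s0 _] := alternating_bounds (M - J) (fun i => dec (i + J)%N).
apply: le_trans s0 _; rewrite le_eqVlt; apply/orP; left; apply/eqP; apply: eq_bigr => i _.
by rewrite exprD -[(-1) ^+ J]signr_odd (negbTE eJ) expr0 mulr1.
Qed.
End Alternating.

Section MainTerm.
Variables (R : realType) (q m : nat).
Hypotheses (q_ge4 : (4 <= q)%N) (le_mq : (m <= q)%N).
Let a j : R := 'C(m, j)%:R * q%:R ^- j.

Let q0 : 0 < q%:R :> R. Proof. by rewrite ltr0n; lia. Qed.

Let a_dec i : 0 <= a i.+1 <= a i.
Proof.
rewrite /a mulr_ge0 ?invr_ge0 ?exprn_ge0 ?(ltW q0) //= exprS invfM mulrA.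
rewrite ler_wpM2r ?invr_ge0 ?exprn_ge0 ?(ltW q0) // ler_pdivrMr // -natrM ler_nat.
have := mul_bin_left m i; have [le_im|lt_mi] := leqP i m; last by rewrite !bin_small //; lia.
move: ('C(m, i.+1)) ('C(m, i)) => x y; nia.
Qed.

Lemma alternating_binomial_ge1 M : (2 <= M)%N ->
  1 - m%:R / q%:R <= \sum_(0 <= j < M) (-1) ^+ j * 'C(m, j)%:R * q%:R ^- j :> R.
Proof.
move=> M2; under eq_bigr do rewrite -mulrA.
apply: le_trans (alternating_ge (J := 2) (b := a) a_dec isT M2).
by rewrite !big_nat_recr //= big_geq // /a bin0 bin1 !expr0 !expr1 invr1 !mulr1 mulN1r add0r.
Qed.

(** After ['C(m, 3)] is bounded by ['C(m, 2) * q / 3], the worst case is [m = q], where the four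
    terms give [(q - 1) / (3 q)]; this is at least 1/4 exactly when [4 <= q]. *)
Lemma alternating_binomial_ge3 M : (4 <= M)%N ->
  4^-1 <= \sum_(0 <= j < M) (-1) ^+ j * 'C(m, j)%:R * q%:R ^- j :> R.
Proof.
move=> M4; under eq_bigr do rewrite -mulrA.
apply: le_trans (alternating_ge (J := 4) (b := a) a_dec isT M4).
rewrite !big_nat_recr //= big_geq // /a bin0 bin1 !expr0 !expr1 invr1 !mulr1 mulN1r add0r.
have -> : (-1) ^+ 2 = 1 :> R by rewrite sqrrN expr1n.
have -> : (-1) ^+ 3 = -1 :> R by rewrite exprS sqrrN expr1n mulr1.
rewrite mul1r mulN1r.
have E2 : 2 * 'C(m, 2)%:R = m%:R * (m%:R - 1) :> R.
  case: m => [|x]; first by rewrite !mul0r mulr0.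
  have := mul_bin_left x.+1 1; rewrite bin1 subSS subn0 => /(congr1 (fun x => x%:R : R)).
  by rewrite !natrM => ->; rewrite -natr1 addrK mulrC.
have E3 : 3 * 'C(m, 3)%:R = 'C(m, 2)%:R * (m%:R - 2) :> R.
  case: m => [|[|x]]; [by rewrite !bin0n /= !(mul0r, mulr0)| by rewrite !bin_small // !(mul0r, mulr0) |].
  have := mul_bin_left x.+2 2; rewrite !subSS subn0 => /(congr1 (fun x => x%:R : R)).
  by rewrite !natrM => ->; rewrite -[x.+2]addn2 natrD addrK mulrC.
set C2 := 'C(m, 2)%:R in E2 E3 *; set C3 := 'C(m, 3)%:R in E3 *.
have C20 : 0 <= C2 by apply: ler0n.
have leq : m%:R <= q%:R :> R by rewrite ler_nat.
have q4 : 4 <= q%:R :> R by rewrite ler_nat.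
have m0 : 0 <= m%:R :> R by apply: ler0n.
set x : R := m%:R in E2 E3 leq m0 *; set y : R := q%:R in leq q4 *.
have y0 : 0 < y := q0; have y3 : 0 < y ^+ 3 by rewrite exprn_gt0.
rewrite -(ler_pM2r y3).
have ny : y != 0 by rewrite gt_eqF.
have -> : (1 - x / y + C2 / y ^+ 2 - C3 / y ^+ 3) * y ^+ 3
  = y ^+ 3 - x * y ^+ 2 + C2 * y - C3 by field.
have H1 : C3 <= C2 * (y / 3).
  rewrite -(ler_pM2l (_ : 0 < 3)) // E3 mulrCA ler_wpM2l // mulrCA divff // mulr1.
  by rewrite lerBlDr (le_trans leq) // lerDl.
apply: le_trans (lerB (lexx _) H1).
have -> : y ^+ 3 - x * y ^+ 2 + C2 * y - C2 * (y / 3) = y * (y ^+ 2 - x * y + (2 * C2) / 3) by field.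
rewrite E2 exprS mulrCA (ler_pM2l y0).
have w0 : 0 <= y - x by rewrite subr_ge0.
have := mulr_ge0 (ltW y0) w0; have := sqr_ge0 (y - x).
have : 0 <= y * (y - 4) by rewrite mulr_ge0 ?(ltW y0) // subr_ge0.
nra.
Qed.

Lemma binomial_sum_le M : \sum_(0 <= j < M) 'C(m, j)%:R * q%:R ^- j <= expR 1 :> R.
Proof.
have a0 j : 0 <= a j by have /andP[_] := a_dec j; apply: le_trans; have /andP[] := a_dec j.
apply: le_trans (_ : \sum_(0 <= j < m.+1) a j <= _).
  have [le_M|lt_M] := leqP M m.+1.
    by rewrite [leRHS](big_cat_nat (n := M)) //= lerDl sumr_ge0.
  rewrite (big_cat_nat (n := m.+1)) //=; last exact: ltnW.
  rewrite [X in _ + X]big_nat_cond [X in _ + X]big1 ?addr0 //.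
  by move=> j /andP[/andP[lt_j _] _]; rewrite bin_small // mul0r.
have -> : \sum_(0 <= j < m.+1) a j = (1 + q%:R^-1) ^+ m.
  rewrite exprDn big_mkord; apply: eq_bigr => j _.
  by rewrite expr1n mul1r /a exprVn mulr_natl.
apply: le_trans (_ : expR (q%:R^-1) ^+ m <= _).
  by rewrite lerXn2r ?nnegrE ?expR_ge0 ?expR_ge1Dx // addr_ge0 // invr_ge0 ltW.
by rewrite -expRM_natl ler_expR ler_pdivrMr // mul1r ler_nat.
Qed.
End MainTerm.

Section Sieve.
Variables (R : realType) (F : finFieldType) (l t k : nat) (Q : {poly F}).
Hypotheses (Qm : Q \in monl F t) (Q0 : Q`_0 != 0) (l_gt0 : (0 < l)%N).
Local Notation q := #|F|.
Local Notation h := (modulus l t Q).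
Local Notation n := #|lin_dom h|.
Local Notation d := (k + t + l)%N.
Variable u : {poly %/ h}.

Definition zeros_count r : nat :=
  count (fun f => (theta h f == u) && (dom_zeros l t Q f == r)) (monl F d).

Lemma dom_zeros_le f : f \in monl F d -> (dom_zeros l t Q f <= d)%N.
Proof.
move=> fd; rewrite -ltnS -(monl_size fd) /dom_zeros cardE.
apply: max_poly_roots; rewrite ?(monic_neq0 (monl_monic fd)) ?enum_uniq //.
by apply/allP => x; rewrite mem_enum finset.in_set => /andP[].
Qed.

Lemma bin_trinomial z r i : ('C(z, r) * 'C(z - r, i) = 'C(z, r + i) * 'C(r + i, r))%N.
Proof.
have [le_z|lt_z] := leqP (r + i) z; last first.
  rewrite (bin_small lt_z) mul0n; have [lt_zr|le_rz] := ltnP z r; first by rewrite bin_small.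
  by rewrite [X in (_ * X)%N]bin_small ?muln0 //; lia.
have r0 := fact_gt0 r; have i0 := fact_gt0 i; have zi0 := fact_gt0 (z - (r + i)).
apply/eqP; rewrite -(eqn_pmul2r (_ : (0 < r`! * (i`! * (z - (r + i))`!))%N)); last by rewrite !muln_gt0 r0 i0.
have E1 := @bin_fact z r ltac:(lia); have E2 := @bin_fact (z - r) i ltac:(lia).
have E3 := @bin_fact z (r + i) le_z; have E4 := @bin_fact (r + i) r (leq_addr _ _).
rewrite addKn in E4; rewrite -subnDA in E2.
apply/eqP; transitivity z`!.
  by rewrite -E1 -E2; move: ('C(z, r)) ('C(z - r, i)) r`! i`! (z - (r + i))`! => *; ring.
by rewrite -E3 -E4; move: ('C(z, r + i)) ('C(r + i, r)) r`! i`! (z - (r + i))`! => *; ring.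
Qed.

Lemma binomial_inversion r z : (r <= d)%N -> (z <= d)%N ->
  \sum_(0 <= i < (d - r).+1) (-1) ^+ i * ('C(r + i, r) * 'C(z, r + i))%:R = (z == r)%:R :> R.
Proof.
move=> le_r le_z.
under eq_bigr do rewrite mulnC -bin_trinomial natrM mulrCA.
rewrite -mulr_sumr; have [lt_zr|lt_rz|->] := ltngtP z r.
- by rewrite bin_small // mul0r.
- rewrite (big_cat_nat (n := (z - r).+1)) //=; last by lia.
  rewrite [X in _ + X]big_nat_cond [X in _ + X]big1 ?addr0; last first.
    by move=> i /andP[/andP[lt_i _] _]; rewrite (bin_small lt_i) mulr0.
  rewrite (_ : \sum_(0 <= i < (z - r).+1) _ = (1 - 1) ^+ (z - r)).
    by rewrite subrr expr0n subn_eq0 leqNgt lt_rz mulr0.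
  rewrite exprDn big_mkord; apply: eq_bigr => i _.
  by rewrite expr1n mul1r mulr_natr.
rewrite binn mul1r subnn big_nat_recl // expr0 bin0 mulr1 big_nat_cond big1 ?addr0 //.
by move=> i _; rewrite bin0n mulr0.
Qed.

Lemma zeros_count_moments r : (r <= d)%N -> (zeros_count r)%:R =
  \sum_(0 <= i < (d - r).+1) (-1) ^+ i * ('C(r + i, r) * moment d (r + i) u)%:R :> R.
Proof.
move=> le_r; rewrite /zeros_count /moment.
transitivity (\sum_(f <- monl F d | theta h f == u) (dom_zeros l t Q f == r)%:R : R).
  elim: (monl F d) => [|f s IH]; first by rewrite big_nil.
  rewrite big_cons /= natrD IH; by case: (theta h f == u) => //=; rewrite add0r.
rewrite big_seq_cond (eq_bigr (fun f => \sum_(0 <= i < (d - r).+1)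
    (-1) ^+ i * ('C(r + i, r) * 'C(dom_zeros l t Q f, r + i))%:R)); last first.
  by move=> f /andP[fd _]; rewrite binomial_inversion // dom_zeros_le.
rewrite -big_seq_cond exchange_big; apply: eq_bigr => i _ /=.
by rewrite -mulr_sumr -natr_sum big_distrr.
Qed.

Definition zeros_main r : R := (\sum_(0 <= i < (d - r).+1) (-1) ^+ i * 'C(n - r, i)%:R * q%:R ^- i)
   * 'C(n, r)%:R * q%:R ^- r.

(** The main term is the same binomial inversion, applied to the model moments ['C(n, j) q^-j]. *)
Lemma zeros_mainE r : zeros_main r =
  \sum_(0 <= i < (d - r).+1) (-1) ^+ i * ('C(r + i, r)%:R * ('C(n, r + i)%:R * q%:R ^- (r + i))).
Proof.
rewrite /zeros_main -mulrA mulr_suml; apply: eq_bigr => i _.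
have := congr1 (fun x => x%:R : R) (bin_trinomial n r i); rewrite !natrM => E.
have T (s a x b y c e : R) : b * a = e * c -> s * a * x * (b * y) = s * (c * (e * (y * x))).
  by move=> E'; transitivity (s * (b * a) * (x * y)); [ring | rewrite E'; ring].
by rewrite (T _ _ _ _ _ _ _ E) exprD invfM.
Qed.

(** The terms are compared in absolute value. Without signs the model sum is at most
    [(1 + 1/q)^(n - r)] times ['C(n, r) q^-r], so giving up cancellation costs at most a factor
    [expR 1]. *)
Lemma sieve_bound (E : R) r : 0 <= E -> (4 <= q)%N -> (r <= d)%N ->
  (forall j, (j <= d)%N ->
    `|(moment d j u)%:R / (q ^ k)%:R - 'C(n, j)%:R * q%:R ^- j| <= E * ('C(n, j)%:R * q%:R ^- j) :> R) ->
  `|(zeros_count r)%:R / (q ^ k)%:R - zeros_main r| <= E * expR 1 * ('C(n, r)%:R * q%:R ^- r).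
Proof.
move=> E0 q4 le_r near; rewrite zeros_count_moments // zeros_mainE mulr_suml -sumrB.
apply: le_trans (ler_norm_sum _ _ _) _.
apply: le_trans (_ : \sum_(0 <= i < (d - r).+1)
    E * ('C(n, r)%:R * q%:R ^- r) * ('C(n - r, i)%:R * q%:R ^- i) <= _); last first.
  rewrite -mulr_sumr mulrAC ler_wpM2r ?mulr_ge0 ?invr_ge0 ?exprn_ge0 // ler_wpM2l //.
  by apply: binomial_sum_le => //; apply: leq_trans (leq_subr _ _) (max_card _).
rewrite big_nat_cond [leRHS]big_nat_cond; apply: ler_sum => i /andP[/andP[_ lt_i] _].
rewrite natrM -!mulrA -mulrBr normrM normrX normrN1 expr1n mul1r -mulrBr normrM ger0_norm ?ler0n //.
apply: le_trans (ler_wpM2l (ler0n _ _) (near (r + i)%N _)) _; first by lia.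
have := congr1 (fun x => x%:R : R) (bin_trinomial n r i); rewrite !natrM => E1.
have T (a x b y c e : R) : b * a = e * c -> c * (E * (e * (y * x))) = E * (b * (y * (a * x))).
  by move=> E'; transitivity (E * (b * a) * (x * y)); [rewrite E'; ring | ring].
by rewrite exprD invfM (T _ _ _ _ _ _ E1).
Qed.

(** A relative error needs the truncated alternating sum bounded below. With [d - r >= 3] it has at
    least four terms, and with [d - r = 0] it is 1. Otherwise [r >= d - 2 >= k - 1], and two terms
    give [1 - (n - r)/q >= r/q >= (k - 1)/q]. *)
Lemma zeros_main_ge (c : R) r : (4 <= q)%N -> (r <= d)%N -> (r <= n)%N ->
  c <= 4^-1 -> c * q%:R <= k%:R - 1 ->
  c * ('C(n, r)%:R * q%:R ^- r) <= zeros_main r.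
Proof.
move=> q4 le_rd le_rn c4 cq; rewrite /zeros_main -[leRHS]mulrA.
have le_nq : (n <= q)%N := max_card _.
have q0 : 0 < q%:R :> R by rewrite ltr0n; lia.
rewrite ler_wpM2r ?mulr_ge0 ?invr_ge0 ?exprn_ge0 //.
have le_mq : (n - r <= q)%N by apply: leq_trans (leq_subr _ _) le_nq.
have [M3|M3] := leqP 3 (d - r); first by apply: le_trans c4 _; apply: alternating_binomial_ge3.
have [M0|M1] := eqVneq (d - r)%N 0%N.
  rewrite M0 big_nat1 bin0 !expr0 invr1 !mulr1 (le_trans c4) // invf_le1 ?ltr0n //.
  by rewrite ler1n.
apply: le_trans (alternating_binomial_ge1 _ q4 le_mq _); last by rewrite ltnS lt0n.
rewrite lerBrDr -(ler_pM2r q0) mulrDl divfK ?gt_eqF // mul1r.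
apply: le_trans (lerD cq (lexx _)) _.
rewrite addrAC lerBlDr -natrD natr1 ler_nat.
move: M3 le_nq le_rn le_rd l_gt0; clear; move: (n) => n; lia.
Qed.
End Sieve.

Section Estimate.
Variables (R : realType) (F : finFieldType) (l k : nat) (Q : {poly F}).
Hypotheses (mQ : Q \is monic) (l_gt0 : (0 < l)%N).
Local Notation q := #|F|.
Local Notation t := (deg Q).
Local Notation n := #|nonzeros Q|.
Local Notation d := (k + t + l)%N.

Let Qt : Q \in monl F t.
Proof. by rewrite mem_monl mQ /deg prednK ?eqxx ?size_poly_gt0 ?monic_neq0. Qed.

Lemma prob_num_zerosE (x0 : F) (eps : set {poly F}) : ~~ root Q x0 -> hayes_classes l Q eps ->
  let Q' := Q \Po ('X + x0%:P) in
  exists2 u, u \in units1 (modulus l t Q') &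
    forall r, prob_num_zeros R Q l k eps r = (zeros_count k u r)%:R / (q ^ k)%:R.
Proof.
move=> Qx0 eps_cl Q'; have le_d : (t + l <= d)%N by rewrite -addnA leq_addl.
have [u uG Hu] := hayes_class_theta Qt Qx0 l_gt0 le_d eps_cl.
have Q't : Q' \in monl F t by rewrite shift_monl.
have Q'0 : Q'`_0 != 0 by rewrite shift_coef0.
exists u => // r; rewrite /prob_num_zeros /unif_on; congr (_%:R / _%:R).
  rewrite (card_monics_in d eps (fun f => num_zeros Q f == r)) /zeros_count.
  rewrite -[in RHS](seq.permP (perm_shift x0 d)) [RHS]count_map; apply: eq_in_count => f fd /=.
  by rewrite Hu // (num_zeros_shift Qt Qx0 l_gt0).
transitivity #|finset (fun f : {poly_(d.+1) F} => (f \in monics_in d eps) && predT (f : {poly F}))|.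
  by apply: eq_card => f; rewrite [RHS]finset.in_set /= andbT.
rewrite card_monics_in.
transitivity (count (fun f => theta (modulus l t Q') f == u) (monl F d)).
  rewrite -[in RHS](seq.permP (perm_shift x0 d)) [RHS]count_map; apply: eq_in_count => f fd /=.
  by rewrite Hu // andbT.
have hm := modulus_monic l t Q'0; have hs := modulus_gt2 Q't Q'0 l_gt0.
have sz : (size (modulus l t Q') - 2 = t + l)%N by rewrite (size_modulus l t Q'0) !subSS subn0.
have u0 : (u : {poly F})`_0 = 1 by move: uG; rewrite inE => /andP[_ /eqP].
rewrite (theta_count hm (ltnW hs) (modulus_coef0 l t Q') (e := d)) ?sz //.
by rewrite -addnA addnK.
Qed.

Lemma main_termE (x0 : F) r : ~~ root Q x0 ->
  main_term R Q l k r = zeros_main R l t k (Q \Po ('X + x0%:P)) r.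
Proof. by move=> Qx0; rewrite /main_term /mu /zeros_main (card_nonzeros Qt Qx0 l_gt0). Qed.

Variables (K : nat) (eta c : R).
Hypotheses (n_gt0 : (0 < n)%N) (K_gt0 : (0 < K)%N) (q4 : (4 <= q)%N) (small_t : (2 * t <= q)%N).
Hypotheses (weil_small : ((K * (t + l).-1) ^ 2 * q <= (K.-1 * n) ^ 2)%N).
Hypotheses (eta0 : 0 <= eta) (c0 : 0 < c) (c4 : c <= 4^-1) (cq : c * q%:R <= k%:R - 1).
Hypotheses (le_dn : (d <= n)%N).
Hypothesis (eta_ge : forall j, (k < j <= d)%N ->
  (q ^ (t + l) * n.+1)%:R ^+ 2 * (K * n ^ 2 - 2 * (n - j) * j)%:R ^+ n <= eta ^+ 2 * (K * n ^ 2)%:R ^+ n :> R).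

Lemma lin_subsets_near (x0 : F) j : ~~ root Q x0 -> (k < j <= d)%N ->
  let h := modulus l t (Q \Po ('X + x0%:P)) in forall u, u \in units1 h ->
  `|(#|units1 h| * lin_subsets j u)%:R - 'C(n, j)%:R| <= eta * 'C(n, j)%:R :> R.
Proof.
move=> Qx0 jkd h u uG.
have Q't : Q \Po ('X + x0%:P) \in monl F t by rewrite shift_monl.
have Q'0 : (Q \Po ('X + x0%:P))`_0 != 0 by rewrite shift_coef0.
have hm := modulus_monic l t Q'0; have hs := modulus_gt2 Q't Q'0 l_gt0.
have h0 := modulus_coef0 l t (Q \Po ('X + x0%:P)).
have En : n = #|lin_dom h| := card_nonzeros Qt Qx0 l_gt0.
have szh : (size h - 3 = (t + l).-1)%N by rewrite (size_modulus l t Q'0) !subSS subn1.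
have leG : (#|units1 h| <= q ^ (t + l))%N.
  by rewrite (card_units1 Q't Q'0 l_gt0) unit_count_le.
have le_jn : (j <= n)%N by case/andP: jkd => _ /leq_trans; apply.
have := @subset_equidistribution _ h hm hs h0 K.
rewrite szh -En => /(_ K_gt0 n_gt0 weil_small j u uG le_jn).
rewrite distn_norm; set D := distn _ _; set C := 'C(n, j).
rewrite -(ler_nat R) => le_D.
have n0R : 0 < n%:R :> R by rewrite ltr0n.
have X0 : 0 < (K * n ^ 2)%:R ^+ n :> R by rewrite exprn_gt0 // ltr0n muln_gt0 K_gt0 expn_gt0 n_gt0.
have C0 : 0 < C%:R :> R by rewrite ltr0n bin_gt0.
rewrite -(@ler_pXn2r _ 2) ?nnegrE ?mulr_ge0 // -(ler_pM2r X0).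
have -> : D%:R ^+ 2 * (K * n ^ 2)%:R ^+ n = (D ^ 2 * (n ^ (2 * n) * K ^ n))%:R :> R.
  by rewrite [in RHS]natrM [in RHS]natrX; congr (_ * _); rewrite -natrX expnMn -expnM mulnC.
apply: le_trans le_D _.
rewrite (_ : _%:R = C%:R ^+ 2 * ((#|units1 h| * n.+1)%:R ^+ 2 * (K * n ^ 2 - 2 * (n - j) * j)%:R ^+ n)); last first.
  rewrite -!natrX -!natrM; congr _%:R; move: (_ ^ n)%N => y.
  have T (a b e z : nat) : (a ^ 2 * (b ^ 2 * e ^ 2 * z) = e ^ 2 * ((a * b) ^ 2 * z))%N by ring.
  exact: T.
rewrite exprMn [_ * C%:R ^+ 2]mulrC -[leRHS]mulrA ler_wpM2l ?exprn_ge0 //.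
apply: le_trans (eta_ge jkd); rewrite ler_wpM2r ?exprn_ge0 //.
by rewrite lerXn2r ?nnegrE // ler_nat leq_mul.
Qed.

Lemma prob_estimate r (eps : set {poly F}) : (r <= d)%N -> hayes_classes l Q eps ->
  exists2 e : R, `|e| <= 2 * (eta + t%:R / q%:R) * expR 1 / c &
    prob_num_zeros R Q l k eps r = (1 + e) * main_term R Q l k r.
Proof.
move=> le_rd eps_cl.
have [x0 Qx0] : exists x0, ~~ root Q x0.
  by have /card_gt0P[x0] := n_gt0; rewrite finset.in_set => Qx0; exists x0.
have Q't : Q \Po ('X + x0%:P) \in monl F t by rewrite shift_monl.
have Q'0 : (Q \Po ('X + x0%:P))`_0 != 0 by rewrite shift_coef0.
have [u uG Hu] := prob_num_zerosE Qx0 eps_cl.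
have En := card_nonzeros Qt Qx0 l_gt0.
have q_gt0 : (0 < q)%N by apply: leq_trans q4.
have q0 : 0 < q%:R :> R by rewrite ltr0n.
set E := 2 * (eta + t%:R / q%:R).
have E0 : 0 <= E by rewrite mulr_ge0 // addr_ge0 // divr_ge0.
have near j : (j <= d)%N -> 
    `|(moment d j u)%:R / (q ^ k)%:R - 'C(n, j)%:R * q%:R ^- j| <= E * ('C(n, j)%:R * q%:R ^- j) :> R.
  move=> le_j; have Eq : (q ^ (d - j))%:R / (q ^ (t + l))%:R / (q ^ k)%:R = q%:R ^- j :> R.
    have nz m : (q ^ m)%:R != 0 :> R by rewrite pnatr_eq0 -lt0n expn_gt0 q_gt0.
    have -> : q%:R ^- j = (q ^ (d - j))%:R / (q ^ d)%:R :> R.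
      by rewrite -[in (q ^ d)%N](subnK le_j) expnD natrM invfM mulrA divff ?nz // mul1r natrX.
    by rewrite -[LHS]mulrA -invfM -natrM -expnD (addnC _ k) addnA.
  have [le_jk|lt_kj] := leqP j k.
    rewrite (moment_small Q't Q'0 l_gt0 uG) -?En; last by rewrite -addnA leq_add2r.
    rewrite -Eq natrM (_ : (d - j - (t + l) = k - j)%N); last by rewrite subnAC -addnA addnK.
    rewrite (_ : (d - j = (k - j) + (t + l))%N); last by rewrite -addnA addnBAC.
    rewrite expnD natrM mulfK; last by rewrite pnatr_eq0 -lt0n expn_gt0 q_gt0.
    by rewrite !mulrA subrr normr0 divr_ge0 // mulr_ge0 // mulr_ge0.
  have := moment_approx (R := R) Q't Q'0 l_gt0 (eta := eta) (j := j) _ small_t eta0 uG le_j.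
  rewrite -En => /(_ (lin_subsets_near Qx0 _)); rewrite lt_kj le_j => /(_ isT) H.
  have k0 : 0 < (q ^ k)%:R :> R by rewrite ltr0n expn_gt0 q_gt0.
  have T (m x y z w : R) : m * z - x * (y * w * z) = (m - x * y * w) * z by ring.
  rewrite -Eq T normrM [`|_^-1|]ger0_norm ?invr_ge0 ?(ltW k0) //.
  have T' (e x y z w : R) : e * (x * (y * w * z)) = e * (x * y * w) * z by ring.
  by rewrite T' ler_wpM2r // invr_ge0 ltW.
have n0 : 0 < ('C(n, r)%:R * q%:R ^- r : R) \/ 'C(n, r) = 0%N.
  have [->|C0] := posnP 'C(n, r); first by right.
  left.
  by rewrite mulr_gt0 ?ltr0n // invr_gt0 exprn_gt0 // ltr0n.
have := sieve_bound (u := u) Q't Q'0 l_gt0 E0 q4 le_rd; rewrite -En => /(_ near).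
rewrite -(Hu r) -(main_termE r Qx0); case: n0 => [B0|C0] le_B; last first.
  (* Here ['C(n, r) = 0], so the error bound is 0 and the probability equals the main term. *)
  exists 0; first by rewrite normr0 divr_ge0 ?(ltW c0) // mulr_ge0 ?expR_ge0.
  by apply/eqP; rewrite addr0 mul1r -subr_eq0 -normr_le0 (le_trans le_B) // C0 mul0r mulr0.
have le_rn : (r <= n)%N.
  by rewrite leqNgt; apply/negP => lt_nr; move: B0; rewrite bin_small // mul0r ltxx.
have := zeros_main_ge (R := R) (k := k) Q't Q'0 l_gt0 (r := r) (c := c).
rewrite -En => /(_ q4 le_rd le_rn c4 cq); rewrite -(main_termE r Qx0) => le_M.
have M0 : 0 < main_term R Q l k r by apply: lt_le_trans le_M; rewrite mulr_gt0.
exists (prob_num_zeros R Q l k eps r / main_term R Q l k r - 1); last first.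
  by rewrite subrKC divfK ?gt_eqF.
have nM : main_term R Q l k r != 0 by rewrite gt_eqF.
rewrite -[X in _ - X](divff nM).
rewrite -mulrBl normrM [`|_^-1|]ger0_norm ?invr_ge0 ?(ltW M0) // ler_pdivrMr //.
apply: le_trans le_B _; rewrite -[leRHS]mulrA ler_wpM2l ?(mulr_ge0 E0) ?expR_ge0 //.
by rewrite [leRHS]mulrC ler_pdivlMr // mulrC.
Qed.
End Estimate.

(** * Asymptotics *)

Section Entropy.
Variable R : realType.
Implicit Types x c : R.

Lemma ln_le_sub1 x : 0 < x -> ln x <= x - 1.
Proof. by move=> x0; have := @le_ln1Dx R (x - 1); rewrite subrKC; apply; rewrite ltrBrDr addNr. Qed.

Definition entropy c : R := c * ln (1 / c) + (1 - c) * ln (1 / (1 - c)).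

Lemma entropyC c : entropy (1 - c) = entropy c.
Proof. by rewrite /entropy subKr addrC. Qed.

Lemma mul_ln_inv_le c : 0 < c -> c * ln (1 / c) <= 1 - c.
Proof.
move=> c0; have := ln_le_sub1 (divr_gt0 ltr01 c0); rewrite -(ler_pM2l c0) mulrBr mulr1.
by rewrite mulrCA divff ?gt_eqF // mulr1.
Qed.

Lemma mul_ln_inv_ge0 c : 0 < c < 1 -> 0 <= c * ln (1 / c).
Proof.
move=> /andP[c0 c1]; rewrite mulr_ge0 ?(ltW c0) // ln_ge0 // div1r invf_ge1 //.
exact: ltW.
Qed.

Lemma entropy_le1 c : 0 < c < 1 -> entropy c <= 1.
Proof.
move=> /andP[c0 c1]; have c1' : 0 < 1 - c by rewrite subr_gt0.
have := lerD (mul_ln_inv_le c0) (mul_ln_inv_le c1').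
by rewrite -/(entropy c) subKr subrK.
Qed.

(** Applying [ln y <= y - 1] to [y = c^(-1/2)] gives [c ln (1/c) <= 2 sqrt c], and the other term is
    at most [c <= sqrt c]. *)
Lemma entropy_le_sqrt c : 0 < c < 1 -> entropy c <= 3 * Num.sqrt c.
Proof.
move=> /andP[c0 c1]; have c1' : 0 < 1 - c by rewrite subr_gt0.
have s0 : 0 < Num.sqrt c by rewrite sqrtr_gt0.
have sc : Num.sqrt c ^+ 2 = c by rewrite sqr_sqrtr // ltW.
have s1 : Num.sqrt c <= 1 by rewrite -[leRHS]sqrtr1 ler_sqrt // ltW.
have := mul_ln_inv_le c1'; rewrite subKr => H2.
have H1 : c * ln (1 / c) <= 2 * Num.sqrt c.
  have -> : 1 / c = (1 / Num.sqrt c) ^+ 2 by rewrite expr_div_n expr1n sc.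
  rewrite lnXn ?divr_gt0 // -[ln _ *+ 2]mulr_natl mulrCA ler_pM2l //.
  rewrite -{1}sc expr2 -mulrA -[leRHS]mulr1 ler_pM2l //.
  by apply: le_trans (mul_ln_inv_le s0) _; rewrite gerBl ltW.
have : c <= Num.sqrt c by rewrite -{1}sc expr2 ler_piMl // ltW.
by rewrite /entropy; lra.
Qed.

(** Applied to [c] and, by symmetry of the entropy, to [1 - c], this keeps [k / q] in a compact part
    of the unit interval. *)
Lemma entropy_gap (delta c : R) : 0 < delta -> 0 < c < 1 -> delta <= entropy c -> delta ^+ 2 / 9 <= c.
Proof.
move=> d0 cc le_d; have := le_trans le_d (entropy_le_sqrt cc); have /andP[c0 _] := cc.
have sc : Num.sqrt c ^+ 2 = c by rewrite sqr_sqrtr // ltW.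
move=> le_s; rewrite ler_pdivrMr //; have : delta ^+ 2 <= (3 * Num.sqrt c) ^+ 2.
  by rewrite lerXn2r ?nnegrE ?mulr_ge0 ?sqrtr_ge0 // ltW.
by rewrite exprMn sc; lra.
Qed.
End Entropy.

Section Conditions.
Variables (R : realType) (F : finFieldType) (Q : {poly F}) (l k : nat).
Hypothesis l_gt0 : (0 < l)%N.

Lemma gammapar_ge0 : 0 <= gammapar R Q l.
Proof.
rewrite /gammapar divr_ge0 // mulr_ge0 ?sqrtr_ge0 // -addrA addr_ge0 // subr_ge0.
by rewrite (ler_nat R 1).
Qed.

(** Dropping the corrections in [p] only enlarges the left side, and on the right
    [ln (2 p) >= ln 4 >= 1]. *)
Lemma conditionA_entropy p (delta : R) : prime p -> conditionA Q l k p delta ->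
  gammapar R Q l + delta <= entropy (cpar R F k).
Proof.
move=> p_pr [[n0 cc] /= H]; have g0 := gammapar_ge0.
have p2 : (2 <= p%:R :> R) by rewrite (ler_nat R 2) prime_gt1.
have p0 : (0 < p%:R :> R) by lra.
have /andP[c0 c1] := cc.
have ln4 : 1 <= ln (2 * p%:R) :> R.
  apply: le_trans (_ : ln (2 ^+ 2) <= _); last by rewrite ler_ln ?posrE; lra.
  rewrite lnXn // -[2]invrK lnV ?posrE ?invr_gt0 //.
  have := @ln_le_sub1 R 2^-1; rewrite invr_gt0 ltr0n => /(_ isT).
  by move: (ln _) => y; lra.
have : gammapar R Q l <= gammapar R Q l * ln (2 * p%:R) by rewrite ler_peMr.
have : 0 <= (1 + cpar R F k) / p%:R * ln (1 + cpar R F k).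
  by rewrite mulr_ge0 ?ln_ge0 ?divr_ge0 //; lra.
have : (p%:R - 1) / p%:R * cpar R F k * ln (1 / cpar R F k) <= cpar R F k * ln (1 / cpar R F k).
  rewrite -[leLHS]mulrA ler_piMl ?mul_ln_inv_ge0 // ler_pdivrMr //; lra.
by rewrite /entropy; move: H; lra.
Qed.

Lemma conditionB_entropy p (delta : R) : conditionB Q l k p delta ->
  gammapar R Q l + delta <= entropy (cpar R F k).
Proof.
move=> [[n0 cc] /= [_ H]]; have g0 := gammapar_ge0; have /andP[c0 c1] := cc.
suff : 0 <= gammapar R Q l * ln ((cpar R F k + gammapar R Q l) / gammapar R Q l).
  by rewrite /entropy; move: H; lra.
(* At [gamma = 0] the quotient inside the logarithm is a default value, but it is multiplied by
   0. *)
have [->|gn] := eqVneq (gammapar R Q l) 0; first by rewrite mul0r.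
have gp : 0 < gammapar R Q l by rewrite lt_def gn.
rewrite mulr_ge0 // ln_ge0 // ler_pdivlMr // mul1r lerDr ltW //.
Qed.
End Conditions.

Section Uniform.
Variable R : realType.

Lemma natr_subn_le a b (y : R) : 0 <= y -> a%:R - b%:R <= y -> (a - b)%:R <= y.
Proof. by move=> y0; have [le_ba|/ltnW] := leqP b a; [rewrite natrB | rewrite -subn_eq0 => /eqP ->]. Qed.

(** The positive terms and the target add up to [4 s^3 + 12 s + s <= 17 s^3], and [68 = 4 * 17]. *)
Lemma decay_exponent (x s : R) : 0 < x -> 1 <= s -> 68 / x <= s ->
  (s ^+ 2 + 3) * (4 * s) - x * s ^+ 4 / 4 <= - s.
Proof.
move=> x0 s1; rewrite ler_pdivrMr // => sx; have s0 : 0 < s by lra.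
have s3 : 0 <= s ^+ 3 by rewrite exprn_ge0 // ltW.
have := ler_wpM2r s3 sx; have := ler_wpM2l (ltW s0) (_ : 1 <= s ^+ 2); rewrite exprn_ege1 // => /(_ isT).
have -> : s * x * s ^+ 3 = x * s ^+ 4 by ring.
have -> : s * s ^+ 2 = s ^+ 3 by ring.
have -> : (s ^+ 2 + 3) * (4 * s) = 4 * s ^+ 3 + 12 * s by ring.
by move: (s ^+ 3) (x * s ^+ 4) => y z; rewrite mulr1; lra.
Qed.

Section Instance.
Variables (F : finFieldType) (Q : {poly F}) (l k K : nat) (delta s : R).
Hypotheses (mQ : Q \is monic) (l_gt0 : (0 < l)%N).
Local Notation q := #|F|.
Local Notation t := (deg Q).
Local Notation n := #|nonzeros Q|.
Local Notation d := (k + t + l)%N.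
Hypotheses (n_gt0 : (0 < n)%N) (cc : 0 < cpar R F k < 1) (delta0 : 0 < delta).
Hypothesis ent : gammapar R Q l + delta <= entropy (cpar R F k).
(** With [s = q^(1/4)] the number of classes costs [e^(O(s^3))], while equidistribution gains
    [e^(- x s^4 / 4)]. *)
Hypotheses (s_def : s = Num.sqrt (Num.sqrt q%:R)) (s1 : 1 <= s).
Local Notation kappa := (delta ^+ 2 / 9).
Local Notation x := (kappa ^+ 2 / K%:R).
Hypotheses (K_delta : 1 <= K%:R * delta) (kappa_s : 10 <= kappa * s) (x_s : 68 / x <= s).

Let s0 : 0 < s. Proof. exact: lt_le_trans s1. Qed.
Let sqrt_q : Num.sqrt q%:R = s ^+ 2. Proof. by rewrite s_def sqr_sqrtr ?sqrtr_ge0. Qed.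
Let q_s : q%:R = s ^+ 4.
Proof. by rewrite -[LHS](@sqr_sqrtr R) // sqrt_q -exprM. Qed.
Let N0 : 0 < n%:R :> R. Proof. by rewrite ltr0n. Qed.
Let T := t%:R + l%:R - 1 : R.
Let T_t : t%:R <= T. Proof. by rewrite /T -addrA lerDl subr_ge0 (ler_nat R 1). Qed.
Let T0 : 0 <= T. Proof. exact: le_trans T_t. Qed.

Let gamma_le : T * s ^+ 2 <= (1 - delta) * n%:R.
Proof.
have := le_trans ent (entropy_le1 cc); rewrite /gammapar sqrt_q -/T -lerBrDr.
by rewrite ler_pdivrMr.
Qed.

Let delta1 : delta <= 1.
Proof.
rewrite -subr_ge0 -(pmulr_lge0 _ N0); apply: le_trans gamma_le.
by rewrite mulr_ge0 // exprn_ge0 // ltW.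
Qed.

Let ent_delta : delta <= entropy (cpar R F k).
Proof. by apply: le_trans ent; rewrite lerDr gammapar_ge0. Qed.

Let kappa0 : 0 < kappa. Proof. by rewrite divr_gt0 ?exprn_gt0. Qed.

Let kappa1 : kappa <= 1 / 9.
Proof. by rewrite ler_wpM2r // expr_le1 // ltW. Qed.

Let s4 : 0 < s ^+ 4. Proof. by rewrite exprn_gt0. Qed.

Let k_ge : kappa * s ^+ 4 <= k%:R.
Proof. by have := entropy_gap delta0 cc ent_delta; rewrite /cpar q_s ler_pdivlMr. Qed.

Let k_le : k%:R <= (1 - kappa) * s ^+ 4.
Proof.
have cc' : 0 < 1 - cpar R F k < 1 by move: cc; lra.
have := entropy_gap delta0 cc' _; rewrite entropyC => /(_ ent_delta).
move=> H; have : cpar R F k <= 1 - kappa by lra.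
by rewrite /cpar q_s ler_pdivrMr.
Qed.

Let N_le : n%:R <= s ^+ 4. Proof. by rewrite -q_s ler_nat max_card. Qed.

Let T_le : T <= s ^+ 2.
Proof.
have s2 : 0 < s ^+ 2 by rewrite exprn_gt0.
rewrite -(ler_pM2r s2) -exprD; apply: le_trans gamma_le _; apply: le_trans N_le.
by rewrite ler_piMl ?(ltW N0) // gerBl ltW.
Qed.

Let N_ge : s ^+ 4 - s ^+ 2 <= n%:R.
Proof.
suff : q%:R <= n%:R + t%:R :> R by rewrite q_s; move: T_le T_t; lra.
rewrite -natrD ler_nat -(cardsC (nonzeros Q)) leq_add2l.
have mQ0 := monic_neq0 mQ; rewrite cardE -ltnS /deg prednK ?size_poly_gt0 //.
apply: max_poly_roots; rewrite ?enum_uniq //.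
by apply/allP => y; rewrite mem_enum !finset.in_set negbK.
Qed.

Let large : 10 * s ^+ 2 <= kappa * s ^+ 4 /\ 1 <= s ^+ 2 /\ 10 * s <= s ^+ 2 * s.
Proof.
have s2 : 1 <= s ^+ 2 by rewrite exprn_ege1.
have s3 : s ^+ 2 <= s ^+ 3 by apply: ler_weXn2l.
have kp := ltW kappa0.
split; last split => //.
- have := ler_wpM2r (exprn_ge0 3 (ltW s0)) kappa_s.
  have -> : kappa * s * s ^+ 3 = kappa * s ^+ 4 by ring.
  by apply: le_trans; rewrite ler_wpM2l.
rewrite ler_pM2r //; have s10 : 10 <= s.
  apply: le_trans kappa_s _; rewrite ler_piMl ?(ltW s0) //; apply: le_trans kappa1 _; lra.
by apply: le_trans s10 _; rewrite expr2 ler_peMl // ltW.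
Qed.

Let q4 : (4 <= q)%N.
Proof.
rewrite -(ler_nat R) q_s; have [H1 [H2 _]] := large; have := kappa1.
have := ler_wpM2r (ltW s4) kappa1; lra.
Qed.

Let d_le : d%:R <= n%:R - (kappa * s ^+ 4 / 2).
Proof.
have Ed : d%:R = k%:R + T + 1 :> R by rewrite !natrD /T; ring.
have [H1 [H2 _]] := large; move: k_le T_le N_ge; rewrite Ed.
have -> : (1 - kappa) * s ^+ 4 = s ^+ 4 - kappa * s ^+ 4 by ring.
by move: H1 H2; move: (s ^+ 4) (s ^+ 2) (kappa * _) => a b e; lra.
Qed.

Let K0 : 0 < K%:R :> R.
Proof. by rewrite -(pmulr_lgt0 _ delta0) (lt_le_trans _ K_delta). Qed.

Let x0 : 0 < x. Proof. by rewrite divr_gt0 // exprn_gt0. Qed.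

Let x1 : x <= 1.
Proof.
have K1 : 1 <= K%:R :> R by rewrite (ler_nat R 1) -(ltr_nat R).
rewrite ler_pdivrMr // mul1r (le_trans _ K1) // expr_le1 ?(ltW kappa0) //.
by apply: le_trans kappa1 _; lra.
Qed.

(** The 4 in the exponent comes from [n >= s^4 / 2] and from the square root, the character bound
    being one for squares. *)
Definition deviation : R := (q ^ (t + l) * q.+1)%:R * expR (- (x * s ^+ 4 / 4)).

(** From [s <= e^s] one gets [q^(t+l+2) <= e^(4 s (t+l+2))], and [t + l + 2 <= s^2 + 3];
    [decay_exponent] then leaves [e^(-s) <= 1/s]. *)
Lemma deviation_le : deviation <= s^-1.
Proof.
have s_exp : s <= expR s by apply: le_trans (expR_ge1Dx s); rewrite lerDr.
apply: le_trans (_ : expR (- s) <= _); last by rewrite expRN lef_pV2 ?posrE ?expR_gt0.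
apply: le_trans (_ : expR ((s ^+ 2 + 3) * (4 * s) - x * s ^+ 4 / 4) <= _); last first.
  by rewrite ler_expR decay_exponent.
rewrite expRD ler_wpM2r ?expR_ge0 //.
apply: le_trans (_ : (q ^ (t + l + 2))%:R <= _).
  rewrite ler_nat [leqRHS]expnD leq_mul //; move: q4; clear; move: (q) => z; nia.
rewrite natrX q_s; apply: le_trans (_ : expR (4 * s) ^+ (t + l + 2) <= _).
  rewrite lerXn2r ?nnegrE ?(ltW s4) ?expR_ge0 // expRM_natl lerXn2r ?nnegrE ?(ltW s0) ?expR_ge0 //.
rewrite -expRM_natl ler_expR ler_wpM2r ?mulr_ge0 ?(ltW s0) //.
by rewrite !natrD; move: T_le; rewrite /T; lra.
Qed.

Let eta_ge j : (k < j <= d)%N ->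
  (q ^ (t + l) * n.+1)%:R ^+ 2 * (K * n ^ 2 - 2 * (n - j) * j)%:R ^+ n
    <= deviation ^+ 2 * (K * n ^ 2)%:R ^+ n :> R.
Proof.
move=> /andP[lt_kj le_jd].
have kj : k%:R <= j%:R :> R by rewrite ler_nat ltnW.
have jd : j%:R <= d%:R :> R by rewrite ler_nat.
have ks0 : 0 <= kappa * s ^+ 4 by rewrite mulr_ge0 // ltW.
have jN : (j <= n)%N by rewrite -(ler_nat R); move: d_le; lra.
(* [j] stays away from both ends: [n - j >= kappa s^4 / 2] and [j >= kappa s^4], while
   [s^4 = q >= n]. *)
have prod_ge : kappa ^+ 2 * n%:R ^+ 2 <= 2 * (n%:R - j%:R) * j%:R.
  apply: le_trans (_ : (kappa * s ^+ 4) * (kappa * s ^+ 4) <= _).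
    have kN : kappa * n%:R <= kappa * s ^+ 4 := ler_wpM2l (ltW kappa0) N_le.
    have kN0 : 0 <= kappa * n%:R := mulr_ge0 (ltW kappa0) (ltW N0).
    by rewrite -exprMn -expr2 lerXn2r ?nnegrE.
  by apply: ler_pM => //; [move: d_le; lra | apply: le_trans kj].
have KN0 : 0 < (K * n ^ 2)%:R :> R by rewrite natrM natrX mulr_gt0 ?exprn_gt0.
have base : (K * n ^ 2 - 2 * (n - j) * j)%:R <= expR (- x) * (K * n ^ 2)%:R :> R.
  apply: le_trans (_ : (1 - x) * (K * n ^ 2)%:R <= _); last first.
    by rewrite ler_wpM2r ?(ltW KN0) // expR_ge1Dx.
  apply: natr_subn_le; first by rewrite mulr_ge0 ?(ltW KN0) // subr_ge0.
  rewrite mulrBl mul1r lerD2l lerN2 [X in x * X]natrM [X in _ * (_ * X)]natrX mulrA divfK ?gt_eqF //.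
  by rewrite !natrM natrB.
have E2 : deviation ^+ 2 = (q ^ (t + l) * q.+1)%:R ^+ 2 * expR (- (x * s ^+ 4 / 2)).
  rewrite exprMn -expRM_natl; congr (_ * expR _); field; by rewrite gt_eqF.
rewrite E2 -mulrA; apply: ler_pM; rewrite ?exprn_ge0 //.
  by rewrite lerXn2r ?nnegrE // ler_nat leq_mul // ltnS max_card.
apply: le_trans (_ : (expR (- x) * (K * n ^ 2)%:R) ^+ n <= _).
  by rewrite lerXn2r ?nnegrE ?mulr_ge0 ?expR_ge0.
rewrite exprMn ler_wpM2r ?exprn_ge0 // -expRM_natl ler_expR mulrN lerN2.
have le_N : s ^+ 4 / 2 <= n%:R by move: N_ge ks0 large => + + [H1 [H2 _]]; have := ler_wpM2r (ltW s4) kappa1; lra.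
by have := ler_wpM2l (ltW x0) le_N; rewrite mulrA [_ * n%:R]mulrC.
Qed.

Lemma uniform_estimate r (eps : set {poly F}) : (r <= d)%N -> hayes_classes l Q eps ->
  exists2 e : R, `|e| <= 16 * expR 1 / kappa / s &
    prob_num_zeros R Q l k eps r = (1 + e) * main_term R Q l k r.
Proof.
move=> le_rd eps_cl; have [H1 [H2 H3]] := large.
have ks : 0 <= kappa * s ^+ 4 by rewrite mulr_ge0 // ltW.
have K_gt0 : (0 < K)%N by rewrite -(ltr_nat R).
have small_t : (2 * t <= q)%N.
  rewrite -(ler_nat R) natrM q_s; have := ler_wpM2r (ltW s4) kappa1; move: T_le T_t; lra.
have weil : ((K * (t + l).-1) ^ 2 * q <= (K.-1 * n) ^ 2)%N.
  have ET : (t + l).-1%:R = T by rewrite /T -natrD -[in RHS](prednK (_ : 0 < t + l)%N) ?addn_gt0 ?l_gt0 ?orbT // -natr1 addrK.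
  have EK : K.-1%:R = K%:R - 1 :> R by rewrite -[in RHS](prednK K_gt0) -natr1 addrK.
  rewrite -(ler_nat R) natrM !natrX !natrM q_s ET EK.
  have -> : (K%:R * T) ^+ 2 * s ^+ 4 = (K%:R * (T * s ^+ 2)) ^+ 2 by ring.
  have K1 : 1 <= K%:R :> R by rewrite (ler_nat R 1).
  have Ts : 0 <= K%:R * (T * s ^+ 2) by rewrite mulr_ge0 // mulr_ge0 ?exprn_ge0 // ltW.
  rewrite lerXn2r ?nnegrE //; first by rewrite mulr_ge0 // subr_ge0.
  apply: le_trans (ler_wpM2l (ltW K0) gamma_le) _.
  by rewrite mulrA ler_wpM2r ?(ltW N0) // mulrBr mulr1 lerD2l lerN2.
have dev0 : 0 <= deviation by rewrite mulr_ge0 ?expR_ge0.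
have c0 : 0 < kappa / 4 by rewrite divr_gt0.
have c4 : kappa / 4 <= 4^-1 by move: kappa1; lra.
have cq : kappa / 4 * q%:R <= k%:R - 1.
  rewrite q_s; have -> : kappa / 4 * s ^+ 4 = kappa * s ^+ 4 / 4 by ring.
  by move: k_ge; lra.
have le_dn : (d <= n)%N by rewrite -(ler_nat R); move: d_le; lra.
have [e le_e Ee] := prob_estimate mQ l_gt0 n_gt0 K_gt0 q4 small_t weil dev0 c0 c4 cq le_dn eta_ge le_rd eps_cl.
exists e => //; apply: le_trans le_e _.
have tq : t%:R / q%:R <= s^-1.
  rewrite q_s ler_pdivrMr //; have -> : s^-1 * s ^+ 4 = s ^+ 3 by rewrite exprS mulKf ?gt_eqF.
  apply: le_trans T_t _; apply: le_trans T_le _; by apply: ler_weXn2l.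
have kn : delta != 0 by rewrite gt_eqF.
have sn : s != 0 by rewrite gt_eqF.
(* The deviation and [t / q] are each at most [1/s], and the main term is bounded below with
   [c = kappa / 4]; hence [2 * 2 * 4 = 16]. *)
have -> : 16 * expR 1 / kappa / s = 2 * (s^-1 + s^-1) * expR 1 / (kappa / 4) by field; rewrite kn sn.
rewrite ler_wpM2r ?invr_ge0 ?(ltW c0) // ler_wpM2r ?expR_ge0 // ler_wpM2l //.
by apply: lerD => //; apply: deviation_le.
Qed.
End Instance.
End Uniform.
Local Open Scope classical_set_scope.

Theorem theorem2 (R : realType) (delta0 : R)
  (p a : nat -> nat) (F : nat -> finFieldType)
  (Q : forall i : nat, {poly F i}) (l k : nat -> nat)
  (delta0_gt0 : 0 < delta0)
  (p_prime : forall i : nat, prime (p i))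
  (cardF : forall i : nat, #|F i| = (p i ^ a i)%N)
  (Q_monic : forall i : nat, Q i \is monic)
  (l_ge1 : forall i : nat, (1 <= l i)%N)
  (k_gt0 : forall i : nat, (0 < k i)%N)
  (k_oo : k i @[i --> \oo] --> \oo)
  (conditions :
    (forall i : nat, conditionA (Q i) (l i) (k i) (p i) delta0) \/
    (p i @[i --> \oo] --> \oo /\
     forall i : nat, conditionB (Q i) (l i) (k i) (p i) delta0)) :
  forall e : R, 0 < e ->
  \forall i \near \oo,
  forall (r : nat) (eps : set {poly F i}),
    (r <= k i + deg (Q i) + l i)%N -> hayes_classes (l i) (Q i) eps ->
    exists2 eta : R, `|eta| < e &
      prob_num_zeros R (Q i) (l i) (k i) eps r =
      (1 + eta) * main_term R (Q i) (l i) (k i) r.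
Proof.
move=> e e0.
have [K K_delta] : exists K : nat, 1 <= K%:R * delta0.
  exists (Num.bound delta0^-1); rewrite -ler_pdivrMr // div1r ltW //.
  by apply: archi_boundP; rewrite invr_ge0 ltW.
have K0 : 0 < K%:R :> R by rewrite -(pmulr_lgt0 _ delta0_gt0) (lt_le_trans _ K_delta).
pose kappa := delta0 ^+ 2 / 9; pose x := kappa ^+ 2 / K%:R.
have kappa0 : 0 < kappa by rewrite divr_gt0 ?exprn_gt0.
have x0 : 0 < x by rewrite divr_gt0 ?exprn_gt0.
have C0 : 0 < 16 * expR 1 / kappa by rewrite divr_gt0 // mulr_gt0 // expR_gt0.
(* [S] collects every threshold to be passed by [q^(1/4)], including the last one, which brings the
   error below [e]. *)
pose S := 2 + 10 / kappa + 68 / x + 16 * expR 1 / kappa / e.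
have [S1 [S2 [S3 S4]]] : 1 < S /\ 10 / kappa <= S /\ 68 / x <= S /\ 16 * expR 1 / kappa / e < S.
  have := divr_ge0 (ler0n R 10) (ltW kappa0); have := divr_ge0 (ler0n R 68) (ltW x0).
  have := divr_ge0 (ltW C0) (ltW e0); rewrite /S.
  move: (10 / kappa) (68 / x) (16 * expR 1 / kappa / e) => a1 a2 a3; lra.
(* Since [c < 1] means [k < q], large [k] makes [q] large: [S ^+ 4 <= k] gives [S <= q^(1/4)]. *)
have k_large : \forall i \near \oo, (Num.bound (S ^+ 4) <= k i)%N.
  exact: k_oo _ (nbhs_infty_ge (Num.bound (S ^+ 4))).
apply: (filterS _ k_large) => i le_k r eps le_r eps_cl; clear k_large.
have [n_gt0 cc] : params_defined R (Q i) (k i) by case: conditions => [/(_ i)[]//|[_ /(_ i)[]]].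
have ent : gammapar R (Q i) (l i) + delta0 <= entropy (cpar R (F i) (k i)).
  case: conditions => [/(_ i)|[_ /(_ i)]]; first exact: (conditionA_entropy (l_ge1 i) (p_prime i)).
  exact: (conditionB_entropy (l_ge1 i)).
set s : R := Num.sqrt (Num.sqrt #|F i|%:R).
have q0 : 0 < #|F i|%:R :> R by rewrite ltr0n; apply/card_gt0P; exists 0.
have S0 : 0 <= S by rewrite ltW // (lt_trans ltr01).
have S_s : S <= s.
  have S4q : S ^+ 4 <= #|F i|%:R.
    apply: le_trans (ltW (archi_boundP (exprn_ge0 4 S0))) _.
    apply: le_trans (_ : (k i)%:R <= _); first by rewrite ler_nat.
    by case/andP: cc => _; rewrite /cpar ltr_pdivrMr // mul1r => /ltW.
  have -> : S = Num.sqrt (Num.sqrt (S ^+ 4)).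
    by rewrite (exprM S 2 2) sqrtr_sqr ger0_norm ?exprn_ge0 // sqrtr_sqr ger0_norm.
  by rewrite !ler_wsqrtr.
have s1 : 1 <= s by apply: le_trans (ltW S1) S_s.
have s0 : 0 < s by apply: lt_le_trans s1.
have kappa_s : 10 <= kappa * s by rewrite mulrC -ler_pdivrMr // (le_trans S2).
have [eta le_eta E] := uniform_estimate (Q_monic i) (l_ge1 i) n_gt0 cc delta0_gt0 ent
  erefl s1 K_delta kappa_s (le_trans S3 S_s) le_r eps_cl.
exists eta => //; apply: le_lt_trans le_eta _.
by rewrite ltr_pdivrMr // [ltRHS]mulrC -ltr_pdivrMr // (lt_le_trans S4).
Qed.
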